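(* Assume that $\mu>p_2\mu^*$ and that $0\notin\overline\omega$. There is no constant $C$ such that for all $\epsilon>0$ and all $u_0\in L^2(\Omega)$ $$\inf_{f} J^\epsilon_{u_0}(f)\le C\,\|u_0\|_{L^2(\Omega)}^2,$$ where the infimum is over all $f\in L^2((0,T);H^{-1}(\Omega))$ localized in $\omega$, i.e. such that $\vartheta f=0$ in $L^2((0,T);H^{-1}(\Omega))$ for every $\vartheta\in\mathcal{D}(\Omega\setminus\overline\omega)$.
   Context: Let $n\ge3$, $T>0$, and let $\Omega\subset\mathbb{R}^n$ be a bounded domain with $0\in\Omega$ and $\partial\Omega\in C^2$; $\omega\subset\Omega$ is a non-empty open set. The coefficient satisfies $p\in C^3(\overline\Omega)$, $0<p_1\le p(x)\le p_2$, $|\nabla p(x)|\le p_3$ for $x\in\overline\Omega$, with constants $0<p_1\le p_2$, $p_3\ge0$. Put $\mu^*=(n-2)^2/4$; $\mu$ is a real constant. $\mathcal{D}(U)$ denotes the smooth compactly supported functions on $U$. For $\epsilon>0$, $u_0\in L^2(\Omega)$ and $f\in L^2((0,T);H^{-1}(\Omega))$, let $u$ be the solution of the (well-posed) problem $$\begin{cases}\partial_tu-\mathrm{div}(p(x)\nabla u)-\frac{\mu}{|x|^2+\epsilon^2}u=f & \text{in }\Omega\times(0,T),\\ u=0 &\text{on }\partial\Omega\times(0,T),\\ u(\cdot,0)=u_0&\text{in }\Omega,\end{cases}$$ and define $$J^\epsilon_{u_0}(f)=\frac12\int_0^T\!\!\int_\Omega|u(x,t)|^2\,dx\,dt+\frac12\int_0^T\|f(t)\|^2_{H^{-1}(\Omega)}\,dt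 .$$ *)

(* Defs.v *)
From HB Require Import structures.
From mathcomp Require Import all_boot all_order all_algebra.
From mathcomp Require Import all_classical all_reals all_analysis.

Set Implicit Arguments.
Unset Strict Implicit.
Unset Printing Implicit Defensive.

Import Order.TTheory GRing.Theory Num.Theory.
Import numFieldNormedType.Exports.

Local Open Scope classical_set_scope.
Local Open Scope ring_scope.

Definition row_display : measure_display.
Proof. exact: default_measure_display. Qed.

Section row_measurable.
Context (R : realType) (n : nat).

Definition row_coord (i : 'I_n) (x : 'rV[R]_n) : measurableTypeR R := x ord0 i.

Let row_set0 : g_sigma_preimage row_coord set0.
Proof. exact: sigma_algebra0. Qed.

Let row_setC A : g_sigma_preimage row_coord A ->
  g_sigma_preimage row_coord (~` A).
Proof. exact: sigma_algebraC. Qed.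

Let row_bigcup (F : (set 'rV[R]_n)^nat) :
  (forall i, g_sigma_preimage row_coord (F i)) ->
  g_sigma_preimage row_coord (\bigcup_i (F i)).
Proof. exact: sigma_algebra_bigcup. Qed.

(* The sigma-algebra on R^n generated by the coordinates (the Borel one). *)
HB.instance Definition _ := @isMeasurable.Build row_display
  'rV[R]_n (g_sigma_preimage row_coord) row_set0 row_setC row_bigcup.

End row_measurable.

Section row_cons.
Context (R : realType) (n : nat).

Definition row_cons (z : measurableTypeR R * 'rV[R]_n) : 'rV[R]_n.+1 :=
  row_mx (z.1%:M : 'rV[R]_1) z.2.

Lemma measurable_row_coord m (i : 'I_m) :
  measurable_fun [set: 'rV[R]_m] (@row_coord R m i).
Proof.
move=> _ Y mY; rewrite setTI; apply: sub_sigma_algebra => /=.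
rewrite -bigcup_seq/=; exists i => /=; first by rewrite mem_index_enum.
by exists Y => //; rewrite setTI.
Qed.

Lemma measurable_row_cons : measurable_fun setT row_cons.
Proof.
apply: (@measurability _ _ _ _ _ _
  (\big[setU/set0]_(i < n.+1) preimage_set_system setT (@row_coord R n.+1 i) measurable)) => //.
move=> _ [B + <-]; rewrite -bigcup_seq => -[i _ [Y mY <-]].
rewrite !setTI; case: (split_ordP (i : 'I_(1 + n))) => j ij.
- rewrite (_ : _ @^-1` _ = (fst @^-1` Y)); last first.
    apply/seteqP; split=> z /=; rewrite /row_coord /row_cons ij;
    by rewrite (@row_mxEl R 1 1 n) (ord1 j) mxE eqxx mulr1n.
  by rewrite -[X in measurable X]setTI; exact: measurable_fst.
- rewrite (_ : _ @^-1` _ = ((@row_coord R n j \o snd) @^-1` Y)); last first.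
    by apply/seteqP; split=> z /=; rewrite /row_coord /row_cons ij
      (@row_mxEr R 1 1 n).
  rewrite -[X in measurable X]setTI.
  have mc : measurable_fun setT (@row_coord R n j \o
      (snd : measurableTypeR R * 'rV[R]_n -> _)).
    by apply: measurableT_comp => //; exact: measurable_row_coord.
  exact: mc.
Qed.

End row_cons.

Section lebesgue_rV.
Context (R : realType).

(* n-dimensional Lebesgue measure, by induction on R^(n+1) = R x R^n. *)
Fixpoint lebesgue_rV (n : nat) : set 'rV[R]_n -> \bar R :=
  match n with
  | 0%N => \d_(0 : 'rV[R]_0)
  | m.+1 => pushforward (lebesgue_measure \x^ @lebesgue_rV m)%E (@row_cons R m)
  end.
Arguments lebesgue_rV n : clear implicits.

Lemma lebesgue_rV_measure n :
  exists mu : {measure set 'rV[R]_n -> \bar R}, lebesgue_rV n = mu.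
Proof.
elim: n => [|n [mu muE]]; first by exists (\d_(0 : 'rV[R]_0)).
pose nu : {measure set (measurableTypeR R * 'rV[R]_n) -> \bar R} :=
  (@lebesgue_measure R \x^ mu)%E.
pose M : {measure set 'rV[R]_n.+1 -> \bar R} :=
  HB.pack (pushforward nu (@row_cons R n)).
by exists (M (@measurable_row_cons R n)); rewrite /= muE.
Qed.

Let lebesgue_rV0 n : lebesgue_rV n set0 = 0%E.
Proof. by have [mu ->] := lebesgue_rV_measure n; rewrite measure0. Qed.

Let lebesgue_rV_ge0 n A : (0 <= lebesgue_rV n A)%E.
Proof. by have [mu ->] := lebesgue_rV_measure n. Qed.

Let lebesgue_rV_sigma_additive n : semi_sigma_additive (lebesgue_rV n).
Proof.
by have [mu ->] := lebesgue_rV_measure n; exact: measure_semi_sigma_additive.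
Qed.

HB.instance Definition _ n := isMeasure.Build _ _ _ (lebesgue_rV n)
  (lebesgue_rV0 n) (@lebesgue_rV_ge0 n) (@lebesgue_rV_sigma_additive n).

End lebesgue_rV.
Arguments lebesgue_rV {R} n.

Section calculus.
Context (R : realType).

Definition enorm (n : nat) (x : 'rV[R]_n) : R :=
  Num.sqrt (\sum_(i < n) x ord0 i ^+ 2).

Definition edot (n : nat) (x y : 'rV[R]_n) : R :=
  \sum_(i < n) x ord0 i * y ord0 i.

Definition partial (n : nat) (i : 'I_n) (f : 'rV[R]_n -> R) : 'rV[R]_n -> R :=
  'D_(delta_mx ord0 i) f.

Definition partials (n : nat) (s : seq 'I_n) (f : 'rV[R]_n -> R) :
  'rV[R]_n -> R := foldr (@partial n) f s.

(* f is of class C^k on the open set U *)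
Fixpoint Ck (n k : nat) (U : set 'rV[R]_n) (f : 'rV[R]_n -> R) : Prop :=
  (forall x, U x -> {for x, continuous f}) /\
  if k is k'.+1 then
    forall i : 'I_n, (forall x, U x -> derivable f x (delta_mx ord0 i)) /\
      Ck k' U (partial i f)
  else True.

(* f is of class C^k on U, and f and all its partial derivatives of order at
   most k extend continuously from U to its closure; the values of f on the
   boundary are those of its extension. *)
Definition Ck_closure (n k : nat) (U : set 'rV[R]_n) (f : 'rV[R]_n -> R) :=
  [/\ Ck k U f, {within closure U, continuous f} &
    forall s : seq 'I_n, (size s <= k)%N ->
      exists2 g : 'rV[R]_n -> R, {within closure U, continuous g} &
        forall x, U x -> g x = partials s f x].

(* The gradient of a function of class C^1 on the closure of U: at a boundary
   point it is the limit of the gradient from inside U. *)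
Definition grad_closure (n : nat) (U : set 'rV[R]_n) (f : 'rV[R]_n -> R)
  (x : 'rV[R]_n) : 'rV[R]_n :=
  \row_i lim (partial i f @ within U (nbhs x)).

(* Locally, up to relabelling and reorienting the coordinate axes, U is the
   region above the graph of a C^k function of the other n - 1 coordinates. *)
Definition Ck_boundary (n k : nat) (U : set 'rV[R]_n) :=
  forall x0, (closure U `\` U) x0 ->
    exists r : R, exists i : 'I_n, exists b : bool,
    exists g : 'rV[R]_n.-1 -> R,
      [/\ 0 < r, Ck k setT g &
        forall x, enorm (x - x0) < r ->
          (U x <-> g (col' i x) < (-1) ^+ b * x ord0 i)].

Definition domain (n : nat) (U : set 'rV[R]_n) :=
  [/\ open U, connected U & U !=set0].

(* \mathcal{D}(U) *)
Definition test_fun (n : nat) (U : set 'rV[R]_n) : set ('rV[R]_n -> R) :=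
  [set f | [/\ forall k, Ck k setT f,
    compact (closure [set x | f x != 0]) &
    closure [set x | f x != 0] `<=` U]].

End calculus.

Section function_spaces.
Context (R : realType) (n : nat) (Omega : set 'rV[R]_n).
Local Notation E := 'rV[R]_n.
Local Notation leb := (@lebesgue_rV R n).

(* Elements of L^2, H^1, H^1_0 are given by representatives, i.e. by Borel
   functions, of which only the values on Omega matter. *)

Definition L2norm2 (v : E -> R) : \bar R :=
  (\int[leb]_(x in Omega) (v x ^+ 2)%:E)%E.

Definition L2 : set (E -> R) :=
  [set v | measurable_fun Omega v /\ (L2norm2 v < +oo)%E].

Definition L2dot (v w : E -> R) : R := \int[leb]_(x in Omega) (v x * w x).

Definition is_weak_partial (i : 'I_n) (v g : E -> R) :=
  L2 g /\ forall phi, test_fun Omega phi ->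
    L2dot v (partial i phi) = - L2dot g phi.

(* The weak derivative, unique almost everywhere in Omega. *)
Definition weak_partial (i : 'I_n) (v : E -> R) : E -> R :=
  xget (fun=> 0) [set g | is_weak_partial i v g].

Definition weak_grad (v : E -> R) (x : E) : E := \row_i weak_partial i v x.

Definition H1 : set (E -> R) :=
  [set v | L2 v /\ forall i, exists g, is_weak_partial i v g].

Definition gradnorm2 (v : E -> R) : \bar R :=
  (\int[leb]_(x in Omega) (enorm (weak_grad v x) ^+ 2)%:E)%E.

(* H^1_0(Omega): the closure of D(Omega) in H^1(Omega) *)
Definition H10 : set (E -> R) :=
  [set v | H1 v /\ forall e : R, 0 < e ->
    exists2 phi, test_fun Omega phi &
      (L2norm2 (v - phi)%R + gradnorm2 (v - phi)%R < e%:E)%E].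

(* On the bounded set Omega this is a norm on H^1_0(Omega), equivalent to that
   of H^1(Omega) by the Poincare inequality. *)
Definition H10norm (v : E -> R) : \bar R := (gradnorm2 v `^ 2^-1)%E.

(* H^{-1}(Omega), the continuous linear forms on H^1_0(Omega); the values of
   the form outside H^1_0(Omega) are irrelevant. *)
Definition Hm1 : set ((E -> R) -> R) :=
  [set l | (forall (a : R) v w, H10 v -> H10 w ->
              l (fun x => a * v x + w x) = a * l v + l w) /\
           exists M : R, forall v, H10 v -> (`|l v|%:E <= M%:E * H10norm v)%E].

Definition Hm1norm (l : (E -> R) -> R) : \bar R :=
  ereal_sup [set `|l v|%:E | v in [set v | H10 v /\ (H10norm v <= 1)%E]].

End function_spaces.

Section bochner.
Context (R : realType) (V : zmodType) (S : set V) (nrm : V -> \bar R).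

Definition simple_valued (s : measurableTypeR R -> V) :=
  [/\ finite_set (range s), range s `<=` S &
      forall y, measurable (s @^-1` [set y])].

Definition strongly_measurable (D : set R) (f : R -> V) :=
  exists2 s : nat -> R -> V, (forall k, simple_valued (s k)) &
    forall t, D t -> nrm (s k t - f t) @[k --> \oo] --> 0%E.

(* L^2((0,T); S) in the sense of Bochner.  Elements are given by Borel
   representatives: a strongly measurable function in the almost everywhere
   sense is equal, outside of a null set, to a function which is everywhere a
   limit of simple functions. *)
Definition L2_time (T : R) : set (R -> V) :=
  [set f | [/\ forall t, t \in `]0, T[ -> S (f t),
    strongly_measurable [set` `]0, T[] f &
    (\int[lebesgue_measure]_(t in [set` `]0%R, T[]) (nrm (f t) ^+ 2)
       < +oo)%E]].

End bochner.

Section control_problem.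
Context (R : realType) (n : nat) (Omega : set 'rV[R]_n).
Variables (T : R) (p : 'rV[R]_n -> R) (mu : R).
Local Notation E := 'rV[R]_n.
Local Notation leb := (@lebesgue_rV R n).

Definition L2H10 : set (R -> E -> R) := L2_time (H10 Omega) (H10norm Omega) T.

Definition L2Hm1 : set (R -> (E -> R) -> R) :=
  L2_time (Hm1 Omega) (Hm1norm Omega) T.

(* The bilinear form on H^1_0(Omega) associated with the operator
   v |-> - div (p grad v) - mu / (|x|^2 + eps^2) v *)
Definition energy_form (eps : R) (v w : E -> R) : R :=
  \int[leb]_(x in Omega)
    (p x * edot (weak_grad Omega v x) (weak_grad Omega w x)
     - mu / (enorm x ^+ 2 + eps ^+ 2) * v x * w x).

(* Weak solutions of the initial-boundary value problem: u belongs to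
   L^2((0,T); H^1_0(Omega)), and the equation is tested against psi(t) w(x),
   with w in H^1_0(Omega) and psi of class C^1 with psi(T) = 0, the time
   derivative and the initial condition being taken into account by an
   integration by parts in time. *)
Definition weak_solution (eps : R) (u0 : E -> R) (f : R -> (E -> R) -> R)
    (u : R -> E -> R) :=
  L2H10 u /\
  forall (w : E -> R) (psi : R -> R), H10 Omega w ->
    (forall t, derivable psi t 1) -> continuous (derive1 psi) -> psi T = 0 ->
    \int[lebesgue_measure]_(t in [set` `]0, T[])
      (- (L2dot Omega (u t) w * derive1 psi t)
       + energy_form eps (u t) w * psi t)
    = L2dot Omega u0 w * psi 0 +
      \int[lebesgue_measure]_(t in [set` `]0, T[]) (f t w * psi t).

(* theta f = 0 in L^2((0,T); H^{-1}(Omega)) for every theta in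
   D(Omega \ closure omega), where <theta f(t), v> = <f(t), theta v> *)
Definition localized (omega : set E) (f : R -> (E -> R) -> R) :=
  forall theta, test_fun (Omega `\` closure omega) theta ->
    {ae lebesgue_measure, forall t : measurableTypeR R, t \in `]0, T[ ->
      forall v, H10 Omega v -> f t (fun x => theta x * v x) = 0}.

Definition cost (f : R -> (E -> R) -> R) (u : R -> E -> R) : \bar R :=
  (2^-1%:E *
     (\int[lebesgue_measure]_(t in [set` `]0%R, T[]) L2norm2 Omega (u t)) +
   2^-1%:E *
     (\int[lebesgue_measure]_(t in [set` `]0%R, T[])
        (Hm1norm Omega (f t) ^+ 2)))%E.

(* inf J^eps_{u0}(f) over the controls f localized in omega; u is the solution
   associated with f. *)
Definition inf_cost (omega : set E) (eps : R) (u0 : E -> R) : \bar R :=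
  ereal_inf [set y | exists f u, [/\ L2Hm1 f, localized omega f,
    weak_solution eps u0 f u & y = cost f u]].

End control_problem.

(* Main.v *)
Require Import Defs.
From HB Require Import structures.
From mathcomp Require Import all_boot all_order all_algebra.
From mathcomp Require Import all_classical all_reals all_analysis.
From mathcomp Require Import measurable_realfun.
From mathcomp Require Import ring lra.

Set Implicit Arguments.
Unset Strict Implicit.
Unset Printing Implicit Defensive.

Import Order.TTheory GRing.Theory Num.Theory.
Import numFieldNormedType.Exports.

Local Open Scope classical_set_scope.
Local Open Scope ring_scope.

(** The operator - div (p grad) - mu/(|x|^2 + eps^2) is bounded below for each
    eps > 0, but its lowest eigenvalue tends to minus infinity as eps tends to
    0: since mu > p2 mu*, the optimality of the constant mu* in Hardy's
    inequality provides test functions concentrated at 0 of arbitrarily negative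
    energy ([hardy_test]). Let - Lam be the bottom of the spectrum and let the
    initial datum be a normalised function w of nearly minimal energy
    ([ground_level]). Without control the solution grows like e^(Lam t), and a
    control supported away from 0 hardly acts on w, which is concentrated at 0;
    so the cost cannot remain bounded.

    Quantitatively, the equation is tested against psi(t) w(x) with
    psi(t) = (1 - t/T) e^(- Lam t). If w were an exact eigenfunction, the terms
    - (u, w) psi' - Lam (u, w) psi would add up to (u, w) e^(- Lam t)/T, and the
    weak formulation would read
      int (u, w) e^(- Lam t)/T dt = |w|^2 + int f(w) psi dt.
    By Young's inequality the first integral is at most a small multiple of the
    cost plus C/Lam. So is the second one: f does not see th w, where th is
    a cutoff equal to 1 at 0 and supported away from the control region, and the
    gradient of w - th w is bounded independently of eps and Lam
    ([localisation], a localisation formula). As Lam tends to infinity with a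
    bounded cost, |w|^2 = 1 is contradicted.

    Spectral theory is avoided by a perturbation argument: w is replaced by a
    test function w' that nearly minimises Q(z) + |z - w|^2, Q being the energy
    form at the level Lam ([near_minimizer]). It satisfies the Euler equation
    Q(w', v) + (w' - w, v) = 0 for v in H^1_0 up to an error sigma (1 + |v|^2)
    in the H^1 norm ([euler_H10]). The term (w' - w, u) is treated like (u, w),
    and sigma is sent to 0 last, for a fixed eps, with the help of the finite
    integral of the gradient of u.

    The functions of time in the statement, such as the squared L^2 norm of
    u(t) or the dual norm of f(t), are not known to be measurable. Their
    integrals are lower integrals, which are monotone, and additive when one of
    the two terms is measurable ([Rintegral_lower_bound]); this suffices once
    the gradient norm is shown to be measurable ([measurable_gradnorm2]). *)

(** * Lebesgue measure on R^n *)

Lemma rV_ballP (R : realType) n (c x : 'rV[R]_n) (r : R) :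
  ball c r x <-> 0 < r /\ forall i, `|c ord0 i - x ord0 i| < r.
Proof.
split=> -[r0 h]; split=> // i; first exact: h.
move=> j.
by rewrite (ord1 i); exact: h.
Qed.

(** Balls are those of the sup norm on row vectors, hence cubes: finite
    intersections of preimages of intervals under the coordinates. *)
Lemma measurable_rV_ball (R : realType) n (c : 'rV[R]_n) (r : R) :
  measurable (ball c r).
Proof.
have [r0|r0] := ltP 0 r; last first.
  rewrite (_ : ball c r = set0)// -subset0 => x /rV_ballP[r1].
  by move: (lt_le_trans r1 r0); rewrite ltxx.
rewrite (_ : ball c r =
    \bigcap_(i in [set: 'I_n]) (row_coord i @^-1` ball (c ord0 i) r)).
  apply: fin_bigcap_measurable => // i _.
  rewrite -[X in measurable X]setTI.
  exact: (@measurable_row_coord R n i measurableT (ball (c ord0 i) r)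
    (open_measurable (@ball_open _ _ _ _))).
apply/seteqP; split=> x.
  by move=> /rV_ballP[_ h] i _; exact: h.
by move=> h; apply/rV_ballP; split=> // i; exact: h.
Qed.

Lemma rV_rat_ball (R : realType) n (x : 'rV[R]_n) (e : R) : 0 < e ->
  exists q : 'rV[rat]_n, ball (map_mx ratr q : 'rV[R]_n) e x.
Proof.
move=> e0.
have /choice[q qE] : forall i : 'I_n,
    exists q : rat, `|ratr q - x ord0 i| < e.
  move=> i; have := @rat_in_itvoo R (x ord0 i - e) (x ord0 i + e).
  case=> [|q]; first by lra.
  rewrite in_itv/= => /andP[h1 h2]; exists q.
  by rewrite ltr_norml; apply/andP; split; lra.
exists (\row_i q i); apply/rV_ballP; split=> // i.
by rewrite !mxE; exact: qE.
Qed.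

(** Cubes with rational centres and radii 1/(k+1) form a countable base. *)
Lemma measurable_rV_open (R : realType) n (U : set 'rV[R]_n) :
  open U -> measurable U.
Proof.
move=> oU.
pose B (z : 'rV[rat]_n * nat) : set 'rV[R]_n :=
  if pselect (ball (map_mx ratr z.1 : 'rV[R]_n) z.2.+1%:R^-1 `<=` U)
  then ball (map_mx ratr z.1 : 'rV[R]_n) z.2.+1%:R^-1 else set0.
suff -> : U = \bigcup_z B z.
  apply: countable_bigcupT_measurable; first exact: countableP.
  move=> z; rewrite /B; case: pselect => /= _; last exact: measurable0.
  exact: measurable_rV_ball.
apply/seteqP; split; last first.
  by move=> x [z _]; rewrite /B; case: pselect => //= h /h.
move=> x Ux; have /nbhs_ballP[e /= e0 xeU] : nbhs x U by exact: open_nbhs_nbhs.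
have [k ke] : exists k : nat, k.+1%:R^-1 < e / 2.
  exists (Num.truncn (e / 2)^-1).
  rewrite -[ltRHS]invrK ltf_pV2 ?posrE ?invr_gt0 ?divr_gt0//.
  exact: truncnS_gt.
have [q xq] : exists q : 'rV[rat]_n, ball (map_mx ratr q : 'rV[R]_n) k.+1%:R^-1 x.
  exact: rV_rat_ball.
exists (q, k) => //; rewrite /B; case: pselect => //= h; exfalso; apply: h.
move=> y qy; apply: xeU.
apply: (@le_ball _ _ _ (k.+1%:R^-1 + k.+1%:R^-1)); first by rewrite [leRHS]splitr lerD// ltW.
exact: ball_triangle (ball_sym xq) qy.
Qed.

Lemma continuous_measurable_rV (R : realType) n (f : 'rV[R]_n -> R) :
  continuous f -> measurable_fun setT f.
Proof.
move=> cf; apply: (measurability _ (RGenOpens.measurableE R)).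
move=> _ [_ [a [b ->] <-]]; rewrite setTI; apply: measurable_rV_open.
by apply: open_comp => // x _; exact: cf.
Qed.

Lemma continuous_in_measurable_rV (R : realType) n (U : set 'rV[R]_n)
    (f : 'rV[R]_n -> R) : open U ->
  (forall x, U x -> {for x, continuous f}) -> measurable_fun U f.
Proof.
move=> oU cf; apply: (measurability _ (RGenOpens.measurableE R)).
move=> _ [_ [a [b ->] <-]]; apply: measurable_rV_open.
rewrite openE => x [Ux xab]; apply: filterI; first exact: open_nbhs_nbhs.
by apply: cf => //; apply: open_nbhs_nbhs; split => //; exact: interval_open.
Qed.

Lemma row_cons_head (R : realType) n (s : R) (z : 'rV[R]_n) :
  row_cons (s, z) ord0 ord0 = s.
Proof.
rewrite /row_cons /= (_ : ord0 = lshift n (ord0 : 'I_1) :> 'I_n.+1).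
  by rewrite (@row_mxEl R 1 1 n) mxE eqxx mulr1n.
exact: val_inj.
Qed.

Lemma row_cons_tail (R : realType) n (s : R) (z : 'rV[R]_n) (i : 'I_n) :
  row_cons (s, z) ord0 (lift ord0 i) = z ord0 i.
Proof.
rewrite /row_cons /= (_ : lift ord0 i = rshift 1 i :> 'I_n.+1).
  by rewrite (@row_mxEr R 1 1 n).
exact: val_inj.
Qed.

Lemma row_cons_ball (R : realType) n (c : 'rV[R]_n.+1) (r : R) : 0 < r ->
  @row_cons R n @^-1` ball c r =
  ball (c ord0 ord0) r `*` ball (col' ord0 c) r.
Proof.
move=> r0; apply/seteqP; split=> -[s z].
  move=> /rV_ballP[_ h]; split=> /=.
    by have := h ord0; rewrite row_cons_head.
  apply/rV_ballP; split=> // i; have := h (lift ord0 i).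
  by rewrite row_cons_tail mxE.
move=> [/= h1 /rV_ballP[_ h2]]; apply/rV_ballP; split=> // i.
case: (unliftP ord0 i) => [j|] ->; last by rewrite row_cons_head.
by rewrite row_cons_tail; have := h2 j; rewrite mxE.
Qed.

Lemma lebesgue_rV_ball (R : realType) n (c : 'rV[R]_n) (r : R) : 0 < r ->
  lebesgue_rV n (ball c r) = ((r *+ 2) ^+ n)%:E.
Proof.
move=> r0; elim: n c => [|n ih] c /=.
  rewrite expr0 diracE mem_set//.
  by apply/rV_ballP; split=> // i; have := ltn_ord i.
rewrite /pushforward row_cons_ball// product_measure2E//=.
- by rewrite (lebesgue_measure_ball _ (ltW r0)) ih -EFinM exprS.
- by apply: open_measurable; exact: ball_open.
- exact: measurable_rV_ball.
Qed.

Section lebesgue_rV_sigma_finite.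
Context (R : realType) (n : nat).

Let sf : sigma_finite setT (@lebesgue_rV R n).
Proof.
exists (fun k : nat => ball (0 : 'rV[R]_n) k.+1%:R).
  apply/seteqP; split=> // x _.
  exists (Num.truncn `|x|) => //; rewrite -ball_normE/= sub0r normrN.
  exact: truncnS_gt.
move=> k; split; first exact: measurable_rV_ball.
by rewrite lebesgue_rV_ball// ltry.
Qed.

HB.instance Definition _ := @Measure_isSigmaFinite.Build _ _ _
  (@lebesgue_rV R n) sf.

End lebesgue_rV_sigma_finite.

Lemma bounded_lebesgue_rV_lty (R : realType) n (A : set 'rV[R]_n) :
  measurable A -> bounded_set A -> (lebesgue_rV n A < +oo)%E.
Proof.
move=> mA [M [_ hM]].
have h x : A x -> `|x| < Num.max M 0 + 2.
  move=> Ax; apply: (@le_lt_trans _ _ (Num.max M 0 + 1)); last by lra.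
  by apply: (hM (Num.max M 0 + 1)) => //; rewrite ltr_pwDr// le_max lexx.
have r0 : 0 < Num.max M 0 + 2 by rewrite ltr_wpDl// le_max lexx orbT.
apply: (@le_lt_trans _ _ (lebesgue_rV n (ball 0 (Num.max M 0 + 2)))).
  apply: le_measure; rewrite ?inE//; first exact: measurable_rV_ball.
  by move=> x /h; rewrite -ball_normE/= sub0r normrN.
by rewrite lebesgue_rV_ball// ltry.
Qed.

(** * Integration over lines, and integrals of derivatives *)

(** The form in which integrability is obtained throughout: domination by a
    multiple of the indicator of a set of finite measure. *)
Lemma bounded_support_integrable d (T : measurableType d) (R : realType)
    (m : {measure set T -> \bar R}) (D A : set T) (f : T -> R) (M : R) :
  measurable D -> measurable A -> (m A < +oo)%E -> measurable_fun D f ->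
  (forall x, D x -> `|f x| <= M * \1_A x) ->
  m.-integrable D (EFin \o f).
Proof.
move=> mD mA Afin mf hf.
apply: (@le_integrable _ _ _ m D mD _ (fun x => (M * \1_A x)%:E)).
- exact/measurable_EFinP.
- move=> x Dx; rewrite !abse_EFin lee_fin; apply: le_trans (hf x Dx) _.
  exact: ler_norm.
- apply: (@integrableS _ _ _ m setT) => //.
  under eq_fun do rewrite EFinM.
  apply: integrableZl => //; apply/integrableP; split.
    exact/measurable_EFinP.
  under eq_integral do rewrite gee0_abs ?lee_fin//.
  by rewrite integral_indic// setIT.
Qed.

(** The measure on R^(n+1) is the image of a product measure, so that Fubini's
    theorem transfers; the first coordinate can be integrated first or last. *)
Section fubini_rV.
Context (R : realType) (n : nat) (f : 'rV[R]_n.+1 -> R) (M K : R).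
Hypotheses (mf : measurable_fun setT f)
  (fM : forall x, `|f x| <= M * \1_(ball (0 : 'rV[R]_n.+1) K) x) (K0 : 0 < K).

Local Notation leb := (@lebesgue_measure R).
Local Notation lebn := (@lebesgue_rV R n).

Let g := f \o @row_cons R n.

Let mg : measurable_fun setT g.
Proof. by apply: measurableT_comp => //; exact: measurable_row_cons. Qed.

Let A : set (measurableTypeR R * 'rV[R]_n) := ball (0 : R) K `*` ball (0 : 'rV[R]_n) K.

Let mb : measurable (ball (0 : R) K : set (measurableTypeR R)).
Proof. by apply: open_measurable; exact: ball_open. Qed.

Let mA : measurable A.
Proof. by apply: measurableX; [exact: mb|exact: measurable_rV_ball]. Qed.

Let AE z : \1_(ball (0 : 'rV[R]_n.+1) K) (row_cons z) = \1_A z :> R.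
Proof.
have := @row_cons_ball R n 0 K K0.
rewrite !mxE (_ : col' ord0 0 = 0 :> 'rV[R]_n) => [E|].
  by rewrite /A -E !indicE.
by apply/matrixP => i j; rewrite !mxE.
Qed.

Let gM z : `|g z| <= M * \1_A z.
Proof. by rewrite -AE; exact: fM. Qed.

Let Afin : ((leb \x lebn) A < +oo)%E.
Proof.
rewrite /A product_measure1E; [|exact: mb|exact: measurable_rV_ball].
rewrite [X in (X * _)%E](_ : _ = (K *+ 2)%:E).
  by rewrite /= lebesgue_rV_ball// -EFinM ltry.
exact: (lebesgue_measure_ball _ (ltW K0)).
Qed.

Let Afin2 : ((leb \x^ lebn) A < +oo)%E.
Proof.
rewrite /A product_measure2E; [|exact: mb|exact: measurable_rV_ball].
rewrite [X in (X * _)%E](_ : _ = (K *+ 2)%:E).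
  by rewrite /= lebesgue_rV_ball// -EFinM ltry.
exact: (lebesgue_measure_ball _ (ltW K0)).
Qed.

Let ig : (leb \x lebn)%E.-integrable setT (EFin \o g).
Proof. exact: (@bounded_support_integrable _ _ _ _ _ A _ M). Qed.

Let ig2 : (leb \x^ lebn)%E.-integrable setT (EFin \o g).
Proof. exact: (@bounded_support_integrable _ _ _ _ _ A _ M). Qed.

Let pushE : (\int[lebesgue_rV n.+1]_x (f x)%:E =
  \int[(leb \x^ lebn)]_z (g z)%:E)%E.
Proof.
rewrite [LHS](@integral_pushforward _ _ _ _ _ _ (@measurable_row_cons R n)
  (leb \x^ lebn)%E setT (EFin \o f)) ?preimage_setT//.
exact/measurable_EFinP.
Qed.

Lemma integral_rV_head_tail : (\int[lebesgue_rV n.+1]_x (f x)%:E =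
  \int[leb]_s \int[lebn]_z (f (row_cons (s, z)))%:E)%E.
Proof. by rewrite pushE -integral12_prod_meas2. Qed.

Lemma integral_rV_tail_head : (\int[lebesgue_rV n.+1]_x (f x)%:E =
  \int[lebn]_z \int[leb]_s (f (row_cons (s, z)))%:E)%E.
Proof. by rewrite pushE -integral21_prod_meas2. Qed.

End fubini_rV.

(** Differentiation along a line commutes with an affine change of variables. *)
Lemma derivable_affine (R : numFieldType) (V W X : normedModType R)
    (phi : V -> W) (f : W -> X) (a v : V) (w : W) :
  (forall h : R, phi (h *: v + a) = h *: w + phi a) ->
  (derivable (f \o phi) a v = derivable f (phi a) w) *
  ('D_v (f \o phi) a = 'D_w f (phi a)).
Proof.
move=> phiE; suff E : (fun h => h^-1 *: (((f \o phi) \o shift a) (h *: v) -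
    (f \o phi) a)) = (fun h => h^-1 *: ((f \o shift (phi a)) (h *: w) -
    f (phi a))).
  by rewrite /derivable /derive E.
by apply/funext => h /=; rewrite phiE.
Qed.

Lemma row_cons_shift_head (R : realType) n (s h : R) (z : 'rV[R]_n) :
  row_cons (h + s, z) = h *: delta_mx ord0 ord0 + row_cons (s, z).
Proof.
apply/rowP => i.
rewrite [RHS]mxE [X in _ = X + _]mxE [X in _ = _ * X + _]mxE.
case: (unliftP ord0 i) => [j|] ->.
  by rewrite !row_cons_tail eqxx/= mulr0 add0r.
by rewrite !row_cons_head eqxx mulr1.
Qed.

Lemma row_cons_shift_tail (R : realType) n (s h : R) (z : 'rV[R]_n) j :
  row_cons (s, h *: delta_mx ord0 j + z) =
  h *: delta_mx ord0 (lift ord0 j) + row_cons (s, z).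
Proof.
apply/rowP => i.
rewrite [RHS]mxE [X in _ = X + _]mxE [X in _ = _ * X + _]mxE.
case: (unliftP ord0 i) => [k|] ->.
  by rewrite !row_cons_tail !mxE eqxx/= (inj_eq lift_inj).
by rewrite !row_cons_head eqxx/= mulr0 add0r.
Qed.

Lemma continuous_row_cons_head (R : realType) n (z : 'rV[R]_n) :
  continuous (fun s : R => row_cons (s, z)).
Proof.
move=> s; apply/cvg_ballP => e e0.
have : nbhs s (ball s e) by exact: nbhsx_ballx.
apply: filterS => t st; apply/rV_ballP; split=> // i.
case: (unliftP ord0 i) => [j|] ->.
  by rewrite !row_cons_tail subrr normr0.
by rewrite !row_cons_head.
Qed.

Lemma continuous_row_cons_tail (R : realType) n (s : R) :
  continuous (fun z : 'rV[R]_n => row_cons (s, z)).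
Proof.
move=> z; apply/(@cvg_ballP _ _ _ _ (nbhs_filter z)) => e e0; near=> t.
have /rV_ballP[_ zt] : ball z e t by near: t; exact: nbhsx_ballx.
apply/rV_ballP; split=> // i.
case: (unliftP ord0 i) => [j|] ->.
  by rewrite !row_cons_tail.
by rewrite !row_cons_head subrr normr0.
Unshelve. all: by end_near. Qed.

Lemma partial_out_ball (R : realType) n (i : 'I_n) (f : 'rV[R]_n -> R) K :
  (forall x, K <= `|x| -> f x = 0) -> forall x, K < `|x| -> partial i f x = 0.
Proof.
move=> f0 x Kx; rewrite /partial (@near_eq_derive _ _ _ f (cst 0)).
  exact: derive_cst.
have : \forall y \near x, K < `|y|.
  by apply: (@cvgr_gt _ _ _ (nbhs_filter x) _ `|x|) => //; exact: norm_continuous.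
by apply: filterS => y /ltW /f0.
Qed.

Lemma continuous_rV_bounded (R : realType) n (f : 'rV[R]_n -> R) (K : R) :
  continuous f -> exists2 M, 0 < M & forall x, `|x| <= K -> `|f x| <= M.
Proof.
move=> cf; pose A := [set x : 'rV[R]_n | `|x| <= K].
have cA : compact A.
  apply: bounded_closed_compact.
    exists K; split; first exact: num_real.
    by move=> r Kr x /= h; apply: le_trans h (ltW Kr).
  rewrite (_ : A = (fun x => `|x|) @^-1` [set x | x <= K])//.
  apply: closed_comp; last exact: closed_le.
  by move=> x _; exact: norm_continuous.
have [A0|/set0P[x0 Ax0]] := eqVneq A set0.
  exists 1 => // x xA; suff : A x by rewrite A0.
  exact: xA.
have [c _ hc] := @compact_EVT_max _ _ (fun x => `|f x|) A (ex_intro _ x0 Ax0) cA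
  (continuous_subspaceT (fun x => cvg_norm (cf x))).
exists (`|f c| + 1) => [|x xK]; first by rewrite ltr_wpDl.
by apply: le_trans (hc x _) _; rewrite ?inE// lerDl.
Qed.

Lemma integral_derive1_compact (R : realType) (g : R -> R) (K : R) :
  0 < K ->
  (forall s, derivable g s 1) -> continuous (derive1 g) ->
  (forall s, K <= `|s| -> g s = 0) ->
  (\int[lebesgue_measure]_s (derive1 g s)%:E = 0)%E.
Proof.
move=> K0 dg cg g0.
have cgs : continuous g.
  by move=> s; exact/differentiable_continuous/derivable1_diffP.
have dg0 s : K < `|s| -> derive1 g s = 0.
  move=> Ks; rewrite derive1E (@near_eq_derive _ _ _ g (cst 0)).
    exact: derive_cst.
  have : \forall y \near s, K < `|y|.
    by apply: (@cvgr_gt _ _ _ (nbhs_filter s) _ `|s|) => //; exact: norm_continuous.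
  by apply: filterS => y /ltW /g0.
rewrite (_ : (fun s => _) = (fun s => (derive1 g s)%:E) \_ `[- K, K]).
  rewrite -integral_mkcond (@continuous_FTC2 _ _ g).
  - by rewrite !g0 ?normrN ?gtr0_norm// subee.
  - by rewrite gtrN.
  - exact: continuous_subspaceT.
  - split=> [s _||]; first exact: dg.
      by apply: cvg_at_right_filter; exact: cgs.
    by apply: cvg_at_left_filter; exact: cgs.
  - by [].
apply/funext => s; rewrite patchE; case: ifPn => // sK.
rewrite dg0//; move: sK; rewrite notin_setE/= in_itv/= => /negP.
by rewrite -ler_norml -ltNge.
Qed.

(** Integrating first along the direction of the derivative reduces the claim
    to the fundamental theorem of calculus on the line. *)
Lemma integral_partial_compact (R : realType) n (i : 'I_n)
    (f : 'rV[R]_n -> R) (K : R) : 0 < K ->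
  (forall x, derivable f x (delta_mx ord0 i)) -> continuous (partial i f) ->
  (forall x, K <= `|x| -> f x = 0) ->
  (\int[lebesgue_rV n]_x (partial i f x)%:E = 0)%E.
Proof.
move=> K0; elim: n i f => [[]//|n ih] i f df cf f0.
have [M M0 hM] := continuous_rV_bounded (K + 1) cf.
have fM x : `|partial i f x| <= M * \1_(ball (0 : 'rV[R]_n.+1) (K + 1)) x.
  rewrite indicE; case: (boolP (x \in _)) => [|].
    rewrite inE -ball_normE/= sub0r normrN mulr1 => xK.
    exact/hM/ltW.
  rewrite notin_setE/= -ball_normE/= sub0r normrN mulr0 => /negP.
  rewrite -leNgt => Kx; rewrite (partial_out_ball i f0) ?normr0//.
  by apply: lt_le_trans Kx; rewrite ltrDl.
have mf := continuous_measurable_rV cf.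
have K1 : 0 < K + 1 by rewrite addr_gt0.
case: (unliftP ord0 i) => [j|] iE.
(* The direction i is among the last n coordinates: induction on n. *)
- rewrite (integral_rV_head_tail mf fM K1).
  apply: integral0_eq => s _.
  have phiE z (h : R) : row_cons (s, h *: delta_mx ord0 j + z) =
    h *: delta_mx ord0 i + row_cons (s, z) by rewrite iE row_cons_shift_tail.
  have E z := derivable_affine f (phiE z).
  rewrite (_ : (fun z => _) = (fun z : 'rV[R]_n =>
      (partial j (f \o (fun z => row_cons (s, z))) z)%:E)); last first.
    by apply/funext => z; rewrite /partial (E z).2.
  apply: ih => [z||z Kz]; first by rewrite (E z).1.
    rewrite (_ : partial j _ = partial i f \o (fun z => row_cons (s, z))).
      by move=> z; apply: continuous_comp;
        [exact: continuous_row_cons_tail|exact: cf].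
    by apply/funext => z; rewrite /partial/= (E z).2.
  apply: f0; apply: le_trans Kz _.
  rewrite leNgt; apply/negP => h.
  have : ball (0 : 'rV[R]_n.+1) `|z| (row_cons (s, z)).
    by rewrite -ball_normE/= sub0r normrN.
  move=> /rV_ballP[z0 hz].
  suff : ball (0 : 'rV[R]_n) `|z| z by rewrite -ball_normE/= sub0r normrN ltxx.
  apply/rV_ballP; split=> // k; have := hz (lift ord0 k).
  by rewrite row_cons_tail !mxE.
(* The direction i is the first coordinate: calculus on the line. *)
- rewrite (integral_rV_tail_head mf fM K1).
  apply: integral0_eq => z _.
  have phiE s (h : R) : row_cons (h *: 1 + s, z) =
    h *: delta_mx ord0 i + row_cons (s, z).
    by rewrite iE -row_cons_shift_head [h *: 1]mulr1.
  have E s := @derivable_affine _ R _ _ (fun s => row_cons (s, z)) f s 1 _ (phiE s).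
  have E1 : derive1 (f \o (fun s => row_cons (s, z))) =
      partial i f \o (fun s => row_cons (s, z)).
    by apply/funext => s; rewrite derive1E/= /partial (E s).2.
  rewrite (_ : (fun s => _) = (fun s =>
      (derive1 (f \o (fun s => row_cons (s, z))) s)%:E)); last first.
    by apply/funext => s; rewrite E1.
  apply: (integral_derive1_compact K0) => [s||s Ks].
  + by rewrite (E s).1.
  + rewrite E1 => s; apply: continuous_comp;
      [exact: continuous_row_cons_head|exact: cf].
  + apply: f0; apply: le_trans Ks _.
    rewrite leNgt; apply/negP => h.
    have : ball (0 : 'rV[R]_n.+1) `|s| (row_cons (s, z)).
      by rewrite -ball_normE/= sub0r normrN.
    move=> /rV_ballP[_ /(_ ord0)]; rewrite mxE row_cons_head sub0r normrN.
    by rewrite ltxx.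
Qed.

(** * Smooth functions of one variable *)

Section smooth1.
Context (R : realType).
Implicit Types (F G : R -> R) (s : R).

Definition smooth1 F := forall k s, derivable (iter k (@derive1 R R) F) s 1.

(** Smoothness is proved by coinduction: it is enough to exhibit a class of
    functions that contains F and is stable under differentiation. *)
Lemma smooth1_coind (P : (R -> R) -> Prop) F :
  (forall G, P G -> exists2 dG, (forall s : R, is_derive s (1 : R) G (dG s)) & P dG) ->
  P F -> smooth1 F.
Proof.
move=> hP PF k; suff [G PG ->] : exists2 G, P G & iter k (@derive1 R R) F = G.
  by have [dG hG _] := hP _ PG => s; exact: ex_derive.
elim: k => [|k [G PG E]]; first by exists F.
have [dG hG PdG] := hP _ PG; exists dG => //=; rewrite E.
by apply/funext => s; rewrite derive1E derive_val.
Qed.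

Lemma smooth1_derivable F s : smooth1 F -> derivable F s 1.
Proof. by move=> /(_ 0%N); exact. Qed.

Lemma smooth1_derive1 F : smooth1 F -> smooth1 (derive1 F).
Proof. by move=> sF k s; have := sF k.+1 s; rewrite iterSr. Qed.

Lemma smooth1_is_derive F s : smooth1 F -> is_derive s 1 F (derive1 F s).
Proof.
by move=> /(@smooth1_derivable _ s) h; rewrite derive1E; exact: derivableP.
Qed.

Lemma smooth1_continuous F : smooth1 F -> continuous F.
Proof.
move=> sF s; apply/differentiable_continuous/derivable1_diffP.
exact: smooth1_derivable.
Qed.

Lemma is_derive1D F G s dF dG : is_derive (s : R) (1 : R) F dF -> is_derive s (1 : R) G dG ->
  is_derive s 1 (fun t => F t + G t) (dF + dG).
Proof. exact: is_deriveD. Qed.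

Lemma is_derive1M F G s dF dG : is_derive (s : R) (1 : R) F dF -> is_derive s (1 : R) G dG ->
  is_derive s 1 (fun t => F t * G t) (F s * dG + G s * dF).
Proof. exact: is_deriveM. Qed.

(** Sums, products and compositions of smooth functions have derivatives of
    the same kind, so this class is stable under differentiation. *)
Inductive smooth1_gen : (R -> R) -> Prop :=
| smooth1_gen_base F : smooth1 F -> smooth1_gen F
| smooth1_gen_id : smooth1_gen id
| smooth1_gen_cst c : smooth1_gen (cst c)
| smooth1_genD F G : smooth1_gen F -> smooth1_gen G ->
    smooth1_gen (fun s => F s + G s)
| smooth1_genM F G : smooth1_gen F -> smooth1_gen G ->
    smooth1_gen (fun s => F s * G s)
| smooth1_gen_comp F G : smooth1 F -> smooth1_gen G -> smooth1_gen (F \o G).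

Lemma smooth1_gen_smooth1 F : smooth1_gen F -> smooth1 F.
Proof.
move=> gF; apply: (smooth1_coind (P := smooth1_gen)) gF => {}F; elim => {F}.
- move=> F sF; exists (derive1 F) => [s|]; first exact: smooth1_is_derive.
  by apply: smooth1_gen_base; exact: smooth1_derive1.
- exists (cst 1) => [s|]; last exact: smooth1_gen_cst.
  exact: is_derive_id.
- move=> c; exists (cst 0) => [s|]; first exact: is_derive_cst.
  exact: smooth1_gen_cst.
- move=> F G _ [dF hF gF] _ [dG hG gG]; exists (fun s => dF s + dG s).
    by move=> s; exact: is_derive1D.
  exact: smooth1_genD.
- move=> F G gF [dF hF gdF] gG [dG hG gdG].
  exists (fun s => F s * dG s + G s * dF s).
    by move=> s; exact: is_derive1M.
  by apply: smooth1_genD; exact: smooth1_genM.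
- move=> F G sF gG [dG hG gdG]; exists (fun s => derive1 F (G s) * dG s).
    move=> s; apply: is_derive1_comp => //; exact: smooth1_is_derive.
  apply: smooth1_genM => //; apply: smooth1_gen_comp => //.
  exact: smooth1_derive1.
Qed.

Lemma smooth1_sin : smooth1 sin.
Proof.
apply: (smooth1_coind (P := fun F => exists a b,
    F = fun s => a * sin s + b * cos s)); last first.
  by exists 1, 0; apply/funext => s; rewrite mul1r mul0r addr0.
move=> _ [a [b ->]]; exists (fun s => - b * sin s + a * cos s); last first.
  by exists (- b), a.
move=> s; apply: (is_derive_eq (is_derive1D
  (is_derive1M (is_derive_cst a s 1) (is_derive_sin s))
  (is_derive1M (is_derive_cst b s 1) (is_derive_cos s)))).
by rewrite /=; ring.
Qed.

Lemma smooth1_cos : smooth1 cos.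
Proof.
rewrite (_ : cos = (fun s => derive1 sin s)).
  exact/smooth1_derive1/smooth1_sin.
by apply/funext => s; rewrite derive1E derive_val.
Qed.

(** From e^(x/N) >= 1 + x/N, raised to a power that beats both x^k and x^m. *)
Lemma poly_expR_decay (p : {poly R}) m :
  exists2 C, 0 <= C & forall x, 0 < x -> `|p.[x]| * expR (- x) <= C * x ^- m.
Proof.
have mono k : exists2 C, 0 <= C &
    forall x : R, 0 < x -> x ^+ k * expR (- x) <= C * x ^- m.
  exists ((k + m).+1%:R ^+ (k + m)) => [|x x0]; first exact: exprn_ge0.
  rewrite ler_pdivlMr ?exprn_gt0// mulrAC -exprD expRN.
  rewrite ler_pdivrMr ?expR_gt0//.
  have q0 : 0 < x / (k + m).+1%:R by rewrite divr_gt0.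
  apply: (@le_trans _ _ ((k + m).+1%:R ^+ (k + m) *
      (1 + x / (k + m).+1%:R) ^+ (k + m))).
    rewrite -exprMn lerXn2r ?nnegrE ?mulr_ge0// ?ltW// ?addr_gt0//.
    by rewrite mulrDr mulrCA divff ?pnatr_eq0// !mulr1 ltrDr.
  rewrite ler_wpM2l ?exprn_ge0//.
  apply: (@le_trans _ _ (expR (x / (k + m).+1%:R) ^+ (k + m))).
    by rewrite lerXn2r ?nnegrE ?expR_ge0 ?addr_ge0// ?(ltW q0)// expR_ge1Dx.
  rewrite -expRM_natr ler_expR -mulrA ler_piMr ?(ltW x0)//.
  by rewrite mulrC ler_pdivrMr// mul1r ler_nat.
have /choice[c_ hc] : forall k, exists C, 0 <= C /\
    forall x : R, 0 < x -> x ^+ k * expR (- x) <= C * x ^- m.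
  by move=> k; have [E ? ?] := mono k; exists E.
exists (\sum_(i < size p) `|p`_i| * c_ i) => [|x x0].
  by apply: sumr_ge0 => i _; rewrite mulr_ge0// (hc _).1.
rewrite horner_coef !mulr_suml.
apply: (@le_trans _ _ (\sum_(i < size p) `|p`_i| * x ^+ i * expR (- x))).
  rewrite -mulr_suml ler_wpM2r ?expR_ge0//.
  apply: (le_trans (ler_norm_sum _ _ _)).
  by apply: ler_sum => i _; rewrite normrM [`|x ^+ i|]ger0_norm// exprn_ge0// ltW.
apply: ler_sum => i _; rewrite -!mulrA ler_wpM2l//.
exact: (hc _).2.
Qed.

(** The family that makes the standard flat function smooth: it contains
    exp(-1/s) and is stable under differentiation. *)
Definition flat (p : {poly R}) (s : R) : R :=
  if 0 < s then p.[s^-1] * expR (- s^-1) else 0.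

Lemma flat_quadratic p : exists2 C, 0 <= C & forall s, `|flat p s| <= C * s ^+ 2.
Proof.
have [C C0 hC] := poly_expR_decay p 2; exists C => // s; rewrite /flat.
case: ifPn => [s0|_]; last by rewrite normr0 mulr_ge0// sqr_ge0.
rewrite normrM (ger0_norm (expR_ge0 _)).
by have := hC s^-1; rewrite invr_gt0 exprVn invrK; exact.
Qed.

(** This gives the derivative of the flat functions at the origin, where
    their two branches meet. *)
Lemma is_derive_quadratic F C :
  (forall s, `|F s| <= C * s ^+ 2) -> is_derive (0 : R) 1 F 0.
Proof.
move=> hF; have F0 : F 0 = 0.
  by apply/eqP; rewrite -normr_le0; have := hF 0; rewrite expr0n/= mulr0.
have C0 : 0 <= C by have := hF 1; rewrite expr1n mulr1; exact: le_trans.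
suff h : (fun h => h^-1 *: ((F \o shift 0) (h *: 1) - F 0)) @ 0^' --> (0 : R).
  split; first by apply/cvg_ex; exists 0.
  exact: cvg_lim.
apply/cvgrPdist_le => e e0; near=> h.
have h0 : h != 0 by near: h; exact: nbhs_dnbhs_neq.
rewrite sub0r normrN /= F0 subr0 addr0 [h *: 1]mulr1 normrM normfV.
rewrite ler_pdivrMl ?normr_gt0//; apply: le_trans (hF h) _.
have : `|h| <= e / (C + 1).
  by near: h; apply: dnbhs0_le; rewrite divr_gt0// ltr_wpDl.
rewrite ler_pdivlMr ?ltr_wpDl// => he.
rewrite -(real_normK (num_real h)) expr2 mulrCA ler_wpM2l//.
by apply: le_trans he; rewrite mulrC ler_wpM2l// lerDl.
Unshelve. all: by end_near. Qed.

Lemma flat_neg p s : s <= 0 -> flat p s = 0.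
Proof. by rewrite /flat ltNge => ->. Qed.

Lemma is_derive_flat p s : is_derive s 1 (flat p) (flat ('X^2 * (p - p^`())) s).
Proof.
have [s0|s0|->] := ltgtP s 0; last first.
- rewrite flat_neg//; have [C _ hC] := flat_quadratic p.
  exact: is_derive_quadratic hC.
- refine (@near_eq_is_derive R _ _ (fun t : R => p.[t^-1] * expR (- t^-1))
    (flat p) s 1 _ _ _).
    have : \forall t \near s, 0 < t by exact: lt_nbhsr.
    by apply: filterS => t t0; rewrite /flat t0.
  have dV : is_derive s 1 (fun t : R => t^-1) (- s ^- 2 *: 1).
    by apply: is_deriveV; rewrite gt_eqF.
  apply: (is_derive_eq (is_derive1M
    (is_derive1_comp (is_derive_poly p s^-1) dV)
    (is_derive1_comp (is_derive_expR _) (is_deriveN dV)))).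
  rewrite /flat s0 !hornerE /= -[X in expR X]/(- s^-1).
  rewrite [(- s ^- 2)%:A]mulr1 -exprVn; ring.
- rewrite flat_neg ?ltW//.
  refine (@near_eq_is_derive R _ _ (cst 0) (flat p) s 1 _ _ (is_derive_cst _ _ _)).
  have : \forall t \near s, t < 0 by exact: lt_nbhsl.
  by apply: filterS => t t0; rewrite flat_neg// ltW.
Qed.

Lemma smooth1_flat p : smooth1 (flat p).
Proof.
apply: (smooth1_coind (P := fun F => exists q, F = flat q)); last by exists p.
move=> _ [q ->]; exists (flat ('X^2 * (q - q^`()))); last by eexists.
exact: is_derive_flat.
Qed.

End smooth1.

(** * Smooth functions and test functions on R^n *)

Section smooth.
Context (R : realType) (n : nat).
Implicit Types f g : 'rV[R]_n -> R.
Local Notation e_ i := (delta_mx (ord0 : 'I_1) (i : 'I_n) : 'rV[R]_n).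

Definition smooth f := forall k, Ck k setT f.

(** As on the line, by coinduction on a class stable under partial
    differentiation. *)
Lemma smooth_coind (P : ('rV[R]_n -> R) -> Prop) f :
  (forall g, P g -> continuous g /\ forall i, exists2 dg,
    (forall x, is_derive x (e_ i) g (dg x)) & P dg) ->
  P f -> smooth f.
Proof.
move=> hP + k; elim: k f => [|k ih] f Pf /=.
  by split=> // x _; exact: (hP _ Pf).1.
split=> [x _|i]; first exact: (hP _ Pf).1.
have [dg hdg Pdg] := (hP _ Pf).2 i; split=> [x _|]; first exact: ex_derive.
rewrite (_ : partial i f = dg); first exact: ih.
by apply/funext => x; rewrite /partial derive_val.
Qed.

Lemma smooth_continuous f : smooth f -> continuous f.
Proof. by move=> /(_ 0%N)[/= cf _] x; exact: cf. Qed.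

Lemma smooth_measurable f (D : set 'rV[R]_n) : smooth f -> measurable_fun D f.
Proof.
move=> sf; apply: measurable_funTS; apply: continuous_measurable_rV.
exact: smooth_continuous.
Qed.

Lemma smooth_derivable f x i : smooth f -> derivable f x (e_ i).
Proof. by move=> /(_ 1%N)[_ /(_ i)[+ _]]; exact. Qed.

Lemma smooth_partial f i : smooth f -> smooth (partial i f).
Proof. by move=> sf k; have [_ /(_ i)[]] := sf k.+1. Qed.

Lemma smooth_is_derive f x i : smooth f -> is_derive x (e_ i) f (partial i f x).
Proof. by move=> sf; apply: derivableP; exact: smooth_derivable. Qed.

Lemma is_derive_fD f g x v df dg : is_derive x v f df -> is_derive x v g dg ->
  is_derive x v (fun y => f y + g y) (df + dg).
Proof. exact: is_deriveD. Qed.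

Lemma is_derive_fM f g x v df dg : is_derive x v f df -> is_derive x v g dg ->
  is_derive x v (fun y => f y * g y) (f x * dg + g x * df).
Proof. exact: is_deriveM. Qed.

(** Restricting f to the line through x in the direction v reduces the claim
    to the chain rule on R. *)
Lemma is_derive_fcomp (F : R -> R) f x v dF df :
  is_derive (f x) 1 F dF -> is_derive x v f df ->
  is_derive x v (fun y => F (f y)) (dF * df).
Proof.
move=> hF hf.
have aff (G : 'rV[R]_n -> R) := @derivable_affine _ R _ _
  (fun t : R => t *: v + x) G 0 1 v.
have shE h : (h *: 1 + 0) *: v + x = h *: v + (0 *: v + x).
  by rewrite addr0 scale0r add0r [h *: 1]mulr1.
have [d1 d2] := aff f shE; have [d3 d4] := aff (fun y => F (f y)) shE.
move: d1 d2 d3 d4; rewrite scale0r add0r => d1 d2 d3 d4.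
have hl : is_derive (0 : R) 1 (f \o (fun t : R => t *: v + x)) df.
  by split; rewrite ?d1 ?d2; [exact: ex_derive|exact: derive_val].
have hF' : is_derive ((f \o (fun t : R => t *: v + x)) 0) 1 F dF.
  by rewrite /= scale0r add0r.
have := is_derive1_comp hF' hl => -[h1 h2].
by split; [rewrite -d3|rewrite -d4].
Qed.

Lemma is_derive_coord (i j : 'I_n) x :
  is_derive x (e_ j) (fun y : 'rV[R]_n => y ord0 i) ((i == j)%:R).
Proof.
have phiE (h : R) : (fun y : 'rV[R]_n => y ord0 i) (h *: e_ j + x) =
    h *: (i == j)%:R + x ord0 i by rewrite !mxE eqxx.
have [h1 h2] := @derivable_affine R _ R R
  (fun y : 'rV[R]_n => y ord0 i : R) id x (e_ j) _ phiE.
by split; [rewrite h1; exact: derivable_id|rewrite h2 derive_id].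
Qed.

Inductive smooth_gen : ('rV[R]_n -> R) -> Prop :=
| smooth_gen_base f : smooth f -> smooth_gen f
| smooth_gen_coord i : smooth_gen (fun x => x ord0 i)
| smooth_gen_cst c : smooth_gen (fun=> c)
| smooth_genD f g : smooth_gen f -> smooth_gen g ->
    smooth_gen (fun x => f x + g x)
| smooth_genM f g : smooth_gen f -> smooth_gen g ->
    smooth_gen (fun x => f x * g x)
| smooth_gen_comp (F : R -> R) f : smooth1 F -> smooth_gen f ->
    smooth_gen (fun x => F (f x)).

Lemma smooth_gen_smooth f : smooth_gen f -> smooth f.
Proof.
move=> gf; apply: (smooth_coind (P := smooth_gen)) gf => {}f; elim => {f}.
- move=> f sf; split=> [|i]; first exact: smooth_continuous.
  exists (partial i f) => [x|]; first exact: smooth_is_derive.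
  by apply: smooth_gen_base; exact: smooth_partial.
- move=> i; split=> [|j]; first exact: coord_continuous.
  exists (fun=> (i == j)%:R); last exact: smooth_gen_cst.
  by move=> x; exact: is_derive_coord.
- move=> c; split=> [|i]; first exact: cst_continuous.
  exists (fun=> 0); last exact: smooth_gen_cst.
  by move=> x; exact: is_derive_cst.
- move=> f g _ [cf hf] _ [cg hg]; split=> [x|i].
    exact: continuousD (cf x) (cg x).
  have [df hdf gdf] := hf i; have [dg hdg gdg] := hg i.
  exists (fun x => df x + dg x); last exact: smooth_genD.
  by move=> x; exact: is_derive_fD.
- move=> f g gf [cf hf] gg [cg hg]; split=> [x|i].
    exact: continuousM (cf x) (cg x).
  have [df hdf gdf] := hf i; have [dg hdg gdg] := hg i.
  exists (fun x => f x * dg x + g x * df x) => [x|].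
    exact: is_derive_fM.
  by apply: smooth_genD; apply: smooth_genM.
- move=> F f sF gf [cf hf]; split=> [x|i].
    apply: continuous_comp; [exact: cf|exact: smooth1_continuous].
  have [df hdf gdf] := hf i.
  exists (fun x => derive1 F (f x) * df x) => [x|].
    by apply: is_derive_fcomp => //; exact: smooth1_is_derive.
  apply: smooth_genM => //; apply: (smooth_gen_comp (F := derive1 F)) => //.
  exact: smooth1_derive1.
Qed.

Lemma smooth_cst c : smooth (fun=> c).
Proof. exact/smooth_gen_smooth/smooth_gen_cst. Qed.

Lemma smooth_coord i : smooth (fun x : 'rV[R]_n => x ord0 i).
Proof. exact/smooth_gen_smooth/smooth_gen_coord. Qed.

Lemma smoothD f g : smooth f -> smooth g -> smooth (fun x => f x + g x).
Proof.
by move=> sf sg; apply: smooth_gen_smooth; apply: smooth_genD;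
  exact: smooth_gen_base.
Qed.

Lemma smoothM f g : smooth f -> smooth g -> smooth (fun x => f x * g x).
Proof.
by move=> sf sg; apply: smooth_gen_smooth; apply: smooth_genM;
  exact: smooth_gen_base.
Qed.

Lemma smooth_comp (F : R -> R) f : smooth1 F -> smooth f ->
  smooth (fun x => F (f x)).
Proof.
by move=> sF sf; apply: smooth_gen_smooth; apply: smooth_gen_comp => //;
  exact: smooth_gen_base.
Qed.

Lemma smooth_sum (I : Type) (s : seq I) (F : I -> 'rV[R]_n -> R) :
  (forall i, smooth (F i)) -> smooth (fun x => \sum_(i <- s) F i x).
Proof.
move=> sF; elim: s => [|i s ih].
  by under eq_fun do rewrite big_nil; exact: smooth_cst.
by under eq_fun do rewrite big_cons; exact: smoothD.
Qed.

Lemma smooth_prod (I : Type) (s : seq I) (F : I -> 'rV[R]_n -> R) :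
  (forall i, smooth (F i)) -> smooth (fun x => \prod_(i <- s) F i x).
Proof.
move=> sF; elim: s => [|i s ih].
  by under eq_fun do rewrite big_nil; exact: smooth_cst.
by under eq_fun do rewrite big_cons; exact: smoothM.
Qed.

Lemma partialD f g i : smooth f -> smooth g ->
  partial i (fun x => f x + g x) = fun x => partial i f x + partial i g x.
Proof.
move=> sf sg; apply/funext => x; rewrite {1}/partial.
have hf := smooth_is_derive x i sf; have hg := smooth_is_derive x i sg.
by have := is_derive_fD hf hg => h; rewrite derive_val.
Qed.

Lemma partialM f g i : smooth f -> smooth g -> partial i (fun x => f x * g x) =
  fun x => f x * partial i g x + g x * partial i f x.
Proof.
move=> sf sg; apply/funext => x; rewrite {1}/partial.
have hf := smooth_is_derive x i sf; have hg := smooth_is_derive x i sg.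
by have := is_derive_fM hf hg => h; rewrite derive_val.
Qed.

Lemma partialZ c f i : smooth f ->
  partial i (fun x => c * f x) = fun x => c * partial i f x.
Proof.
move=> sf; rewrite (partialM i (smooth_cst c) sf); apply/funext => x.
by rewrite /partial derive_cst mulr0 addr0.
Qed.

Lemma partial_comp (F : R -> R) f i : smooth1 F -> smooth f ->
  partial i (fun x => F (f x)) = fun x => derive1 F (f x) * partial i f x.
Proof.
move=> sF sf; apply/funext => x; rewrite {1}/partial.
have hF := smooth1_is_derive (f x) sF; have hf := smooth_is_derive x i sf.
by have := is_derive_fcomp hF hf => h; rewrite derive_val.
Qed.

Lemma partial_coord i j :
  partial j (fun x : 'rV[R]_n => x ord0 i) = fun=> (i == j)%:R.
Proof.
apply/funext => x; rewrite /partial.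
by have := is_derive_coord i j x => h; rewrite derive_val.
Qed.

Definition sqn (x : 'rV[R]_n) : R := \sum_(i < n) x ord0 i ^+ 2.

Lemma enorm_sqn x : enorm x ^+ 2 = sqn x.
Proof. by rewrite sqr_sqrtr// sumr_ge0// => i _; exact: sqr_ge0. Qed.

Lemma sqn_ge0 x : 0 <= sqn x.
Proof. by apply: sumr_ge0 => i _; exact: sqr_ge0. Qed.

Lemma smooth_sqn : smooth sqn.
Proof.
rewrite /sqn; apply: smooth_sum => i.
under eq_fun do rewrite expr2; apply: smoothM; exact: smooth_coord.
Qed.

Lemma partial_sqn i : partial i sqn = fun x => 2 * x ord0 i.
Proof.
apply/funext => x; rewrite /partial.
suff h : forall s : seq 'I_n, is_derive x (e_ i)
    (fun y => \sum_(j <- s) y ord0 j ^+ 2)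
    (\sum_(j <- s) (2 * x ord0 j * (j == i)%:R)).
  have := h (index_enum 'I_n) => {}h; rewrite derive_val.
  rewrite (bigD1 i)//= eqxx mulr1 big1 ?addr0// => j /negbTE ->.
  by rewrite mulr0.
elim=> [|j s ih].
  under eq_fun do rewrite big_nil; rewrite big_nil; exact: is_derive_cst.
under eq_fun do rewrite big_cons; rewrite big_cons; apply: is_derive_fD => //.
under eq_fun do rewrite expr2.
apply: (is_derive_eq (is_derive_fM (is_derive_coord j i x)
  (is_derive_coord j i x))).
ring.
Qed.

Lemma sqn_coord (x : 'rV[R]_n) i : x ord0 i ^+ 2 <= sqn x.
Proof.
rewrite /sqn (bigD1 i)//= lerDl sumr_ge0// => j _; exact: sqr_ge0.
Qed.

Lemma norm_le_sqn (x : 'rV[R]_n) r : 0 < r -> sqn x < r ^+ 2 -> `|x| < r.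
Proof.
move=> r0 xr; suff : ball (0 : 'rV[R]_n) r x by rewrite -ball_normE/= sub0r normrN.
apply/rV_ballP; split=> // i; rewrite mxE sub0r normrN.
rewrite -(@ltr_pXn2r _ 2)// ?nnegrE ?(ltW r0)//.
by rewrite real_normK ?num_real//; apply: le_lt_trans xr; exact: sqn_coord.
Qed.

Lemma test_fun_sub (U K : set 'rV[R]_n) f : smooth f -> compact K ->
  K `<=` U -> (forall x, f x != 0 -> K x) -> test_fun U f.
Proof.
move=> sf cK KU fK; have clK : closed K by apply: compact_closed cK; exact: norm_hausdorff.
have sub : closure [set x | f x != 0] `<=` K.
  by rewrite ((closure_id K).1 clK); apply: closure_subset => x /= /fK.
split=> //; last exact: subset_trans KU.
by apply: subclosed_compact cK sub; exact: closed_closure.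
Qed.

Lemma test_fun_smooth U f : test_fun U f -> smooth f.
Proof. by case. Qed.

Lemma test_fun_supp U f g : test_fun U f -> smooth g ->
  (forall x, ~ closure [set x | f x != 0] x -> g x = 0) -> test_fun U g.
Proof.
move=> [sf cf fU] sg h.
apply: (@test_fun_sub U (closure [set x | f x != 0])) => //.
by move=> x /eqP gx; apply: contrapT => /h.
Qed.

Lemma test_fun0 (U : set 'rV[R]_n) : test_fun U (fun=> 0).
Proof.
apply: (@test_fun_sub U set0); [exact: smooth_cst|exact: compact0|by []|].
by move=> x; rewrite eqxx.
Qed.

Lemma test_fun_out U f x : test_fun U f -> ~ closure [set x | f x != 0] x ->
  f x = 0.
Proof.
move=> _ h; apply/eqP; apply: contrapT => /negP fx; apply: h.
exact: subset_closure.
Qed.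

Lemma test_fun_outU U f x : test_fun U f -> ~ U x -> f x = 0.
Proof.
by move=> tf Ux; apply: (test_fun_out tf); case: tf => _ _ h /h.
Qed.

Lemma test_funMl U f g : smooth g -> test_fun U f ->
  test_fun U (fun x => g x * f x).
Proof.
move=> sg tf; apply: (test_fun_supp tf).
  by apply: smoothM => //; exact: test_fun_smooth tf.
by move=> x /(test_fun_out tf) ->; rewrite mulr0.
Qed.

Lemma test_funZ U c f : test_fun U f -> test_fun U (fun x => c * f x).
Proof. by apply: test_funMl; exact: smooth_cst. Qed.

Lemma test_funD U f g : test_fun U f -> test_fun U g ->
  test_fun U (fun x => f x + g x).
Proof.
move=> tf tg; have [sf cf fU] := tf; have [sg cg gU] := tg.
apply: (@test_fun_sub U (closure [set x | f x != 0] `|` closure [set x | g x != 0])).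
- exact: smoothD.
- exact: compactU.
- by move=> x [/fU|/gU].
- move=> x; have [fx|fx] := eqVneq (f x) 0.
    by rewrite fx add0r => gx; right; exact: subset_closure.
  by move=> _; left; exact: subset_closure.
Qed.

Lemma test_fun_partial U f i : test_fun U f -> test_fun U (partial i f).
Proof.
move=> tf; have [sf _ _] := tf; apply: (test_fun_supp tf).
  exact: smooth_partial.
move=> x nx; rewrite /partial (@near_eq_derive _ _ _ f (cst 0)).
  exact: derive_cst.
have : \forall y \near x, ~ closure [set x | f x != 0] y.
  apply: open_nbhs_nbhs; split=> //.
  by apply: closed_openC; exact: closed_closure.
by apply: filterS => y /(test_fun_out tf).
Qed.

Lemma test_fun_bounded U f : test_fun U f ->
  exists2 M, 0 < M & forall x, `|f x| <= M.
Proof.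
move=> tf; have [sf cf _] := tf.
have [K [_ hK]] : bounded_set (closure [set x | f x != 0]).
  exact: compact_bounded.
have [M M0 hM] := continuous_rV_bounded (K + 1) (smooth_continuous sf).
exists M => // x; have [cx|nx] := pselect (closure [set x | f x != 0] x).
  by apply: hM; apply: (hK (K + 1)) => //; rewrite ltrDl.
by rewrite (test_fun_out tf nx) normr0 ltW.
Qed.

Lemma test_fun_support U f : test_fun U f ->
  exists2 K, 0 < K & forall x, K <= `|x| -> f x = 0.
Proof.
move=> tf; have [sf cf _] := tf.
have [K [_ hK]] : bounded_set (closure [set x | f x != 0]).
  exact: compact_bounded.
exists (`|K| + 2) => [|x Kx]; first by rewrite ltr_wpDl.
apply: (test_fun_out tf) => cx.
have := hK (`|K| + 1) _ x cx; rewrite ltr_pwDr ?ler_norm// => /(_ isT) h.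
by have := le_trans Kx h; rewrite lerD2l; lra.
Qed.

Lemma test_fun_integral_partial U f i : test_fun U f ->
  (\int[lebesgue_rV n]_x (partial i f x)%:E = 0)%E.
Proof.
move=> tf; have [K K0 hK] := test_fun_support tf.
have sf := test_fun_smooth tf.
apply: (integral_partial_compact K0) => //.
  by move=> x; exact: smooth_derivable.
exact/smooth_continuous/smooth_partial.
Qed.

End smooth.

(** * The fundamental lemma of the calculus of variations *)

(** Functions whose integral vanishes on a generating pi-system vanish almost
    everywhere: the sets on which the integral vanishes form a lambda-system. *)
Lemma ae_eq0_pi_system d (T : measurableType d) (R : realType)
    (m : {measure set T -> \bar R}) (D : set T) (f : T -> R)
    (G : set (set T)) :
  measurable D -> m.-integrable D (EFin \o f) ->
  @measurable d T = <<s G >> -> setI_closed G ->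
  (\int[m]_(x in D) (f x)%:E = 0)%E ->
  (forall A, G A -> (\int[m]_(x in D `&` A) (f x)%:E = 0)%E) ->
  ae_eq m D (EFin \o f) (cst 0%E).
Proof.
move=> mD intf GE GI fD fG.
have mf := measurable_int _ intf.
pose H := [set A : set T | measurable A /\ (\int[m]_(x in D `&` A) (f x)%:E = 0)%E].
have HI : lambda_system setT H.
  split=> //.
  - by split=> //; rewrite setIT.
  - move=> A B BA [mA fA] [mB fB]; split; first exact: measurableD.
    have := fA; rewrite -{1}(setDUK BA) setIUr integral_setU//=.
    + by rewrite fB add0e.
    + exact: measurableI.
    + by apply: measurableI => //; apply: measurableD.
    + apply: measurable_funS mf => //.
      by move=> x [[]|[]].
    + apply/disj_setPS => x [[_ Bx] [_ [_]]]; exact.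
  - move=> F ndF HF; have mF : measurable (\bigcup_i F i).
      by apply: bigcup_measurable => i _; exact: (HF i).1.
    split=> //.
    (* Increasing unions: dominated convergence, with |f| as the majorant. *)
    pose f_ k x := ((EFin \o f) \_ (F k)) x.
    have mf_ k : measurable_fun D (f_ k).
      rewrite /f_; apply/(measurable_restrict _ (HF k).1 mD).
      by apply: measurable_funS mf => //; exact: subIsetr.
    have cf_ x : D x -> f_ ^~ x @ \oo --> ((EFin \o f) \_ (\bigcup_i F i)) x.
      move=> Dx; have [[k _ Fkx]|nF] := pselect ((\bigcup_i F i) x).
        apply: cvg_near_cst; exists k => // j /= kj.
        rewrite /f_ !patchE !mem_set//; first by exists k.
        by have := ndF _ _ kj => /subsetPset; apply.
      rewrite (_ : f_ ^~ x = cst (((EFin \o f) \_ (\bigcup_i F i)) x)).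
        exact: cvg_cst.
      apply/funext => k; rewrite /f_/= !patchE !memNset//.
      by move=> Fkx; apply: nF; exists k.
    have iabs : m.-integrable D (abse \o (EFin \o f)).
      exact: integrable_abse.
    have dom k x : D x -> (`|f_ k x| <= (abse \o (EFin \o f)) x)%E.
      move=> _; rewrite /f_ patchE; case: ifPn => _ //=.
      by rewrite normr0 lee_fin.
    have := @dominated_cvg _ _ _ m D mD f_ _ (abse \o (EFin \o f)) mf_ cf_
      (fun x _ => isT) iabs dom.
    rewrite (_ : (fun k => _) = cst 0%E); last first.
      by apply/funext => k; rewrite /f_ -integral_mkcondr (HF k).2.
    rewrite -integral_mkcondr => h.
    by apply/esym; exact: (cvg_unique _ (@cvg_cst _ _ _ _ _) h).
have sub : @measurable d T `<=` H.
  rewrite GE; apply: lambda_system_subset => // A GA.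
  split; last exact: fG.
  by rewrite GE; exact: sub_sigma_algebra.
apply: (integral_ae_eq mD intf) => // E ED mE.
rewrite integral0; have [_] := sub E mE.
by rewrite setIC (setIidl ED).
Qed.

Section boxes.
Context (R : realType) (n : nat).

Definition box (a b : 'I_n -> R) : set 'rV[R]_n :=
  [set x | forall i, a i < x ord0 i < b i].

Lemma measurable_box a b : measurable (box a b).
Proof.
rewrite (_ : box a b =
    \bigcap_(i in [set: 'I_n]) (row_coord i @^-1` `]a i, b i[)).
  apply: fin_bigcap_measurable => // i _; rewrite -[X in measurable X]setTI.
  exact: (@measurable_row_coord R n i measurableT _ (measurable_itv _)).
apply/seteqP; split=> x h i; last by have := h i Logic.I; rewrite /= in_itv.
by move=> _; have := h i; rewrite /= in_itv.
Qed.

Lemma boxI a b a' b' : box a b `&` box a' b' =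
  box (fun i => Num.max (a i) (a' i)) (fun i => Num.min (b i) (b' i)).
Proof.
apply/seteqP; split=> x.
  move=> [h h'] i; move: (h i) (h' i) => /andP[h1 h2] /andP[h3 h4].
  by rewrite gt_max lt_min h1 h2 h3 h4.
move=> h; split=> i; have := h i; rewrite gt_max lt_min;
  by move=> /andP[/andP[h1 h2] /andP[h3 h4]]; apply/andP.
Qed.

Lemma measurable_rV_boxE :
  @measurable _ 'rV[R]_n = <<s [set A | exists a b, A = box a b] >>.
Proof.
apply/seteqP; split; last first.
  apply: smallest_sub; first exact: sigma_algebra_measurable.
  by move=> _ [a [b ->]]; exact: measurable_box.
apply: smallest_sub; first exact: smallest_sigma_algebra.
rewrite -bigcup_seq => _ [i _ [Y mY <-]]; rewrite setTI.
pose G := [set A : set 'rV[R]_n | exists a b, A = box a b].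
suff h : measurable_fun [set: g_sigma_algebraType G] (row_coord i).
  by have := h measurableT Y mY; rewrite setTI.
apply: (measurability _ (RGenOpens.measurableE R)).
move=> _ [_ [a [b ->] <-]]; rewrite setTI.
rewrite (_ : _ @^-1` _ = \bigcup_k box
    (fun j => if j == i then a else - k%:R) (fun j => if j == i then b else k%:R)).
  apply: bigcup_measurable => k _; apply: sub_sigma_algebra.
  by do 2 eexists.
apply/seteqP; split=> x.
  rewrite /= in_itv/= => xab; exists (Num.truncn `|x|).+1 => // j.
  case: eqP => [->//|_]; rewrite -ltr_norml.
  suff /rV_ballP[_ /(_ j)] : ball (0 : 'rV[R]_n) (Num.truncn `|x|).+1%:R x.
    by rewrite mxE sub0r normrN.
  by rewrite -ball_normE/= sub0r normrN truncnS_gt.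
by move=> [k _ /(_ i)]; rewrite eqxx /= in_itv.
Qed.

(** Smooth functions with values in [0, 1] that converge to the indicator of
    the box, and that vanish outside of it. *)
Definition box_bump (a b : 'I_n -> R) (k : nat) (x : 'rV[R]_n) : R :=
  \prod_(i < n) (flat 1 (k.+1%:R * (x ord0 i - a i)) *
                 flat 1 (k.+1%:R * (b i - x ord0 i))).

Lemma flat1E (s : R) : 0 < s -> flat 1 s = expR (- s^-1).
Proof. by rewrite /flat => ->; rewrite hornerC mul1r. Qed.

Lemma flat1_ge0 (s : R) : 0 <= flat 1 s.
Proof.
by rewrite /flat; case: ifPn => // _; rewrite hornerC mul1r expR_ge0.
Qed.

Lemma flat1_le1 (s : R) : flat 1 s <= 1.
Proof.
rewrite /flat; case: ifPn => // s0; rewrite hornerC mul1r expR_le1.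
by rewrite oppr_le0 invr_ge0 ltW.
Qed.

Lemma smooth_box_bump a b k : smooth (box_bump a b k).
Proof.
apply: smooth_prod => i; apply: smoothM; apply: smooth_comp.
- exact: smooth1_flat.
- apply: smoothM; first exact: smooth_cst.
  by apply: smoothD; [exact: smooth_coord|exact: smooth_cst].
- exact: smooth1_flat.
- apply: smoothM; first exact: smooth_cst.
  apply: smoothD; first exact: smooth_cst.
  under eq_fun do rewrite -mulN1r.
  by apply: smoothM; [exact: smooth_cst|exact: smooth_coord].
Qed.

Lemma box_bump_ge0 a b k x : 0 <= box_bump a b k x.
Proof. by apply: prodr_ge0 => i _; rewrite mulr_ge0// flat1_ge0. Qed.

Lemma box_bump_le1 a b k x : box_bump a b k x <= 1.
Proof.
rewrite -[leRHS](@big1_eq R 1 *%R 'I_n (index_enum 'I_n) xpredT).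
apply: ler_prod => i _; rewrite mulr_ge0 ?flat1_ge0//=.
by rewrite mulr_ile1 ?flat1_ge0 ?flat1_le1.
Qed.

Lemma box_bump_out a b k x : ~ box a b x -> box_bump a b k x = 0.
Proof.
move=> /existsNP[i /negP]; rewrite negb_and -!leNgt => h.
rewrite /box_bump (bigD1 i)//=.
case/orP: h => h.
  by rewrite flat_neg ?mul0r// mulr_ge0_le0// subr_le0.
by rewrite [flat _ (_ * (b i - _))]flat_neg ?mulr0 ?mul0r// mulr_ge0_le0// subr_le0.
Qed.

Lemma flat1_cvg (s : R) : 0 < s -> flat 1 (k.+1%:R * s) @[k --> \oo] --> (1 : R).
Proof.
move=> s0.
rewrite (_ : (fun k : nat => _) = (fun k : nat => expR (- (s^-1 * k.+1%:R^-1)))).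
  rewrite -[X in _ --> X](@expR0 R) -[X in expR X]oppr0 -[X in - X](mulr0 s^-1).
  apply: (@cvg_comp _ _ _ (fun k : nat => - (s^-1 * k.+1%:R^-1)) expR).
    by apply: cvgN; apply: cvgMl_tmp; exact: cvg_harmonic.
  exact: continuous_expR.
by apply/funext => k; rewrite flat1E ?mulr_gt0// invfM mulrC.
Qed.

Lemma box_bump_cvg a b x : box_bump a b k x @[k --> \oo] --> (\1_(box a b) x : R).
Proof.
rewrite indicE; case: (boolP (x \in _)) => [|]; rewrite (inE, notin_setE) => h; last first.
  rewrite (_ : (fun k => _) = cst 0); first exact: cvg_cst.
  by apply/funext => k; rewrite box_bump_out.
have -> : true%:R = \prod_(i < n) (1 * 1) :> R by rewrite big1// => i _; rewrite mulr1.
rewrite /box_bump; elim: (index_enum 'I_n) => [|i s ih].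
  by under eq_fun do rewrite big_nil; rewrite big_nil; exact: cvg_cst.
under eq_fun do rewrite big_cons; rewrite big_cons; apply: cvgM => //.
by have /andP[h1 h2] := h i; apply: cvgM; apply: flat1_cvg; rewrite subr_gt0.
Qed.

End boxes.

(** The fundamental lemma of the calculus of variations. Smooth bumps converge
    to the indicator of a box, so the integral of g over every small box
    vanishes; boxes generate the Borel sets and countably many balls cover U. *)
Lemma ae_eq0_test_fun (R : realType) (n : nat) (U : set 'rV[R]_n)
    (g : 'rV[R]_n -> R) : open U -> bounded_set U ->
  (lebesgue_rV n).-integrable U (EFin \o g) ->
  (forall phi, test_fun U phi ->
     (\int[lebesgue_rV n]_(x in U) (g x * phi x)%:E = 0)%E) ->
  {ae lebesgue_rV n, forall x, U x -> g x = 0}.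
Proof.
move=> oU bU ig hg.
have mU := measurable_rV_open oU.
have mg : measurable_fun U g by apply/measurable_EFinP; exact: measurable_int ig.
have key a b : closure (box a b) `<=` U ->
    (\int[lebesgue_rV n]_(x in box a b) (g x)%:E = 0)%E.
  move=> abU; have abU' : box a b `<=` U by apply: subset_trans abU; exact: subset_closure.
  have cab : compact (closure (box a b)).
    apply: bounded_closed_compact; last exact: closed_closure.
    have [M [Mr hM]] := bU; exists M; split=> // r Mr' x /abU; exact: hM.
  have tb k : test_fun U (box_bump a b k).
    apply: (test_fun_sub (smooth_box_bump _ _ _) cab abU) => x.
    by move=> /eqP h; apply: subset_closure; apply: contrapT => /(box_bump_out k).
  pose f_ k x := (g x * box_bump a b k x)%:E.
  have mf_ k : measurable_fun U (f_ k).
    apply/measurable_EFinP; apply: measurable_funM => //.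
    by apply: smooth_measurable; exact: smooth_box_bump.
  have cf_ x : U x -> f_ ^~ x @ \oo --> ((g x * \1_(box a b) x)%:E : \bar R).
    move=> _; apply: cvg_EFin; first exact: nearW.
    by apply: cvgMl_tmp; exact: box_bump_cvg.
  have iabs := integrable_abse ig.
  have dom k x : U x -> (`|f_ k x| <= (abse \o (EFin \o g)) x)%E.
    move=> _; rewrite /f_ /= lee_fin normrM ler_piMr//.
    by rewrite ger0_norm ?box_bump_ge0// box_bump_le1.
  have := @dominated_cvg _ _ _ (lebesgue_rV n) U mU f_ _
    (abse \o (EFin \o g)) mf_ cf_ (fun x _ => isT) iabs dom.
  rewrite (_ : (fun k => _) = cst 0%E); last by apply/funext => k; exact: hg.
  move=> h; rewrite -[RHS](esym (cvg_unique _ (@cvg_cst _ _ _ _ _) h))//.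
  rewrite -[in LHS](setIidr abU') integral_mkcondr; apply: eq_integral => x _.
  by rewrite patchE indicE /=; case: ifPn; rewrite ?mulr1 ?mulr0.
have loc (c : 'rV[R]_n) (r : R) : 0 < r -> ball c (r *+ 2) `<=` U ->
    {ae lebesgue_rV n, forall x, ball c r x -> g x = 0}.
  move=> r0 cU.
  have bE : ball c r = box (fun i => c ord0 i - r) (fun i => c ord0 i + r).
    apply/seteqP; split=> x.
      by move=> /rV_ballP[_ h] i; rewrite -ltr_distl distrC.
    by move=> h; apply/rV_ballP; split=> // i; rewrite distrC ltr_distl.
  have clU : closure (ball c r) `<=` U.
    move=> x /(_ _ (nbhsx_ballx x r r0))[y [cy xy]]; apply: cU.
    by rewrite mulr2n; exact: ball_triangle cy (ball_sym xy).
  have sub := subset_trans (@subset_closure _ (ball c r)) clU.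
  have mB : measurable (ball c r) by exact: measurable_rV_ball.
  have := @ae_eq0_pi_system _ _ _ (lebesgue_rV n) (ball c r) g
    [set A | exists a b, A = box a b] mB (integrableS mU mB sub ig)
    (measurable_rV_boxE R n).
  move=> /(_ _ _ _)h.
  have : ae_eq (lebesgue_rV n) (ball c r) (EFin \o g) (cst 0%E).
    apply: h.
    - by move=> _ _ [a [b ->]] [a' [b' ->]]; rewrite boxI; do 2 eexists.
    - by rewrite bE; apply: key; rewrite -bE.
    - move=> _ [a [b ->]]; rewrite bE boxI; apply: key; rewrite -boxI -bE.
      by apply: subset_trans clU; apply: closure_subset; exact: subIsetl.
  by apply: filterS => x hx /hx[].
pose B (z : 'rV[rat]_n * nat) (s : R) : set 'rV[R]_n :=
  ball (map_mx ratr z.1 : 'rV[R]_n) (s * z.2.+1%:R^-1).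
pose P (j : nat) (x : 'rV[R]_n) := forall z : 'rV[rat]_n * nat,
  unpickle j = Some z -> B z 2 `<=` U -> B z 1 x -> g x = 0.
have aeP j : {ae lebesgue_rV n, forall x, P j x}.
  rewrite /P; case: (unpickle j) => [z|]; last by apply: aeW.
  have [zU|nz] := pselect (B z 2 `<=` U); last by apply: aeW => x _ [<-].
  have h1 : 0 < z.2.+1%:R^-1 :> R by rewrite invr_gt0 ltr0n.
  have := loc (map_mx ratr z.1) _ h1.
  rewrite -[_ *+ 2]mulr_natl => /(_ zU).
  by apply: filterS => x hx _ [<-] _; rewrite /B mul1r.
have := @ae_foralln _ _ _ (lebesgue_rV n) P aeP.
apply: filterS => x hx Ux.
have /nbhs_ballP[e /= e0 xeU] : nbhs x U by exact: open_nbhs_nbhs.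
have [k ke] : exists k : nat, k.+1%:R^-1 < e / 3.
  exists (Num.truncn (e / 3)^-1).
  rewrite -[ltRHS]invrK ltf_pV2 ?posrE ?invr_gt0 ?divr_gt0//.
  exact: truncnS_gt.
have [q xq] : exists q : 'rV[rat]_n, ball (map_mx ratr q : 'rV[R]_n) k.+1%:R^-1 x.
  exact: rV_rat_ball.
apply: (hx (pickle (q, k)) (q, k)); first exact: pickleK.
  move=> y qy; apply: xeU; apply: (@le_ball _ _ _ (k.+1%:R^-1 + 2 * k.+1%:R^-1)).
    move: ke; rewrite ltr_pdivlMr//; set rho := _^-1 => ke; lra.
  exact: ball_triangle (ball_sym xq) qy.
by rewrite /B mul1r.
Qed.

(** * The space L^2 *)

Section L2_theory.
Context (R : realType) (n : nat) (Omega : set 'rV[R]_n).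
Hypotheses (oO : open Omega) (bO : bounded_set Omega).
Local Notation E := 'rV[R]_n.
Local Notation leb := (@lebesgue_rV R n).
Implicit Types v w a : E -> R.

Let mO : measurable Omega. Proof. exact: measurable_rV_open. Qed.

Let O_fin : (leb Omega < +oo)%E.
Proof. exact: bounded_lebesgue_rV_lty. Qed.

(** The multipliers of L^2(Omega): bounded measurable functions *)
Definition bmf a :=
  measurable_fun Omega a /\ exists M : R, forall x, Omega x -> `|a x| <= M.

Lemma L2_sqr_integrable v : L2 Omega v ->
  leb.-integrable Omega (fun x => (v x ^+ 2)%:E).
Proof.
move=> [mv v2]; apply/integrableP; split.
  by apply/measurable_EFinP; exact: measurable_funX.
under eq_integral do rewrite gee0_abs ?lee_fin ?sqr_ge0//.
exact: v2.
Qed.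

Lemma L2_mul_integrable v w : L2 Omega v -> L2 Omega w ->
  leb.-integrable Omega (EFin \o (fun x => v x * w x)).
Proof.
move=> Lv Lw; have iv := L2_sqr_integrable Lv; have iw := L2_sqr_integrable Lw.
apply: (le_integrable mO _ _ (integrableD mO iv iw)).
  by apply/measurable_EFinP; apply: measurable_funM; [case: Lv|case: Lw].
move=> x _ /=; rewrite lee_fin [leRHS]ger0_norm ?addr_ge0 ?sqr_ge0//.
rewrite ler_norml; apply/andP; split; rewrite -subr_ge0.
  have := sqr_ge0 (v x + w x); have := sqr_ge0 (v x); have := sqr_ge0 (w x); nra.
have := sqr_ge0 (v x - w x); have := sqr_ge0 (v x); have := sqr_ge0 (w x); nra.
Qed.

Lemma integrable_sqr_L2 v : measurable_fun Omega v ->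
  leb.-integrable Omega (fun x => (v x ^+ 2)%:E) -> L2 Omega v.
Proof.
move=> mv /integrableP[_ h]; split=> //; apply: le_lt_trans h.
rewrite le_eqVlt; apply/orP; left; apply/eqP; apply: eq_integral => x _.
by rewrite gee0_abs// lee_fin sqr_ge0.
Qed.

Lemma L2_bmfM a v : bmf a -> L2 Omega v -> L2 Omega (fun x => a x * v x).
Proof.
move=> [ma [M hM]] Lv; apply: integrable_sqr_L2.
  by apply: measurable_funM => //; case: Lv.
apply: (le_integrable mO _ _ (integrableZl mO (M ^+ 2) (L2_sqr_integrable Lv))).
  apply/measurable_EFinP; apply: measurable_funX; apply: measurable_funM => //.
  by case: Lv.
move=> x Ox /=; rewrite lee_fin ger0_norm ?sqr_ge0//.
rewrite [leRHS]ger0_norm; last by apply: mulr_ge0; exact: sqr_ge0.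
rewrite exprMn ler_wpM2r ?sqr_ge0//.
have M0 := le_trans (normr_ge0 _) (hM x Ox).
by rewrite -(real_normK (num_real (a x))) lerXn2r ?nnegrE// hM.
Qed.

Lemma bmf_cst c : bmf (fun=> c).
Proof. by split => //; exists `|c|. Qed.

Lemma bmfM a b : bmf a -> bmf b -> bmf (fun x => a x * b x).
Proof.
move=> [ma [M hM]] [mb [N hN]]; split; first exact: measurable_funM.
exists (M * N) => x Ox; rewrite normrM ler_pM//; [exact: hM|exact: hN].
Qed.

Lemma bmfD a b : bmf a -> bmf b -> bmf (fun x => a x + b x).
Proof.
move=> [ma [M hM]] [mb [N hN]]; split; first exact: measurable_funD.
exists (M + N) => x Ox; apply: le_trans (ler_normD _ _) _.
by rewrite lerD//; [exact: hM|exact: hN].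
Qed.

Lemma L2_bmf a : bmf a -> L2 Omega a.
Proof.
move=> [ma [M hM]]; apply: integrable_sqr_L2 => //.
apply: measurable_bounded_integrable => //; first exact: measurable_funX.
exists (`|M| ^+ 2); split; first exact: num_real.
move=> r Mr x Ox /=; rewrite normrX; apply: le_trans (ltW Mr).
rewrite lerXn2r ?nnegrE//; apply: le_trans (hM x Ox) _; exact: ler_norm.
Qed.

Lemma bmf_test phi : test_fun Omega phi -> bmf phi.
Proof.
move=> tp; split; first by apply: smooth_measurable; exact: test_fun_smooth tp.
by have [M _ hM] := test_fun_bounded tp; exists M.
Qed.

Lemma L2_test phi : test_fun Omega phi -> L2 Omega phi.
Proof. by move=> /bmf_test; exact: L2_bmf. Qed.

(** Linear combinations are written c * v + w, in the shape in which the
    linearity of the elements of H^-1 is expressed; hence the many - 1 below. *)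
Lemma L2_lin c v w : L2 Omega v -> L2 Omega w ->
  L2 Omega (fun x => c * v x + w x).
Proof.
move=> Lv Lw; apply: integrable_sqr_L2.
  apply: measurable_funD; last by case: Lw.
  by apply: measurable_funM => //; case: Lv.
have iv := integrableZl mO (2 * c ^+ 2) (L2_sqr_integrable Lv).
have iw := integrableZl mO 2 (L2_sqr_integrable Lw).
apply: (le_integrable mO _ _ (integrableD mO iv iw)).
  apply/measurable_EFinP; apply: measurable_funX.
  apply: measurable_funD; last by case: Lw.
  by apply: measurable_funM => //; case: Lv.
move=> x _ /=; rewrite lee_fin ger0_norm ?sqr_ge0//.
rewrite [leRHS]ger0_norm; last first.
  by rewrite addr_ge0// mulr_ge0 ?sqr_ge0// mulr_ge0// sqr_ge0.
by have := sqr_ge0 (c * v x - w x); nra.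
Qed.

Lemma L2_0 : L2 Omega (fun=> 0).
Proof. exact/L2_bmf/bmf_cst. Qed.

Lemma L2dot_lin c v w z : L2 Omega v -> L2 Omega w -> L2 Omega z ->
  L2dot Omega (fun x => c * v x + w x) z =
  c * L2dot Omega v z + L2dot Omega w z.
Proof.
move=> Lv Lw Lz; rewrite /L2dot -RintegralZl//; last exact: L2_mul_integrable.
rewrite -RintegralD//.
- by apply: eq_Rintegral => x _; ring.
- have := integrableZl mO c (L2_mul_integrable Lv Lz); apply: eq_integrable => //.
- exact: L2_mul_integrable.
Qed.

Lemma L2dotC v w : L2dot Omega v w = L2dot Omega w v.
Proof. by apply: eq_Rintegral => x _; rewrite mulrC. Qed.

Lemma L2norm2E v : L2 Omega v -> L2norm2 Omega v = (L2dot Omega v v)%:E.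
Proof.
move=> Lv; rewrite /L2norm2 /L2dot /Rintegral fineK.
  by apply: eq_integral => x _; rewrite expr2.
by apply: integrable_fin_num => //; exact: L2_mul_integrable.
Qed.

Lemma L2dot_ge0 v : 0 <= L2dot Omega v v.
Proof. by apply: Rintegral_ge0 => x _; rewrite -expr2 sqr_ge0. Qed.

Lemma L2dot_ae v w z : L2 Omega v -> L2 Omega w -> L2 Omega z ->
  {ae leb, forall x, Omega x -> v x = w x} -> L2dot Omega v z = L2dot Omega w z.
Proof.
move=> Lv Lw Lz vw; rewrite /L2dot /Rintegral; congr fine.
apply: ae_eq_integral => //.
- exact: measurable_int (L2_mul_integrable Lv Lz).
- exact: measurable_int (L2_mul_integrable Lw Lz).
- by apply: filterS vw => x h Ox; rewrite h.
Qed.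

Lemma le_L2dot v w v' w' : L2 Omega v -> L2 Omega w -> L2 Omega v' ->
  L2 Omega w' -> (forall x, Omega x -> v x * w x <= v' x * w' x) ->
  L2dot Omega v w <= L2dot Omega v' w'.
Proof.
by move=> Lv Lw Lv' Lw' h; apply: le_Rintegral => //; exact: L2_mul_integrable.
Qed.

End L2_theory.

(** * Sobolev functions, jets and quadratic forms *)

Section sobolev.
Context (R : realType) (n : nat) (Omega : set 'rV[R]_n).
Hypotheses (oO : open Omega) (bO : bounded_set Omega).
Local Notation E := 'rV[R]_n.
Local Notation leb := (@lebesgue_rV R n).
Implicit Types v w g h phi psi : E -> R.

Let mO : measurable Omega. Proof. exact: measurable_rV_open. Qed.

(** Two weak derivatives have the same integral against test functions. *)
Lemma is_weak_partial_unique i v g h :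
  is_weak_partial Omega i v g -> is_weak_partial Omega i v h ->
  {ae leb, forall x, Omega x -> g x = h x}.
Proof.
move=> [Lg hg] [Lh hh].
have Ld : L2 Omega (fun x => -1 * h x + g x) by exact: L2_lin.
have L1 : L2 Omega (fun=> 1) by exact/L2_bmf/bmf_cst.
have int_d : leb.-integrable Omega (EFin \o (fun x => -1 * h x + g x)).
  have := L2_mul_integrable oO Ld L1; apply: eq_integrable => // x _ /=.
  by rewrite mulr1.
have := ae_eq0_test_fun oO bO int_d.
have hphi phi : test_fun Omega phi ->
    (\int[leb]_(x in Omega) ((-1 * h x + g x) * phi x)%:E = 0)%E.
  move=> tp; have Lp := L2_test oO bO tp.
  have := L2dot_lin oO (-1) Lh Lg Lp.
  have := hg _ tp; rewrite (hh _ tp) => /oppr_inj ->.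
  rewrite mulN1r addNr /L2dot /Rintegral => e0.
  rewrite -[LHS]fineK ?e0//.
  by apply: integrable_fin_num => //; exact: L2_mul_integrable.
move=> /(_ hphi); apply: filterS => x h0 Ox.
by have := h0 Ox; lra.
Qed.

(** The integral of the derivative of the product phi * psi vanishes. *)
Lemma L2dot_partial i phi psi : test_fun Omega phi -> test_fun Omega psi ->
  L2dot Omega phi (partial i psi) = - L2dot Omega (partial i phi) psi.
Proof.
move=> tp tq; have tdp := test_fun_partial i tp; have tdq := test_fun_partial i tq.
have Lp := L2_test oO bO tp; have Lq := L2_test oO bO tq.
have Ldp := L2_test oO bO tdp; have Ldq := L2_test oO bO tdq.
apply/eqP; rewrite -subr_eq0 opprK; apply/eqP.
rewrite /L2dot -RintegralD//; try exact: L2_mul_integrable.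
have tpq := test_funMl (test_fun_smooth tp) tq.
transitivity (\int[leb]_(x in Omega) partial i (fun x => phi x * psi x) x).
  apply: eq_Rintegral => x _.
  rewrite (partialM i (test_fun_smooth tp) (test_fun_smooth tq)); ring.
rewrite Rintegral_mkcond (_ : _ \_ Omega = partial i (fun x => phi x * psi x)).
  by rewrite /Rintegral (test_fun_integral_partial i tpq).
apply/funext => x; rewrite patchE; case: ifPn => //; rewrite notin_setE => nx.
by rewrite (test_fun_outU (test_fun_partial i tpq)).
Qed.

Lemma is_weak_partial_test i phi : test_fun Omega phi ->
  is_weak_partial Omega i phi (partial i phi).
Proof.
move=> tp; split; first exact/(L2_test oO bO)/test_fun_partial.
by move=> psi tq; exact: L2dot_partial.
Qed.

Lemma is_weak_partial_lin i c v w g h : L2 Omega v -> L2 Omega w ->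
  is_weak_partial Omega i v g -> is_weak_partial Omega i w h ->
  is_weak_partial Omega i (fun x => c * v x + w x) (fun x => c * g x + h x).
Proof.
move=> Lv Lw [Lg hg] [Lh hh]; split; first exact: L2_lin.
move=> phi tp; have Lp := L2_test oO bO tp.
have Ldp := L2_test oO bO (test_fun_partial i tp).
by rewrite !L2dot_lin// hg// hh// opprD mulrN.
Qed.

Lemma H1_lin c v w : H1 Omega v -> H1 Omega w ->
  H1 Omega (fun x => c * v x + w x).
Proof.
move=> [Lv hv] [Lw hw]; split; first exact: L2_lin.
move=> i; have [g hg] := hv i; have [h hh] := hw i.
by eexists; exact: is_weak_partial_lin hg hh.
Qed.

Lemma H1_weak_partial i v : H1 Omega v ->
  is_weak_partial Omega i v (weak_partial Omega i v).
Proof. by move=> [_ /(_ i)[g hg]]; exact: (xgetPex (fun=> 0)) (ex_intro _ g hg). Qed.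

Lemma H1_test phi : test_fun Omega phi -> H1 Omega phi.
Proof.
move=> tp; split; first exact: L2_test.
by move=> i; eexists; exact: is_weak_partial_test.
Qed.

Lemma weak_partial_test i phi : test_fun Omega phi ->
  {ae leb, forall x, Omega x -> weak_partial Omega i phi x = partial i phi x}.
Proof.
move=> tp; apply: is_weak_partial_unique; last exact: is_weak_partial_test.
exact/H1_weak_partial/H1_test.
Qed.

Lemma weak_partial_lin i c v w : H1 Omega v -> H1 Omega w ->
  {ae leb, forall x, Omega x -> weak_partial Omega i (fun x => c * v x + w x) x =
     c * weak_partial Omega i v x + weak_partial Omega i w x}.
Proof.
move=> hv hw; apply: is_weak_partial_unique.
  exact/H1_weak_partial/H1_lin.
apply: is_weak_partial_lin; [by case: hv|by case: hw|..];
exact: H1_weak_partial.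
Qed.

(** A function followed by its n first derivatives. The notion of derivative is
    a parameter: classical and weak jets then share the same forms, and on test
    functions they agree almost everywhere. *)
Definition jet (D : 'I_n -> (E -> R) -> E -> R) v (j : 'I_n.+1) : E -> R :=
  if unlift ord0 j is Some i then D i v else v.

Definition wjet := jet (weak_partial Omega).
Definition cjet := jet (@partial R n).

Lemma jet0 D v : jet D v ord0 = v.
Proof. by rewrite /jet unlift_none. Qed.

Lemma jetS D v i : jet D v (lift ord0 i) = D i v.
Proof. by rewrite /jet liftK. Qed.

Lemma L2_wjet v j : H1 Omega v -> L2 Omega (wjet v j).
Proof.
move=> hv; rewrite /wjet /jet; case: unlift => [i|]; last by case: hv.
by have [] := H1_weak_partial i hv.
Qed.

Lemma test_cjet phi j : test_fun Omega phi -> test_fun Omega (cjet phi j).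
Proof.
by move=> tp; rewrite /cjet /jet; case: unlift => // i; exact: test_fun_partial.
Qed.

Lemma L2_cjet phi j : test_fun Omega phi -> L2 Omega (cjet phi j).
Proof. by move=> tp; exact/(L2_test oO bO)/test_cjet. Qed.

Lemma wjet_test phi j : test_fun Omega phi ->
  {ae leb, forall x, Omega x -> wjet phi j x = cjet phi j x}.
Proof.
move=> tp; rewrite /wjet /cjet /jet; case: unlift => [i|].
  exact: weak_partial_test.
exact: aeW.
Qed.

Lemma wjet_lin c v w j : H1 Omega v -> H1 Omega w ->
  {ae leb, forall x, Omega x -> wjet (fun x => c * v x + w x) j x =
     c * wjet v j x + wjet w j x}.
Proof.
move=> hv hw; rewrite /wjet /jet; case: unlift => [i|].
  exact: weak_partial_lin.
exact: aeW.
Qed.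

Lemma cjet_lin c phi psi j : smooth phi -> smooth psi ->
  cjet (fun x => c * phi x + psi x) j =
  fun x => c * cjet phi j x + cjet psi j x.
Proof.
move=> sp sq; rewrite /cjet /jet; case: unlift => // i.
rewrite (partialD i (f := fun x => c * phi x)) ?partialZ//.
by apply: smoothM => //; exact: smooth_cst.
Qed.

(** A bilinear form on jets, diagonal with weights a. It covers at once the
    squared H^1 norm, the Dirichlet integral, the L^2 product and the energy
    of the operator, all of which differ only by their weights. *)
Definition wform (a X Y : 'I_n.+1 -> E -> R) : R :=
  \sum_j L2dot Omega (fun x => a j x * X j x) (Y j).

Definition unitw (j : 'I_n.+1) (x : E) : R := 1.

Section wform.
Variables (a X Y Z : 'I_n.+1 -> E -> R).
Hypotheses (ba : forall j, bmf Omega (a j)) (LX : forall j, L2 Omega (X j))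
  (LY : forall j, L2 Omega (Y j)) (LZ : forall j, L2 Omega (Z j)).

Let LaX j : L2 Omega (fun x => a j x * X j x).
Proof. exact: L2_bmfM. Qed.

Let LaY j : L2 Omega (fun x => a j x * Y j x).
Proof. exact: L2_bmfM. Qed.

Lemma wformC : wform a X Y = wform a Y X.
Proof.
by apply: eq_bigr => j _; apply: eq_Rintegral => x _; rewrite mulrAC.
Qed.

Lemma wform_linl c :
  wform a (fun j x => c * X j x + Y j x) Z = c * wform a X Z + wform a Y Z.
Proof.
rewrite /wform mulr_sumr -big_split/=; apply: eq_bigr => j _.
rewrite -L2dot_lin//; apply: eq_Rintegral => x _; ring.
Qed.

Lemma wform_ael (X' : 'I_n.+1 -> E -> R) : (forall j, L2 Omega (X' j)) ->
  (forall j, {ae leb, forall x, Omega x -> X' j x = X j x}) ->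
  wform a X' Y = wform a X Y.
Proof.
move=> LX' h; apply: eq_bigr => j _; apply: L2dot_ae => //.
  exact: L2_bmfM.
by apply: filterS (h j) => x hx Ox; rewrite hx.
Qed.

Lemma wformE : (\int[leb]_(x in Omega) (\sum_j a j x * X j x * Y j x)%:E)%E =
  (wform a X Y)%:E.
Proof.
rewrite /wform -sumEFin.
transitivity (\sum_(j < n.+1) \int[leb]_(x in Omega) (a j x * X j x * Y j x)%:E)%E.
  rewrite -integral_sum//; last by move=> j; exact: L2_mul_integrable.
  by apply: eq_integral => x _; rewrite sumEFin.
apply: eq_bigr => j _; rewrite /L2dot /Rintegral fineK//.
by apply: integrable_fin_num => //; exact: L2_mul_integrable.
Qed.

End wform.

Lemma le_wform (a b X Y : 'I_n.+1 -> E -> R) :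
  (forall j, bmf Omega (a j)) -> (forall j, bmf Omega (b j)) ->
  (forall j, L2 Omega (X j)) -> (forall j, L2 Omega (Y j)) ->
  (forall j x, Omega x -> a j x * X j x ^+ 2 <= b j x * Y j x ^+ 2) ->
  wform a X X <= wform b Y Y.
Proof.
move=> ba bb LX LY h; apply: ler_sum => j _.
apply: le_L2dot => //; try exact: L2_bmfM.
by move=> x Ox; rewrite -!mulrA -!expr2; exact: h.
Qed.

Lemma bmf_unitw j : bmf Omega (unitw j).
Proof. exact: bmf_cst. Qed.

Lemma wform_unitw_ge0 X : 0 <= wform unitw X X.
Proof.
apply: sumr_ge0 => j _; rewrite /unitw.
rewrite (_ : (fun x => 1 * X j x) = X j); first exact: L2dot_ge0.
by apply/funext => x; rewrite mul1r.
Qed.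

Lemma wform_young (a X Y : 'I_n.+1 -> E -> R) (M t : R) : 0 < t ->
  (forall j, bmf Omega (a j)) -> (forall j, L2 Omega (X j)) ->
  (forall j, L2 Omega (Y j)) ->
  (forall j x, Omega x -> `|a j x| <= M) ->
  wform a X Y <= M * (t * wform unitw X X + t^-1 * wform unitw Y Y).
Proof.
move=> t0 ba LX LY aM.
rewrite /wform mulrDr !mulr_sumr -big_split/=; apply: ler_sum => j _.
have L1X : L2 Omega (fun x => unitw j x * X j x) by apply: L2_bmfM => //; exact: bmf_unitw.
have L1Y : L2 Omega (fun x => unitw j x * Y j x) by apply: L2_bmfM => //; exact: bmf_unitw.
have i1 := integrableZl mO (M * t) (L2_mul_integrable oO L1X (LX j)).
have i2 := integrableZl mO (M / t) (L2_mul_integrable oO L1Y (LY j)).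
rewrite !mulrA -RintegralZl//; last exact: L2_mul_integrable.
rewrite -[X in _ + X]RintegralZl//; last exact: L2_mul_integrable.
rewrite -RintegralD//.
apply: le_Rintegral => //.
- by apply: L2_mul_integrable => //; exact: L2_bmfM.
- exact: integrableD i1 i2.
move=> x Ox; rewrite /unitw !mul1r.
have M0 := le_trans (normr_ge0 _) (aM j x Ox).
apply: le_trans (ler_norm _) _; rewrite -mulrA normrM.
apply: (@le_trans _ _ (M * `|X j x * Y j x|)).
  by rewrite ler_wpM2r//; exact: aM.
rewrite -!(mulrA M) -mulrDr ler_wpM2l//.
set x1 := X j x; set y1 := Y j x.
rewrite ler_norml; apply/andP; split.
  have : 0 <= t^-1 * ((t * x1 + y1) ^+ 2 + (t * x1) ^+ 2 + y1 ^+ 2).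
    by rewrite mulr_ge0 ?invr_ge0 ?(ltW t0)// !addr_ge0// sqr_ge0.
  have -> : t^-1 * ((t * x1 + y1) ^+ 2 + (t * x1) ^+ 2 + y1 ^+ 2) =
    2 * (t * (x1 * x1)) + 2 * (t^-1 * (y1 * y1)) + 2 * (x1 * y1).
    by field; rewrite gt_eqF.
  lra.
have : 0 <= t^-1 * ((t * x1 - y1) ^+ 2 + (t * x1) ^+ 2 + y1 ^+ 2).
  by rewrite mulr_ge0 ?invr_ge0 ?(ltW t0)// !addr_ge0// sqr_ge0.
have -> : t^-1 * ((t * x1 - y1) ^+ 2 + (t * x1) ^+ 2 + y1 ^+ 2) =
  2 * (t * (x1 * x1)) + 2 * (t^-1 * (y1 * y1)) - 2 * (x1 * y1).
  by field; rewrite gt_eqF.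
lra.
Qed.

Lemma gradnorm2E v : H1 Omega v ->
  (L2norm2 Omega v + gradnorm2 Omega v = (wform unitw (wjet v) (wjet v))%:E)%E.
Proof.
move=> hv; have Lj j := L2_wjet j hv.
rewrite -(wformE bmf_unitw Lj Lj) /L2norm2 /gradnorm2.
have i1 := L2_sqr_integrable hv.1.
have i2 : leb.-integrable Omega (fun x =>
    (\sum_(i < n) weak_partial Omega i v x ^+ 2)%:E).
  under eq_fun do rewrite -sumEFin; apply: integrable_sum => // i _.
  by apply: L2_sqr_integrable; have [] := H1_weak_partial i hv.
rewrite -integralD//.
  apply: eq_integral => x _; rewrite -EFinD; congr EFin.
  rewrite big_ord_recl /unitw /wjet jet0 !mul1r -expr2; congr (_ + _).
  rewrite /enorm sqr_sqrtr; last by apply: sumr_ge0 => i _; exact: sqr_ge0.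
  by apply: eq_bigr => i _; rewrite jetS !mul1r mxE expr2.
apply: eq_integrable i2 => // x _; congr EFin.
rewrite /enorm sqr_sqrtr; last by apply: sumr_ge0 => i _; exact: sqr_ge0.
by apply: eq_bigr => i _; rewrite mxE.
Qed.

Lemma H10_test phi : test_fun Omega phi -> H10 Omega phi.
Proof.
move=> tp; split; first exact: H1_test.
move=> e e0; exists phi => //; rewrite subrr.
have t0 := test_fun0 Omega.
have h0 := H1_test t0; rewrite -[0]/(fun=> 0) (gradnorm2E h0).
rewrite lte_fin (_ : wform _ _ _ = 0)//; apply: big1 => j _.
rewrite (_ : L2dot _ _ _ = L2dot Omega (fun x => 0) (wjet (fun=> 0) j)).
  rewrite /L2dot (_ : (fun x => 0 * _) = fun=> 0).
    by rewrite Rintegral_cst// mul0r.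
  by apply/funext => x; rewrite mul0r.
apply: L2dot_ae => //.
- by apply: L2_bmfM => //; [exact: bmf_unitw|exact: L2_wjet].
- exact/L2_bmf/bmf_cst.
- exact: L2_wjet.
- have := wjet_test j t0; apply: filterS => x + Ox => /(_ Ox) ->.
  rewrite /cjet /jet; case: unlift => [i|]; last by rewrite mulr0.
  by rewrite /partial derive_cst mulr0.
Qed.

End sobolev.

(** * Slowly varying bumps in logarithmic coordinates *)

Section log_profile.
Context (R : realType).
Implicit Types (g : R -> R) (k t s : R).

(** The function t^(-k) g(ln t) on the half-line t > 0. The derivative of such a
    function is of the same kind, with exponent k + 1. *)
Definition lprofile k g t : R := if 0 < t then expR (- (k * ln t)) * g (ln t) else 0.

Lemma is_derive_lprofile k g dg s0 t : (forall s, s <= s0 -> g s = 0) ->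
  (forall s, is_derive s (1 : R) g (dg s)) ->
  is_derive t (1 : R) (lprofile k g)
    (lprofile (k + 1) (fun s => dg s - k * g s) t).
Proof.
move=> g0 hg.
have dg0 s : s < s0 -> dg s = 0.
  move=> ss0; have := hg s => h; rewrite -(@derive_val _ _ _ _ _ _ _ h).
  rewrite (@near_eq_derive _ _ _ g (cst 0)); first exact: derive_cst.
  have : \forall u \near s, u < s0 by exact: lt_nbhsl.
  by apply: filterS => u /ltW /g0.
have [t0|t0] := ltP 0 t; last first.
  have tlt : t < expR (s0 - 1) by apply: le_lt_trans t0 (expR_gt0 _).
  rewrite {2}/lprofile ltNge t0 /=.
  refine (@near_eq_is_derive R _ _ (cst 0) (lprofile k g) t 1 _ _ (is_derive_cst _ _ _)).
  have : \forall u \near t, u < expR (s0 - 1) by exact: lt_nbhsl.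
  apply: filterS => u ut; rewrite /lprofile; case: ifPn => // u0.
  rewrite g0 ?mulr0//; rewrite -(@ler_expR R) lnK ?posrE//.
  by apply: le_trans (ltW ut) _; rewrite ler_expR; lra.
refine (@near_eq_is_derive R _ _
  (fun u : R => expR (- (k * ln u)) * g (ln u)) (lprofile k g) t 1 _ _ _).
  have : \forall u \near t, 0 < u by exact: lt_nbhsr.
  by apply: filterS => u u0; rewrite /lprofile u0.
have dln := is_derive1_ln t0.
have dk : is_derive t (1 : R) (fun u : R => - (k * ln u)) (- (k * t^-1)).
  have := is_deriveN (is_derive1M (is_derive_cst k t 1) dln).
  by move=> h; apply: (is_derive_eq h); rewrite mulr0 addr0.
apply: (is_derive_eq (is_derive1M (is_derive1_comp (is_derive_expR _) dk)
  (is_derive1_comp (hg _) dln))).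
have lnt : expR (- ln t) = t^-1 by rewrite expRN lnK ?posrE.
rewrite /lprofile t0 mulrDl mul1r opprD expRD lnt /=.
ring.
Qed.

Lemma smooth1_lprofile k g s0 : smooth1 g -> (forall s, s <= s0 -> g s = 0) ->
  smooth1 (lprofile k g).
Proof.
move=> sg g0.
apply: (smooth1_coind (P := fun F => exists k g s0,
  [/\ smooth1 g, forall s, s <= s0 -> g s = 0 & F = lprofile k g])); last first.
  by exists k, g, s0.
move=> _ [{}k [{}g [{}s0 [{}sg {}g0 ->]]]].
exists (lprofile (k + 1) (fun s => derive1 g s - k * g s)).
  move=> s; apply: is_derive_lprofile g0 _ => u; exact: smooth1_is_derive.
exists (k + 1), (fun s => derive1 g s - k * g s), (s0 - 1); split=> //.
  apply: smooth1_gen_smooth1; apply: smooth1_genD.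
    by apply: smooth1_gen_base; exact: smooth1_derive1.
  under eq_fun do rewrite -mulNr.
  apply: smooth1_genM; first exact: smooth1_gen_cst.
  exact: smooth1_gen_base.
move=> s ss0; rewrite g0 ?mulr0 ?subr0; last by lra.
rewrite derive1E (@near_eq_derive _ _ _ g (cst 0)); first exact: derive_cst.
have : \forall u \near s, u < s0 by apply: lt_nbhsl; lra.
by apply: filterS => u /ltW /g0.
Qed.

(** A bump whose second derivative is bounded below by a multiple of itself:
    near the ends of its support it is convex. *)
Lemma semiconvex_bump : exists B B1 B2 : R -> R,
  [/\ smooth1 B, forall s, is_derive s (1 : R) B (B1 s),
      forall s, is_derive s (1 : R) B1 (B2 s) &
      [/\ forall s, 0 <= B s, forall s, - 36 * B s <= B2 s,
          forall s, ~~ (0 < s < 1) -> B s = 0 & forall s, 0 < s < 1 -> 0 < B s]].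
Proof.
pose e2 := flat 'X^2 : R -> R; pose e4 := flat ('X^4 - 2%:P * 'X^3) : R -> R.
have d1 s : is_derive s (1 : R) (flat 1) (e2 s).
  have := is_derive_flat 1 s; rewrite (_ : 'X^2 * _ = 'X^2)//.
  by rewrite derivC subr0 mulr1.
have d2 s : is_derive s (1 : R) e2 (e4 s).
  have := is_derive_flat 'X^2 s; rewrite (_ : 'X^2 * _ = 'X^4 - 2%:P * 'X^3)//.
  by rewrite derivXn/= -mulr_natl polyC_natr; ring.
have dr s : is_derive s (1 : R) (fun u : R => 1 - u) (-1).
  have := is_deriveD (is_derive_cst (1:R) s 1) (is_deriveN (is_derive_id s (1 : R))).
  by move=> h; apply: (is_derive_eq h); rewrite add0r.
have d1r s : is_derive s (1 : R) (fun u => flat 1 (1 - u)) (- e2 (1 - s)).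
  by apply: (is_derive_eq (is_derive1_comp (d1 _) (dr s))); rewrite mulrN1.
have d2r s : is_derive s (1 : R) (fun u => e2 (1 - u)) (- e4 (1 - s)).
  by apply: (is_derive_eq (is_derive1_comp (d2 _) (dr s))); rewrite mulrN1.
pose B s := flat 1 s * flat 1 (1 - s) : R.
pose B1 s := flat 1 s * - e2 (1 - s) + flat 1 (1 - s) * e2 s.
pose B2 s := (flat 1 s * e4 (1 - s) + - e2 (1 - s) * e2 s) +
  (flat 1 (1 - s) * e4 s + e2 s * - e2 (1 - s)).
have flat1_pos s : 0 < s -> 0 < flat 1 s :> R.
  by move=> s0; rewrite flat1E// expR_gt0.
exists B, B1, B2; split.
- apply: smooth1_gen_smooth1; apply: smooth1_genM.
    by apply: smooth1_gen_base; exact: smooth1_flat.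
  apply: (@smooth1_gen_comp _ (flat 1)); first exact: smooth1_flat.
  apply: (@smooth1_genD _ (cst 1) (fun s => - s)); first exact: smooth1_gen_cst.
  under eq_fun do rewrite -mulN1r.
  by apply: (@smooth1_genM _ (cst (-1)) id);
    [exact: smooth1_gen_cst|exact: smooth1_gen_id].
- by move=> s; apply: is_derive1M.
- move=> s; apply: is_derive1D; apply: is_derive1M => //.
  apply: (is_derive_eq (is_deriveN (d2r s))); exact: opprK.
split.
- by move=> s; rewrite mulr_ge0 ?flat1_ge0.
- move=> s; case: (boolP (0 < s < 1)) => [/andP[s0 s1]|].
    have t0 : 0 < 1 - s by lra.
    set a := s^-1; set b := (1 - s)^-1.
    have ab : a * b = a + b by rewrite /a /b; field; rewrite !gt_eqF.
    have E2 : e2 s = a ^+ 2 * flat 1 s.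
      by rewrite /e2 /flat s0 !hornerE /= ?mulr1 ?mul1r.
    have E2r : e2 (1 - s) = b ^+ 2 * flat 1 (1 - s).
      by rewrite /e2 /flat t0 !hornerE /= ?mulr1 ?mul1r.
    have E4 : e4 s = (a ^+ 4 - 2 * a ^+ 3) * flat 1 s.
      by rewrite /e4 /flat s0 !hornerE /= ?mulr1 ?mul1r.
    have E4r : e4 (1 - s) = (b ^+ 4 - 2 * b ^+ 3) * flat 1 (1 - s).
      by rewrite /e4 /flat t0 !hornerE /= ?mulr1 ?mul1r.
    (* With a = 1/s and b = 1/(1-s) one has a b = a + b, so that the symmetric
       polynomial B2 / B in a and b depends on x = a b only. *)
    have -> : B2 s =
        ((a * b) ^+ 4 - 6 * (a * b) ^+ 3 + 6 * (a * b) ^+ 2) * B s.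
      rewrite /B2 /B E2 E2r E4 E4r; set f1 := flat 1 s; set f2 := flat 1 (1 - s).
      transitivity (((a + b) ^+ 4 - 4 * (a * b) * (a + b) ^+ 2 -
        2 * ((a + b) ^+ 3 - 3 * (a * b) * (a + b))) * (f1 * f2)); first by ring.
      by rewrite -ab; ring.
    apply: ler_wpM2r; first by rewrite mulr_ge0 ?flat1_ge0.
    set x := a * b; rewrite -subr_ge0.
    have -> : x ^+ 4 - 6 * x ^+ 3 + 6 * x ^+ 2 - - 36 =
        (x ^+ 2 - 3 * x - 3) ^+ 2 + 3 * (x - 3) ^+ 2 by ring.
    by rewrite addr_ge0 ?sqr_ge0// mulr_ge0 ?sqr_ge0.
  rewrite negb_and -!leNgt => /orP[h|h].
    by rewrite /B2 /B /e2 /e4 !(flat_neg _ h) !(mul0r, mulr0, mulrN, addr0, oppr0).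
  have h' : 1 - s <= 0 by lra.
  by rewrite /B2 /B /e2 /e4 !(flat_neg _ h') !(mul0r, mulr0, mulNr, addr0, oppr0).
- move=> s; rewrite negb_and -!leNgt => /orP[h|h].
    by rewrite /B (flat_neg _ h) mul0r.
  by rewrite /B [flat _ (1 - s)]flat_neg ?mulr0//; lra.
- by move=> s /andP[s0 s1]; rewrite mulr_gt0 ?flat1_pos//; lra.
Qed.

(** Stretching the bump to length N divides the constant by N^2: a slowly
    varying bump is almost convex. *)
Lemma wide_semiconvex_bump (l N : R) : 0 < N -> exists B B1 B2 : R -> R,
  [/\ smooth1 B, forall s, is_derive s (1 : R) B (B1 s),
      forall s, is_derive s (1 : R) B1 (B2 s) &
      [/\ forall s, 0 <= B s, forall s, - (36 / N ^+ 2) * B s <= B2 s,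
          forall s, ~~ (l < s < l + N) -> B s = 0 &
          forall s, l < s < l + N -> 0 < B s]].
Proof.
move=> N0; have [B [B1 [B2 [sB hB1 hB2 [B0 hB Bout Bin]]]]] := semiconvex_bump.
pose h s := (s - l) / N : R.
have dh s : is_derive s (1 : R) h N^-1.
  have := is_derive1M (is_derive1D (is_derive_id s (1 : R))
    (is_derive_cst (- l) s 1)) (is_derive_cst N^-1 s 1).
  by move=> H; apply: (is_derive_eq H); rewrite mulr0 add0r addr0 mulr1.
have hin s : (0 < h s < 1) = (l < s < l + N).
  by rewrite /h pmulr_lgt0 ?invr_gt0// ltr_pdivrMr// mul1r subr_gt0 ltrBlDl.
exists (B \o h), (fun s => B1 (h s) * N^-1), (fun s => B2 (h s) * N^-1 * N^-1).
split.
- apply: smooth1_gen_smooth1; apply: smooth1_gen_comp => //.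
  apply: (@smooth1_genM _ (fun s => s - l) (cst N^-1)); last exact: smooth1_gen_cst.
  by apply: (@smooth1_genD _ id (cst (- l))); [exact: smooth1_gen_id|exact: smooth1_gen_cst].
- by move=> s; exact: is_derive1_comp.
- move=> s; have := is_derive1M (is_derive1_comp (hB2 (h s)) (dh s))
    (is_derive_cst N^-1 s 1).
  by move=> H; apply: (is_derive_eq H); rewrite mulr0 add0r mulrC.
split.
- by move=> s; exact: B0.
- move=> s; have N20 : 0 <= N^-1 * N^-1 by rewrite mulr_ge0// invr_ge0 ltW.
  rewrite -mulrA; apply: le_trans (ler_wpM2r N20 (hB (h s))).
  have -> : (N ^+ 2)^-1 = N^-1 * N^-1 by rewrite expr2 invfM.
  by rewrite le_eqVlt; apply/orP; left; apply/eqP => /=; ring.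
- by move=> s; rewrite -hin => /Bout.
- by move=> s; rewrite -hin => /Bin.
Qed.

End log_profile.

(** * The potential, and radial functions *)

Section hardy.
Context (R : realType) (n : nat) (Omega : set 'rV[R]_n).
Hypotheses (oO : open Omega) (bO : bounded_set Omega).
Local Notation E := 'rV[R]_n.
Local Notation leb := (@lebesgue_rV R n).

Let mO : measurable Omega. Proof. exact: measurable_rV_open. Qed.

Definition potential (mu eps : R) (x : E) : R := mu / (sqn x + eps ^+ 2).

Lemma potential_den_gt0 (eps : R) (x : E) : 0 < eps -> 0 < sqn x + eps ^+ 2.
Proof. by move=> e0; rewrite ltr_wpDl ?sqn_ge0// exprn_gt0. Qed.

Lemma potential_bound (mu eps : R) x : 0 < mu -> 0 < eps ->
  0 <= potential mu eps x <= mu / eps ^+ 2.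
Proof.
move=> m0 e0; have d0 := potential_den_gt0 x e0; apply/andP; split.
  by rewrite divr_ge0 ?ltW.
by rewrite ler_pM2l// lef_pV2 ?posrE ?exprn_gt0// lerDr sqn_ge0.
Qed.

Lemma bmf_potential (mu eps : R) : 0 < mu -> 0 < eps ->
  bmf Omega (potential mu eps).
Proof.
move=> m0 e0; split; last first.
  exists (mu / eps ^+ 2) => x _.
  by have /andP[h1 h2] := potential_bound x m0 e0; rewrite ger0_norm.
apply: measurable_funTS; apply: continuous_measurable_rV => x.
have c1 : {for x, continuous (fun x : E => sqn x + eps ^+ 2)}.
  apply: continuousD; last exact: cst_continuous.
  by apply: smooth_continuous; exact: smooth_sqn.
apply: (@continuousM _ _ (cst mu) (fun x => (sqn x + eps ^+ 2)^-1) x).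
  exact: cst_continuous.
apply: (@continuous_comp _ _ _ (fun x => sqn x + eps ^+ 2) GRing.inv) => //.
by apply: inv_continuous; rewrite gt_eqF// potential_den_gt0.
Qed.

(** Weights of the quadratic form  int p |grad v|^2 + c v^2 *)
Definition qweight (p c : E -> R) (j : 'I_n.+1) : E -> R :=
  if unlift ord0 j is Some _ then p else c.

Lemma bmf_qweight p c j : bmf Omega p -> bmf Omega c ->
  bmf Omega (qweight p c j).
Proof. by rewrite /qweight; case: unlift. Qed.

Lemma wform_qweight p c D D' v w :
  wform Omega (qweight p c) (jet D v) (jet D' w) =
  L2dot Omega (fun x => c x * v x) w +
  \sum_i L2dot Omega (fun x => p x * D i v x) (D' i w).
Proof.
rewrite /wform big_ord_recl !jet0 /qweight unlift_none; congr (_ + _).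
by apply: eq_bigr => i _; rewrite !jetS liftK.
Qed.

Lemma radial_partial2 (F : R -> R) i : smooth1 F ->
  partial i (partial i (fun x => F (sqn x))) = fun x : E =>
    4 * x ord0 i ^+ 2 * derive1 (derive1 F) (sqn x) + 2 * derive1 F (sqn x).
Proof.
move=> sF; rewrite (partial_comp i sF (@smooth_sqn R n)) partial_sqn.
have s1 := smooth1_derive1 sF.
rewrite (partialM i (smooth_comp s1 (@smooth_sqn R n))); last first.
  by apply: smoothM; [exact: smooth_cst|exact: smooth_coord].
apply/funext => x; rewrite (partial_comp i s1 (@smooth_sqn R n)) partial_sqn.
by rewrite (partialZ 2 i (smooth_coord R i)) partial_coord eqxx /=; ring.
Qed.

Lemma L2_sum (I : Type) (s : seq I) (g : I -> E -> R) :
  (forall i, L2 Omega (g i)) -> L2 Omega (fun x => \sum_(i <- s) g i x).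
Proof.
move=> Lg; elim: s => [|i s ih].
  under eq_fun do rewrite big_nil; exact: L2_0.
rewrite (_ : (fun x => _) = fun x => 1 * g i x + \sum_(i <- s) g i x).
  exact: L2_lin.
by apply/funext => x; rewrite big_cons mul1r.
Qed.

Lemma L2dotZ c v z : L2 Omega v -> L2 Omega z ->
  L2dot Omega (fun x => c * v x) z = c * L2dot Omega v z.
Proof.
move=> Lv Lz; rewrite /L2dot -RintegralZl//; last exact: L2_mul_integrable.
by apply: eq_Rintegral => x _; rewrite mulrA.
Qed.

Lemma L2dot_sum (I : Type) (s : seq I) (g : I -> E -> R) z :
  (forall i, L2 Omega (g i)) -> L2 Omega z ->
  L2dot Omega (fun x => \sum_(i <- s) g i x) z = \sum_(i <- s) L2dot Omega (g i) z.
Proof.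
move=> Lg Lz; elim: s => [|i s ih].
  rewrite big_nil /L2dot (_ : (fun x => _) = fun=> 0).
    by rewrite Rintegral_cst// mul0r.
  by apply/funext => x; rewrite big_nil mul0r.
rewrite (_ : (fun x => \sum_(i <- _) _) = fun x => 1 * g i x + \sum_(i <- s) g i x).
  rewrite L2dot_lin//; last exact: L2_sum.
  by rewrite mul1r ih big_cons.
by apply/funext => x; rewrite big_cons mul1r.
Qed.

(** Green's identity for a radial function *)
Lemma radial_dirichlet (F : R -> R) : smooth1 F ->
  test_fun Omega (fun x => F (sqn x)) ->
  let G x := - (4 * sqn x * derive1 (derive1 F) (sqn x) +
     2 * n%:R * derive1 F (sqn x)) in
  L2 Omega G /\ 
  \sum_i L2dot Omega (partial i (fun x => F (sqn x)))
                     (partial i (fun x => F (sqn x))) =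
  L2dot Omega G (fun x => F (sqn x)).
Proof.
move=> sF tF; set phi := fun x => F (sqn x) => G.
have Lp := L2_test oO bO tF.
have Ldd i : L2 Omega (partial i (partial i phi)).
  by apply: L2_test => //; do 2 apply: test_fun_partial.
have LS : L2 Omega (fun x => \sum_i partial i (partial i phi) x).
  exact: L2_sum.
have GE : G = fun x => -1 * \sum_i partial i (partial i phi) x.
  apply/funext => x; rewrite mulN1r; congr (- _).
  under eq_bigr do rewrite radial_partial2//.
  rewrite big_split/= sumr_const card_ord -!mulr_suml -mulr_sumr /sqn.
  by rewrite -[_ *+ n]mulr_natr; ring.
split; first by rewrite GE; apply: L2_bmfM => //; exact: bmf_cst.
rewrite GE L2dotZ// mulN1r L2dot_sum// -sumrN.
by apply: eq_bigr => i _; exact: (L2dot_partial oO bO i (test_fun_partial i tF) tF).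
Qed.

Lemma L2dot_test_gt0 phi x0 : test_fun Omega phi -> phi x0 != 0 ->
  0 < L2dot Omega phi phi.
Proof.
move=> tp p0; have Ox0 : Omega x0.
  by apply: contrapT => /(test_fun_outU tp) /eqP; rewrite (negbTE p0).
pose c := `|phi x0| / 2; have c0 : 0 < c by rewrite divr_gt0// normr_gt0.
have : nbhs x0 (Omega `&` [set x | c < `|phi x|]).
  apply: filterI; first exact: open_nbhs_nbhs.
  apply: (@cvgr_gt _ _ _ (nbhs_filter x0) (fun x => `|phi x|) `|phi x0|).
    by apply: cvg_norm; apply: smooth_continuous; exact: test_fun_smooth tp.
  by rewrite /c ltr_pdivrMr// ltr_pMr ?normr_gt0// ltr1n.
move=> /nbhs_ballP[r /= r0 hr].
pose I x := \1_(ball x0 r) x : R.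
have mI : measurable_fun Omega I.
  apply: measurable_indic; exact: measurable_rV_ball.
have bI : bmf Omega (fun x => c * I x).
  apply: bmfM; first exact: bmf_cst.
  split=> //; exists 1 => x _; rewrite /I indicE.
  by case: (_ \in _); rewrite ?normr1 ?normr0.
have LI := L2_bmf oO bO bI; have Lp := L2_test oO bO tp.
apply: (@lt_le_trans _ _ (L2dot Omega (fun x => c * I x) (fun x => c * I x))).
  rewrite /L2dot (_ : \int[_]_(x in _) _ = c ^+ 2 * (r *+ 2) ^+ n).
    by rewrite mulr_gt0 ?exprn_gt0// mulrn_wgt0.
  have sub : ball x0 r `<=` Omega by move=> x /hr[].
  rewrite /Rintegral.
  rewrite (_ : (\int[_]_(x in _) _ = \int[leb]_(x in Omega) ((c ^+ 2)%:E * (I x)%:E))%E).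
    rewrite integralZl//.
      rewrite /I integral_indic//; last exact: measurable_rV_ball.
      by rewrite setIidl//= lebesgue_rV_ball.
    apply: (bounded_support_integrable (A := ball x0 r) (M := 1)) => //.
    - exact: measurable_rV_ball.
    - by rewrite /= lebesgue_rV_ball// ltry.
    - by move=> x _; rewrite mul1r ger0_norm.
  apply: eq_integral => x _; rewrite -EFinM; congr EFin.
  rewrite /I indicE; case: (_ \in _); rewrite ?mulr1 ?mulr0 ?expr2//.
apply: le_L2dot => // x Ox; rewrite /I indicE.
case: (boolP (x \in _)) => [|_]; last by rewrite !mulr0 -expr2 sqr_ge0.
rewrite inE !mulr1 => /hr[_ /= hx].
rewrite -!expr2 -(real_normK (num_real (phi x))) lerXn2r ?nnegrE//; exact: ltW.
Qed.

End hardy.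

(** * Optimality of the Hardy constant *)

(** The optimality of Hardy's inequality. The test function is
    |x|^(-(n-2)/2) B(ln |x|^2) with B a bump of length N: up to the error
    144/N^2 its Dirichlet integral is mu* int phi^2/|x|^2, which the potential
    beats since mu > p2 mu*. Concentrating the support at 0 then makes
    the gain d/|x|^2 larger than any prescribed level Ls. *)
Lemma hardy_test (R : realType) (n : nat) (Omega : set 'rV[R]_n)
    (p : 'rV[R]_n -> R) (p2 mu Ls : R) : open Omega -> bounded_set Omega ->
  Omega 0 -> (3 <= n)%N -> 0 < p2 -> bmf Omega p ->
  (forall x, Omega x -> p x <= p2) -> p2 * ((n%:R - 2) ^+ 2 / 4) < mu ->
  exists eps phi, [/\ 0 < eps, test_fun Omega phi, 0 < L2dot Omega phi phi &
    wform Omega (qweight p (fun x => Ls - potential mu eps x))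
      (cjet phi) (cjet phi) <= - L2dot Omega phi phi].
Proof.
move=> oO bO O0 n3 p20 bp pp2 hmu.
have mO := measurable_rV_open oO.
(* The profile is a function of |x|^2, hence the exponent (n-2)/4. *)
pose k : R := (n%:R - 2) / 4; pose ms : R := (n%:R - 2) ^+ 2 / 4.
have nE : n%:R = 4 * k + 2 :> R by rewrite /k; field.
have msE : ms = 4 * k ^+ 2 by rewrite /ms /k; field.
have ms0 : 0 <= ms by rewrite /ms divr_ge0// sqr_ge0.
have mu0 : 0 < mu by apply: le_lt_trans hmu; rewrite mulr_ge0// ltW.
pose d : R := mu - p2 * ms; have d0 : 0 < d by rewrite subr_gt0.
have dmu : d <= mu by rewrite /d lerBlDr lerDl mulr_ge0// ltW.
(* The window is long enough for the error to take half of the margin d. *)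
pose N : R := 1 + 288 * p2 / d.
have N1 : 1 <= N by rewrite lerDl divr_ge0 ?mulr_ge0 ?ltW.
have N0 : 0 < N by exact: lt_le_trans N1.
have hN : p2 * (144 / N ^+ 2) <= d / 2.
  have N2 : 288 * p2 / d <= N ^+ 2.
    by apply: (@le_trans _ _ N); [rewrite lerDr|rewrite expr2 ler_pMr].
  rewrite mulrA ler_pdivrMr ?exprn_gt0//.
  move: N2; rewrite ler_pdivrMr// => N2; lra.
have /nbhs_ballP[r /= r0 rO] : nbhs (0 : 'rV[R]_n) Omega by exact: open_nbhs_nbhs.
(* The support lies in t1 < |x|^2 < t2: inside Omega, and so close to 0 that
   Ls + 1 is at most a quarter of the margin d/|x|^2. *)
pose t2 := Num.min (r ^+ 2 / 2) (d / (4 * (`|Ls| + 1))).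
have L0 : 0 < 4 * (`|Ls| + 1) by rewrite mulr_gt0// ltr_wpDl.
have t20 : 0 < t2 by rewrite lt_min !divr_gt0// exprn_gt0.
have t2r : t2 < r ^+ 2.
  rewrite /t2 gt_min; apply/orP; left; rewrite ltr_pdivrMr//.
  by rewrite ltr_pMr ?exprn_gt0// ltr1n.
have t2L : t2 * (4 * (`|Ls| + 1)) <= d.
  by rewrite -ler_pdivlMr// /t2 ge_min lexx orbT.
pose l := ln t2 - N; pose t1 := expR l; have t10 : 0 < t1 by exact: expR_gt0.
(* On the support eps^2 is at most gam |x|^2, which costs a quarter of the
   margin in the regularised potential. *)
pose gam := d / (4 * mu); have gam0 : 0 < gam by rewrite divr_gt0// mulr_gt0.
pose eps := Num.min 1 (gam * t1).
have e0 : 0 < eps by rewrite lt_min ltr01 mulr_gt0.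
have eg : eps ^+ 2 <= gam * t1.
  rewrite expr2; apply: (@le_trans _ _ eps); last by rewrite /eps ge_min lexx orbT.
  by rewrite ler_piMr ?(ltW e0)// /eps ge_min lexx.
have [B [B1 [B2 [sB hB1 hB2 [B0 hB Bout Bin]]]]] := wide_semiconvex_bump l N0.
have Bl s : s <= l -> B s = 0.
  by move=> sl; apply: Bout; rewrite negb_and -leNgt sl.
pose F := lprofile k B; have sF : smooth1 F by exact: smooth1_lprofile Bl.
pose G1 s := B1 s - k * B s; pose G2 s := B2 s - k * B1 s - (k + 1) * G1 s.
have F1 : derive1 F = lprofile (k + 1) G1.
  apply/funext => s; have := is_derive_lprofile k s Bl hB1 => h.
  by rewrite derive1E derive_val.
have hG1 s : is_derive s (1 : R) G1 (B2 s - k * B1 s).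
  have := is_deriveB (hB2 s) (is_derive1M (is_derive_cst k s 1) (hB1 s)).
  by move=> h; apply: (is_derive_eq h); rewrite mulr0 addr0.
have G1l s : s <= l - 1 -> G1 s = 0.
  move=> sl; rewrite /G1 Bl ?mulr0 ?subr0; last by lra.
  have := hB1 s => h; rewrite -(@derive_val _ _ _ _ _ _ _ h).
  rewrite (@near_eq_derive _ _ _ B (cst 0)); first exact: derive_cst.
  have : \forall u \near s, u < l by apply: lt_nbhsl; lra.
  by apply: filterS => u /ltW /Bl.
have F2 : derive1 (derive1 F) = lprofile (k + 2) G2.
  apply/funext => s; rewrite F1.
  have := is_derive_lprofile (k + 1) s G1l hG1 => h.
  rewrite derive1E derive_val (_ : k + 1 + 1 = k + 2)//; lra.
pose phi (x : 'rV[R]_n) := F (sqn x).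
have phi_supp x : phi x != 0 -> t1 < sqn x < t2.
  rewrite /phi /F /lprofile; case: ifPn => [s0|]; last by rewrite eqxx.
  rewrite mulf_eq0 negb_or => /andP[_ hb].
  have : l < ln (sqn x) < l + N by apply: contraNT hb => /Bout ->.
  rewrite subrK -(@ltr_expR R l) lnK ?posrE// => /andP[-> h].
  by move: h; rewrite -ltr_expR !lnK ?posrE.
have sp : smooth phi by apply: smooth_comp => //; exact: smooth_sqn.
have tphi : test_fun Omega phi.
  have Kr x : sqn x <= t2 -> `|x| < r.
    by move=> h; apply: norm_le_sqn => //; exact: le_lt_trans h t2r.
  apply: (test_fun_sub (K := [set x | sqn x <= t2])) => //.
  - apply: bounded_closed_compact.
      exists r; split; first exact: num_real.
      by move=> M rM x /= /Kr xr; apply: ltW; exact: lt_trans rM.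
    rewrite (_ : [set x | _] = @sqn R n @^-1` [set t | t <= t2])//.
    apply: closed_comp; last exact: closed_le.
    by move=> x _; apply: smooth_continuous; exact: smooth_sqn.
  - by move=> x /= /Kr xr; apply: rO; rewrite -ball_normE/= sub0r normrN.
  - by move=> x /phi_supp/andP[_ /ltW].
have [LG dirE] := radial_dirichlet oO bO sF tphi.
set G := (G in L2 _ G) in LG dirE.
have Gphi x : phi x != 0 ->
    G x * phi x <= (ms + 144 / N ^+ 2) / sqn x * phi x ^+ 2.
  move=> px; have /andP[ht1 ht2] := phi_supp x px.
  have s0 : 0 < sqn x by exact: lt_trans ht1.
  rewrite /G /phi F2 F1 /F /lprofile s0; set s := sqn x; set u := ln s.
  have es : expR (- u) = s^-1 by rewrite expRN lnK ?posrE.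
  have E1 : expR (- ((k + 1) * u)) = expR (- (k * u)) * s^-1.
    by rewrite mulrDl mul1r opprD expRD es.
  have E2 : expR (- ((k + 2) * u)) = expR (- (k * u)) * s^-1 * s^-1.
    rewrite (_ : - ((k + 2) * u) = - (k * u) + - u + - u); last by ring.
    by rewrite !expRD es.
  rewrite E1 E2; set e := expR (- (k * u)).
  have e00 : 0 < e by exact: expR_gt0.
  have -> : - (4 * s * (e * s^-1 * s^-1 * G2 u) + 2 * n%:R * (e * s^-1 * G1 u)) *
      (e * B u) = e ^+ 2 * s^-1 * (ms * B u - 4 * B2 u) * B u.
    by rewrite /G2 /G1 nE msE; field; rewrite gt_eqF.
  have -> : (ms + 144 / N ^+ 2) / s * (e * B u) ^+ 2 =
      e ^+ 2 * s^-1 * (ms * B u + 4 * ((36 / N ^+ 2) * B u)) * B u.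
    by field; rewrite !gt_eqF.
  apply: ler_wpM2r; first exact: B0.
  apply: ler_wpM2l; first by rewrite mulr_ge0 ?sqr_ge0// invr_ge0 ltW.
  by have := hB u; lra.
have pos : 0 < L2dot Omega phi phi.
  have n0 : (0 < n)%N by exact: leq_trans n3.
  pose i0 := Ordinal n0; pose c := expR ((l + N / 2) / 2).
  pose x0 : 'rV[R]_n := c *: delta_mx ord0 i0.
  have sx0 : sqn x0 = expR (l + N / 2).
    rewrite /sqn (bigD1 i0)//= [X in _ + X]big1.
      rewrite addr0 !mxE !eqxx mulr1 /c -expRM_natl; congr expR; by field.
    by move=> i ii; rewrite !mxE (negbTE ii) mulr0 expr0n.
  apply: (L2dot_test_gt0 oO bO tphi (x0 := x0)).
  rewrite /phi sx0 /F /lprofile expR_gt0 expRK gt_eqF// mulr_gt0 ?expR_gt0//.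
  by apply: Bin; apply/andP; split; lra.
exists eps, phi; split=> //.
have bc : bmf Omega (fun x => Ls - potential mu eps x).
  rewrite (_ : (fun x => _) = fun x => Ls + -1 * potential mu eps x).
    apply: bmfD; first exact: bmf_cst.
    by apply: bmfM; [exact: bmf_cst|exact: bmf_potential].
  by apply/funext => x; rewrite mulN1r.
have Lphi := L2_test oO bO tphi.
have Lc : L2 Omega (fun x => (Ls - potential mu eps x) * phi x) by exact: L2_bmfM.
have Ld i : L2 Omega (partial i phi).
  by apply: L2_test => //; exact: test_fun_partial.
rewrite wform_qweight.
apply: (@le_trans _ _ (L2dot Omega (fun x => (Ls - potential mu eps x) * phi x) phi +
    p2 * L2dot Omega G phi)).
  rewrite lerD2l -dirE mulr_sumr; apply: ler_sum => i _.
  rewrite -L2dotZ//; apply: le_L2dot => //; try exact: L2_bmfM.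
    by apply: L2_bmfM => //; exact: bmf_cst.
  by move=> x Ox; rewrite -!mulrA ler_wpM2r -?expr2 ?sqr_ge0// pp2.
rewrite -subr_le0 opprK.
set A := L2dot _ (fun x => _ * phi x) phi.
rewrite (_ : A + _ + _ = p2 * L2dot Omega G phi + (1 * A + L2dot Omega phi phi));
  last by ring.
rewrite {}/A.
have L1 : L2 Omega (fun x => 1 * ((Ls - potential mu eps x) * phi x) + phi x).
  exact: L2_lin.
rewrite -L2dot_lin// -L2dot_lin//.
apply: (@le_trans _ _ (L2dot Omega (fun=> 0) phi)); last first.
  by rewrite /L2dot (_ : (fun x => _) = fun=> 0) ?Rintegral_cst ?mul0r//;
    apply/funext => x; rewrite mul0r.
apply: le_L2dot => //; [exact: L2_lin|exact: L2_0|].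
move=> x Ox; rewrite mul0r.
have [->|px] := eqVneq (phi x) 0; first by rewrite mulr0.
have /andP[ht1 ht2] := phi_supp x px.
have s0 : 0 < sqn x by exact: lt_trans ht1.
have := ler_wpM2l (ltW p20) (Gphi x px).
set t := sqn x in ht1 ht2 s0 *; set f := phi x => h.
rewrite mulrDl -mulrA; apply: (le_trans (lerD h (lexx _))).
rewrite [leLHS](_ : _ = f ^+ 2 * (p2 * (ms + 144 / N ^+ 2) / t +
  (Ls + 1 - potential mu eps x))); last by ring.
rewrite mulr_ge0_le0 ?sqr_ge0//.
have hV : (mu - d / 4) / t <= potential mu eps x.
  rewrite /potential ler_pdivlMr; last exact: potential_den_gt0.
  rewrite mulrAC ler_pdivrMr// -/t.
  have gt : gam * t1 <= gam * t by rewrite ler_wpM2l ?ltW.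
  have et : eps ^+ 2 <= gam * t by exact: le_trans gt.
  apply: (@le_trans _ _ ((mu - d / 4) * (t + gam * t))).
    by apply: ler_wpM2l; [lra|rewrite lerD2l].
  rewrite (_ : _ * _ = (mu - d ^+ 2 / (16 * mu)) * t); last first.
    by rewrite /gam; field; rewrite gt_eqF.
  rewrite ler_wpM2r ?(ltW s0)// gerBl divr_ge0 ?sqr_ge0// mulr_ge0// ltW//.
have hL : Ls + 1 <= (d / 4) / t.
  rewrite ler_pdivlMr//.
  apply: (@le_trans _ _ ((`|Ls| + 1) * t)).
    by rewrite ler_wpM2r ?(ltW s0)// lerD2r ler_norm.
  apply: (@le_trans _ _ ((`|Ls| + 1) * t2)).
    by rewrite ler_wpM2l ?(ltW ht2)// addr_ge0.
  by rewrite ler_pdivlMr//; move: t2L; lra.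
have hp : p2 * (ms + 144 / N ^+ 2) / t <= (mu - d / 2) / t.
  rewrite ler_wpM2r ?invr_ge0 ?(ltW s0)// mulrDr; move: hN; rewrite /d; lra.
have : (mu - d / 4) / t = (mu - d / 2) / t + (d / 4) / t by field; rewrite gt_eqF.
lra.
Qed.

(** * Bottom of the spectrum and approximate ground states *)

Section variational.
Context (R : realType) (n : nat) (Omega : set 'rV[R]_n).
Hypotheses (oO : open Omega) (bO : bounded_set Omega).
Local Notation E := 'rV[R]_n.
Local Notation leb := (@lebesgue_rV R n).
Local Notation L2n v := (L2dot Omega v v).
Local Notation N2 X := (wform Omega (@unitw R n) X X).

Let mO : measurable Omega. Proof. exact: measurable_rV_open. Qed.

Lemma wform_ge0 (a X : 'I_n.+1 -> E -> R) :
  (forall j x, Omega x -> 0 <= a j x) -> 0 <= wform Omega a X X.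
Proof.
move=> a0; apply: sumr_ge0 => j _; apply: Rintegral_ge0 => x Ox.
by rewrite -mulrA -expr2 mulr_ge0 ?sqr_ge0// a0.
Qed.

Lemma wform_expand (a X Y : 'I_n.+1 -> E -> R) (t : R) :
  (forall j, bmf Omega (a j)) -> (forall j, L2 Omega (X j)) ->
  (forall j, L2 Omega (Y j)) ->
  wform Omega a (fun j x => t * Y j x + X j x) (fun j x => t * Y j x + X j x) =
  t ^+ 2 * wform Omega a Y Y + 2 * t * wform Omega a X Y + wform Omega a X X.
Proof.
move=> ba LX LY; have LYX j : L2 Omega (fun x => t * Y j x + X j x) by exact: L2_lin.
rewrite wform_linl//.
rewrite (wformC Omega a Y) (wformC Omega a X) !wform_linl//.
by rewrite (wformC Omega a Y X); ring.
Qed.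

Lemma wform_scale (a X : 'I_n.+1 -> E -> R) (c : R) :
  (forall j, bmf Omega (a j)) -> (forall j, L2 Omega (X j)) ->
  wform Omega a (fun j x => c * X j x) (fun j x => c * X j x) =
  c ^+ 2 * wform Omega a X X.
Proof.
move=> ba LX; rewrite mulr_sumr; apply: eq_bigr => j _.
have LaX : L2 Omega (fun x => a j x * X j x) by exact: L2_bmfM.
rewrite -L2dotZ//; apply: eq_Rintegral => x _; ring.
Qed.

Lemma L2n_expand v D (t : R) : L2 Omega v -> L2 Omega D ->
  L2n (fun x => t * v x + D x) = t ^+ 2 * L2n v + 2 * t * L2dot Omega D v + L2n D.
Proof.
move=> Lv LD; have LZ : L2 Omega (fun x => t * v x + D x) by exact: L2_lin.
rewrite L2dot_lin// (L2dotC _ v) (L2dotC _ D) !L2dot_lin//.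
by rewrite (L2dotC _ v D); ring.
Qed.

Lemma wform_young_norm (a X Y : 'I_n.+1 -> E -> R) (M t : R) : 0 < t ->
  (forall j, bmf Omega (a j)) -> (forall j, L2 Omega (X j)) ->
  (forall j, L2 Omega (Y j)) ->
  (forall j x, Omega x -> `|a j x| <= M) ->
  `|wform Omega a X Y| <= M * (t * N2 X + t^-1 * N2 Y).
Proof.
move=> t0 ba LX LY aM; rewrite ler_norml (wform_young oO)// andbT lerNl.
have -> : - wform Omega a X Y = wform Omega (fun j x => -1 * a j x) X Y.
  rewrite /wform -sumrN; apply: eq_bigr => j _.
  have LaX : L2 Omega (fun x => a j x * X j x) by exact: L2_bmfM.
  by rewrite -[LHS]mulN1r -(L2dotZ oO)//; apply: eq_Rintegral => x _; ring.
apply: wform_young => //.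
- by move=> j; apply: bmfM => //; exact: bmf_cst.
- by move=> j x Ox; rewrite mulN1r normrN; exact: aM.
Qed.

Lemma N2_double (X Y : 'I_n.+1 -> E -> R) : (forall j, L2 Omega (X j)) -> (forall j, L2 Omega (Y j)) ->
  N2 (fun j x => -1 * Y j x + X j x) <= 2 * N2 X + 2 * N2 Y.
Proof.
move=> LX LY; have b1 j : bmf Omega (@unitw R n j) by exact: bmf_cst.
have := @wform_unitw_ge0 R n Omega (fun j x => 1 * Y j x + X j x).
rewrite !wform_expand//; set a := N2 X; set b := N2 Y; lra.
Qed.

Variables (p : E -> R) (p1 p2 mu eps : R).
Hypotheses (bp : bmf Omega p) (p1_gt0 : 0 < p1)
  (pb : forall x, Omega x -> p1 <= p x <= p2) (mu_gt0 : 0 < mu) (eps_gt0 : 0 < eps).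

Local Notation V := (potential mu eps).

(** The energy form raised by the level L; it is nonnegative exactly when - L is
    below the spectrum. *)
Definition qform (L : R) (X Y : 'I_n.+1 -> E -> R) : R :=
  wform Omega (qweight p (fun x => L - V x)) X Y.

Lemma bmf_level L : bmf Omega (fun x => L - V x).
Proof.
rewrite (_ : (fun x => _) = fun x => L + -1 * V x).
  apply: bmfD; first exact: bmf_cst.
  by apply: bmfM; [exact: bmf_cst|exact: bmf_potential].
by apply/funext => x; rewrite mulN1r.
Qed.

Lemma bmf_qlevel L j : bmf Omega (qweight p (fun x => L - V x) j).
Proof. by apply: bmf_qweight => //; exact: bmf_level. Qed.

Lemma qform_shift L L' phi : test_fun Omega phi ->
  qform L' (cjet phi) (cjet phi) =
  qform L (cjet phi) (cjet phi) + (L' - L) * L2n phi.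
Proof.
move=> tp; have Lp := L2_test oO bO tp.
have LVp : L2 Omega (fun x => (L - V x) * phi x).
  by apply: L2_bmfM => //; exact: bmf_level.
rewrite /qform !wform_qweight addrAC; congr (_ + _).
rewrite addrC -L2dot_lin//; apply: eq_Rintegral => x _; ring.
Qed.

(** The bottom of the spectrum lies at - Lam. The levels at which the form is
    nonnegative are bounded below, by Ls because of phi0, and the level
    mu/eps^2 is one of them; Lam is their infimum, and 1/4 below it some test
    function has negative energy. *)
Lemma ground_level Ls phi0 : test_fun Omega phi0 -> 0 < L2n phi0 ->
  qform Ls (cjet phi0) (cjet phi0) <= - L2n phi0 ->
  exists Lam w, [/\ Ls <= Lam,
    forall phi, test_fun Omega phi -> 0 <= qform Lam (cjet phi) (cjet phi),
    test_fun Omega w, L2n w = 1 & qform Lam (cjet w) (cjet w) <= 1 / 4].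
Proof.
move=> tp0 p00 hLs.
pose S := [set L | forall phi, test_fun Omega phi ->
  0 <= qform L (cjet phi) (cjet phi)].
have S0 : S (mu / eps ^+ 2).
  move=> phi tp; apply: wform_ge0 => j x Ox; rewrite /qweight.
  case: unlift => [_|].
    by have /andP[h _] := pb Ox; apply: le_trans h; exact: ltW.
  by rewrite subr_ge0; have /andP[] := potential_bound x mu_gt0 eps_gt0.
have Slb : lbound S Ls.
  move=> L SL; have := SL _ tp0; rewrite (qform_shift Ls L tp0) => h.
  have : 0 <= (L - Ls - 1) * L2n phi0.
    by rewrite mulrBl mul1r; move: hLs h; set q := qform _ _ _; set b := _ * _; lra.
  by rewrite pmulr_lge0//; lra.
have hS : has_inf S by split; [exists (mu / eps ^+ 2)|exists Ls].
pose Lam := inf S.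
have SLam : S Lam.
  move=> phi tp; have N0 : 0 <= L2n phi by exact: L2dot_ge0.
  apply/ler_addgt0Pl => e e0.
  have e1 : 0 < e / (L2n phi + 1) by rewrite divr_gt0// ltr_wpDl.
  have [L SL LLam] := inf_adherent e1 hS.
  have := SL _ tp; rewrite (qform_shift Lam L tp) addrC => /le_trans; apply.
  rewrite lerD2r; apply: (@le_trans _ _ (e / (L2n phi + 1) * L2n phi)).
    by rewrite ler_wpM2r// lerBlDl ltW.
  by rewrite mulrAC ler_pdivrMr ?ltr_wpDl// ler_wpM2l ?lerDl// ltW.
have nS : ~ S (Lam - 1 / 4).
  by move=> /(ge_inf hS.2); rewrite -/Lam; lra.
move: nS => /existsNP[phi /not_implyP[tp /negP]]; rewrite -ltNge => hphi.
have := qform_shift Lam (Lam - 1 / 4) tp => E1.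
have N0 : 0 <= L2n phi by exact: L2dot_ge0.
have N1 : 0 < L2n phi by have := SLam _ tp; move: hphi; rewrite E1; lra.
pose c := (Num.sqrt (L2n phi))^-1.
have c2 : c ^+ 2 = (L2n phi)^-1 by rewrite /c exprVn sqr_sqrtr.
have sp := test_fun_smooth tp.
have cE : cjet (fun x => c * phi x) = fun j x => c * cjet phi j x.
  apply/funext => j; rewrite /cjet /jet; case: unlift => // i.
  exact: partialZ.
have Lp := L2_test oO bO tp.
exists Lam, (fun x => c * phi x); split=> //.
- by apply: lb_le_inf => //; exact: hS.1.
- exact: test_funZ.
- rewrite L2dotZ//; last by apply: L2_bmfM => //; exact: bmf_cst.
  by rewrite L2dotC L2dotZ// mulrA -expr2 c2 mulVf// gt_eqF.
- rewrite cE /qform wform_scale.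
  + rewrite c2 mulrC ler_pdivrMr//.
    by move: hphi; rewrite E1 /qform; lra.
  + by move=> j; exact: bmf_qlevel.
  + by move=> j; exact: L2_cjet.
Qed.

(** An upper bound for all the weights of the form at the level Lam + 1. *)
Definition K2 (Lam : R) : R := `|p2| + `|Lam| + 1.

(** Weights that retain the values and discard the derivatives. *)
Definition omass : 'I_n.+1 -> E -> R := qweight (fun=> 0) (fun=> 1).

Lemma bmf_omass j : bmf Omega (omass j).
Proof. by apply: bmf_qweight; exact: bmf_cst. Qed.

Lemma omassE D D' v w : L2 Omega v -> L2 Omega w ->
  wform Omega omass (jet D v) (jet D' w) = L2dot Omega v w.
Proof.
move=> Lv Lw; rewrite /omass wform_qweight L2dotZ// mul1r big1 ?addr0// => i _.
rewrite /L2dot (_ : (fun x => _) = fun=> 0) ?Rintegral_cst ?mul0r//.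
by apply/funext => x; rewrite !mul0r.
Qed.

(** A substitute for the ground state. The test function w' minimises
    Q(z) + |z - w|^2 up to sigma^2, hence satisfies the Euler equation
    Q(w', v) + (w' - w, v) = 0 up to an error that is small in the H^1 norm of
    v: vary w' by t v with t = sigma and t = - sigma. *)
Lemma near_minimizer Lam w sigma :
  (forall phi, test_fun Omega phi -> 0 <= qform Lam (cjet phi) (cjet phi)) ->
  test_fun Omega w -> qform Lam (cjet w) (cjet w) <= 1 / 4 -> 0 < sigma ->
  exists w', [/\ test_fun Omega w', qform Lam (cjet w') (cjet w') <= 1 / 4,
    L2n (fun x => -1 * w x + w' x) <= 1 / 4 &
    forall v, test_fun Omega v ->
      `|qform Lam (cjet w') (cjet v) + L2dot Omega (fun x => -1 * w x + w' x) v|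
      <= sigma / 2 * (1 + K2 Lam * N2 (cjet v))].
Proof.
move=> Q0 tw Qw s0.
pose F z := qform Lam (cjet z) (cjet z) + L2n (fun x => -1 * w x + z x).
have Lw := L2_test oO bO tw.
have F0 z : test_fun Omega z -> 0 <= F z.
  by move=> tz; rewrite addr_ge0 ?Q0// L2dot_ge0.
pose S := [set F z | z in test_fun Omega].
have hS : has_inf S.
  by split; [exists (F w), w|exists 0 => _ [z tz <-]; exact: F0].
have Fw : F w <= 1 / 4.
  rewrite /F (_ : L2n _ = 0) ?addr0// /L2dot (_ : (fun x => _) = fun=> 0).
    by rewrite Rintegral_cst// mul0r.
  by apply/funext => x; rewrite mulN1r addNr mul0r.
(* A near-minimiser, replaced by w itself if it is worse than w. *)
have [w' [tw' Fw' hw']] : exists w', [/\ test_fun Omega w', F w' <= 1 / 4 &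
    forall z, test_fun Omega z -> F w' <= F z + sigma ^+ 2].
  have s2 : 0 < sigma ^+ 2 by rewrite exprn_gt0.
  have [_ [z tz <-] hz] := inf_adherent s2 hS.
  have hz' y : test_fun Omega y -> F z <= F y + sigma ^+ 2.
    move=> ty; apply: (le_trans (ltW hz)); rewrite lerD2r; apply: (ge_inf hS.2).
    by exists y.
  have [zw|wz] := leP (F z) (F w).
    by exists z; split=> //; exact: le_trans Fw.
  exists w; split=> // y ty; apply: le_trans (hz' y ty); exact: ltW.
have Q0' := Q0 _ tw'.
have D0 : 0 <= L2n (fun x => -1 * w x + w' x) by exact: L2dot_ge0.
exists w'; split=> //.
- by move: Fw'; rewrite /F; lra.
- by move: Fw'; rewrite /F; lra.
move=> v tv; have Lv := L2_test oO bO tv; have Lw' := L2_test oO bO tw'.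
have sv := test_fun_smooth tv; have sw' := test_fun_smooth tw'.
have Ld : L2 Omega (fun x => -1 * w x + w' x) by exact: L2_lin.
set l := _ + L2dot _ _ v.
pose b := qform Lam (cjet v) (cjet v) + L2n v.
have key t : - sigma ^+ 2 <= t ^+ 2 * b + 2 * t * l.
  pose z x := t * v x + w' x.
  have tz : test_fun Omega z by apply: test_funD => //; exact: test_funZ.
  have := hw' _ tz; rewrite /F.
  have -> : cjet z = fun j x => t * cjet v j x + cjet w' j x.
    by apply/funext => j; exact: cjet_lin.
  rewrite {2}/qform wform_expand; first last.
  - by move=> j; exact: L2_cjet.
  - by move=> j; exact: L2_cjet.
  - by move=> j; exact: bmf_qlevel.
  have -> : L2n (fun x => -1 * w x + z x) =
      t ^+ 2 * L2n v + 2 * t * L2dot Omega (fun x => -1 * w x + w' x) v +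
      L2n (fun x => -1 * w x + w' x).
    rewrite -(L2n_expand t Lv Ld); congr L2dot;
      by apply/funext => x; rewrite /z; ring.
  rewrite /b /l /qform; set q1 := wform _ _ _ _; set q2 := wform _ _ _ _.
  set q3 := wform _ _ _ _; lra.
have bN : b <= K2 Lam * N2 (cjet v).
  have -> : b = qform (Lam + 1) (cjet v) (cjet v).
    by rewrite (qform_shift Lam (Lam + 1) tv) /b (addrC Lam 1) addrK mul1r.
  have -> : K2 Lam * N2 (cjet v) = wform Omega (fun j x => K2 Lam) (cjet v) (cjet v).
    rewrite mulr_sumr; apply: eq_bigr => j _.
    have Lj := L2_cjet oO bO j tv.
    rewrite (_ : (fun x => unitw j x * _) = cjet v j) ?L2dotZ//.
    by apply/funext => x; rewrite /unitw mul1r.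
  apply: le_wform => // [j|j|j|j|j x Ox]; [exact: bmf_qlevel|exact: bmf_cst|exact: L2_cjet|exact: L2_cjet|].
  rewrite ler_wpM2r ?sqr_ge0// /qweight /K2; case: unlift => [_|].
    by have /andP[_ h] := pb Ox; have := normr_ge0 Lam; have := ler_norm p2; lra.
  have /andP[h _] := potential_bound x mu_gt0 eps_gt0.
  have := normr_ge0 p2; have := ler_norm Lam; lra.
have h1 := key sigma; have h2 := key (- sigma).
have sig2 : 0 < sigma * 2 by rewrite mulr_gt0.
have hl : `|l| <= sigma / 2 * (1 + b).
  rewrite ler_norml; apply/andP; split; rewrite -(ler_pM2l sig2).
    have -> : sigma * 2 * - (sigma / 2 * (1 + b)) = - (sigma ^+ 2 + sigma ^+ 2 * b).
      by field.
    by lra.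
  have -> : sigma * 2 * (sigma / 2 * (1 + b)) = sigma ^+ 2 + sigma ^+ 2 * b.
    by field.
  move: h2; rewrite sqrrN; lra.
have hs2 : 0 <= sigma / 2 by rewrite divr_ge0// ltW.
by apply: (le_trans hl); rewrite ler_wpM2l// lerD2l.
Qed.

Lemma H10_approx u e : H10 Omega u -> 0 < e -> exists2 phi, test_fun Omega phi &
  N2 (wjet Omega (fun x => -1 * phi x + u x)) < e.
Proof.
move=> [hu happ] e0; have [phi tp hphi] := happ e e0; exists phi => //.
have h1 : H1 Omega (fun x => -1 * phi x + u x).
  by apply: (H1_lin oO bO) => //; exact: H1_test.
rewrite -lte_fin -(gradnorm2E oO h1).
rewrite (_ : (fun x => _) = u - phi)//.
by apply/funext => x; rewrite mulN1r addrC.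
Qed.

(** The approximate Euler equation extends from test functions to H^1_0 by
    density; the approximation error is absorbed by doubling sigma. *)
Lemma euler_H10 Lam sigma w' d u : test_fun Omega w' -> test_fun Omega d ->
  0 < sigma ->
  (forall v, test_fun Omega v ->
     `|qform Lam (cjet w') (cjet v) + L2dot Omega d v|
      <= sigma / 2 * (1 + K2 Lam * N2 (cjet v))) ->
  H10 Omega u ->
  `|qform Lam (cjet w') (wjet Omega u) + L2dot Omega d u|
    <= sigma * (1 + K2 Lam * N2 (wjet Omega u)).
Proof.
move=> tw' td s0 hv Hu; have hu := Hu.1.
have K20 : 0 < K2 Lam by rewrite ltr_wpDl// addr_ge0.
have [M [M0 hM]] : exists M, 0 <= M /\ forall j x, Omega x ->
    `|qweight p (fun x => Lam - V x) j x| <= M.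
  have [_ [Mp hMp]] := bp; have [_ [Mc hMc]] := bmf_level Lam.
  exists (`|Mp| + `|Mc|); split; first by rewrite addr_ge0.
  move=> j x Ox; rewrite /qweight; case: unlift => [_|].
    by apply: le_trans (hMp x Ox) _; apply: le_trans (ler_norm _) _; rewrite lerDl.
  by apply: le_trans (hMc x Ox) _; apply: le_trans (ler_norm _) _; rewrite lerDr.
set X := wjet Omega u.
pose A := M * N2 (cjet w') + N2 (cjet d).
have A0 : 0 <= A by rewrite addr_ge0 ?mulr_ge0// wform_unitw_ge0.
(* The parameter of Young's inequality makes the fixed jets of w' and d cost
   sigma/4; then the distance e to u is chosen small in terms of it. *)
pose t := sigma / (4 * (A + 1)).
have t0 : 0 < t by rewrite divr_gt0// mulr_gt0// ltr_wpDl.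
have tA : t * A <= sigma / 4.
  rewrite /t mulrAC ler_pdivrMr ?mulr_gt0 ?ltr_wpDl//.
  have -> : sigma / 4 * (4 * (A + 1)) = sigma * A + sigma by field.
  by rewrite lerDl ltW.
pose e := Num.min (8 * K2 Lam)^-1 (sigma * t / (8 * (M + 1))).
have e0 : 0 < e.
  have M1 : 0 < M + 1 by rewrite ltr_wpDl.
  by rewrite lt_min invr_gt0 mulr_gt0//= divr_gt0// mulr_gt0.
have [phi tp hphi] := H10_approx Hu e0.
set Z := wjet Omega _ in hphi.
have hp := H1_test oO bO tp.
pose z x := -1 * phi x + u x.
have hz : H1 Omega z by exact: (H1_lin oO bO).
have LZ j : L2 Omega (Z j) by exact: L2_wjet.
have LX j : L2 Omega (X j) by exact: L2_wjet.
have LY j : L2 Omega (cjet phi j) by exact: L2_cjet.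
have LW j : L2 Omega (cjet w' j) by exact: L2_cjet.
have LD j : L2 Omega (cjet d j) by exact: L2_cjet.
have NZ : 0 <= N2 Z by exact: wform_unitw_ge0.
have NX : 0 <= N2 X by exact: wform_unitw_ge0.
have aeXZ j : {ae leb, forall x, Omega x -> X j x = 1 * Z j x + cjet phi j x}.
  have h1 := wjet_lin oO bO (-1) j hp hu.
  have h2 := wjet_test oO bO j tp.
  apply: filterS2 h1 h2 => x k1 k2 Ox.
  by rewrite /Z k1// k2// /X; ring.
have LZY j : L2 Omega (fun x => 1 * Z j x + cjet phi j x) by exact: L2_lin.
have bq j := bmf_qlevel Lam j.
have EQ : qform Lam (cjet w') X = qform Lam (cjet w') Z + qform Lam (cjet w') (cjet phi).
  rewrite /qform (wformC Omega _ _ X) (wform_ael oO (X := fun j x => 1 * Z j x + cjet phi j x))//.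
  by rewrite wform_linl// mul1r !(wformC Omega _ _ (cjet w')).
have Ld := L2_test oO bO td; have Lp := L2_test oO bO tp.
have ED : L2dot Omega d u = L2dot Omega d z + L2dot Omega d phi.
  rewrite (L2dotC Omega d z) (L2dotC Omega d phi) -[L2dot Omega z d]mul1r.
  rewrite -(L2dot_lin oO)//; last by case: hz.
  by rewrite L2dotC; apply: eq_Rintegral => x _; rewrite /z; ring.
have hZ : `|qform Lam (cjet w') Z| <= M * (t * N2 (cjet w') + t^-1 * N2 Z).
  exact: wform_young_norm.
have hz1 : `|L2dot Omega d z| <= 1 * (t * N2 (cjet d) + t^-1 * N2 Z).
  have Lz : L2 Omega z by case: hz.
  rewrite -(omassE (@partial R n) (weak_partial Omega) Ld Lz).
  apply: wform_young_norm => //; first by move=> j; exact: bmf_omass.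
  by move=> j x _; rewrite /omass /qweight; case: unlift; rewrite ?normr0 ?normr1.
have NY : N2 (cjet phi) <= 2 * N2 X + 2 * N2 Z.
  have <- : N2 (fun j x => -1 * Z j x + X j x) = N2 (cjet phi).
    have b1 j : bmf Omega (@unitw R n j) by exact: bmf_cst.
    have LXZ j : L2 Omega (fun x => -1 * Z j x + X j x) by exact: L2_lin.
    have ae2 j : {ae leb, forall x, Omega x -> -1 * Z j x + X j x = cjet phi j x}.
      by apply: filterS (aeXZ j) => x k Ox; rewrite k//; ring.
    rewrite (wform_ael oO b1 LY LXZ LXZ ae2) (wformC Omega) (wform_ael oO b1 LY LY LXZ ae2)//.
  exact: N2_double.
have hphi1 : N2 Z <= (8 * K2 Lam)^-1.
  by apply: (le_trans (ltW hphi)); rewrite /e ge_min lexx.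
have hphi2 : (M + 1) * (t^-1 * N2 Z) <= sigma / 8.
  rewrite mulrCA mulrC ler_pdivrMr//.
  have : N2 Z <= sigma * t / (8 * (M + 1)).
    by apply: (le_trans (ltW hphi)); rewrite /e ge_min lexx orbT.
  rewrite ler_pdivlMr ?mulr_gt0 ?ltr_wpDl// => h; lra.
have KZ : K2 Lam * N2 Z <= 1 / 8.
  move: hphi1; rewrite invfM -(ler_pM2l K20) mulrCA divff ?gt_eqF// mulr1.
  by move=> h; apply: le_trans h _; lra.
have hphi3 := hv _ tp.
rewrite EQ ED.
set q1 := qform _ _ Z in hZ *; set q2 := qform _ _ _ in hphi3 *.
set d1 := L2dot _ d z in hz1 *; set d2 := L2dot _ d phi in hphi3 *.
have -> : q1 + q2 + (d1 + d2) = (q2 + d2) + (q1 + d1) by ring.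
apply: (le_trans (ler_normD _ _)); apply: (le_trans (lerD hphi3 (ler_normD _ _))).
have KY : K2 Lam * N2 (cjet phi) <= K2 Lam * (2 * N2 X + 2 * N2 Z).
  by rewrite ler_wpM2l// ltW.
have KY2 : sigma / 2 * (1 + K2 Lam * N2 (cjet phi)) <=
    sigma / 2 * (1 + K2 Lam * (2 * N2 X + 2 * N2 Z)).
  by rewrite ler_wpM2l ?lerD2l// divr_ge0// ltW.
have KZ2 : sigma * (K2 Lam * N2 Z) <= sigma * (1 / 8) by rewrite ler_wpM2l// ltW.
move: hZ hz1 tA hphi2 KY2 KZ2; rewrite /A.
set n1 := N2 (cjet w'); set n2 := N2 (cjet d); set n3 := N2 Z; set n4 := N2 X.
set n5 := N2 (cjet phi).
nra.
Qed.

End variational.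

(** * Localisation away from the singularity *)

Lemma sin_le_id (R : realType) (x : R) : 0 <= x -> sin x <= x.
Proof.
rewrite le_eqVlt => /predU1P[<-|x0]; first by rewrite sin0.
have [c _] := @MVT R sin cos 0 x x0 (fun y _ => is_derive_sin y)
  (continuous_subspaceT (@continuous_sin R)).
by rewrite sin0 !subr0 => ->; rewrite ler_piMl ?cos_le1// ltW.
Qed.

(** A smooth partition of unity in squares, sin^2 G + cos^2 G = 1, whose second
    member is supported near 0 and whose first member vanishes at 0. *)
Lemma square_partition (R : realType) (n : nat) (U : set 'rV[R]_n) :
  open U -> U 0 -> exists (G : 'rV[R]_n -> R) (M C : R),
  [/\ smooth G, test_fun U (fun x => cos (G x)), 0 <= M /\ 0 <= C,
      forall i x, `|partial i G x| <= M &
      forall x, sin (G x) ^+ 2 <= C * sqn x].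
Proof.
move=> oU U0.
have /nbhs_ballP[r /= r0 rU] : nbhs (0 : 'rV[R]_n) U by exact: open_nbhs_nbhs.
pose q := (r / 2) ^+ 2; have q0 : 0 < q by rewrite exprn_gt0// divr_gt0.
have qr : q < r ^+ 2.
  by rewrite ltr_pXn2r ?nnegrE ?divr_ge0 ?ltW// ltr_pdivrMr// ltr_pMr// ltr1n.
pose eta (x : 'rV[R]_n) : R := flat 1 (1 - q^-1 * sqn x).
have seta : smooth eta.
  apply: smooth_comp; first exact: smooth1_flat.
  apply: smoothD; first exact: smooth_cst.
  under eq_fun do rewrite -mulNr.
  by apply: smoothM; [exact: smooth_cst|exact: smooth_sqn].
have eta_supp x : eta x != 0 -> sqn x <= q.
  apply: contra_neqT; rewrite -ltNge => qx; apply: flat_neg.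
  by rewrite subr_le0 mulrC ler_pdivlMr// mul1r ltW.
pose K := [set x : 'rV[R]_n | sqn x <= q].
have Kr x : K x -> `|x| < r.
  by move=> h; apply: norm_le_sqn => //; exact: le_lt_trans h qr.
have cK : compact K.
  apply: bounded_closed_compact.
    exists r; split; first exact: num_real.
    by move=> m rm x /Kr xr; apply: ltW; exact: lt_trans rm.
  rewrite (_ : K = @sqn R n @^-1` [set t | t <= q])//.
  apply: closed_comp; last exact: closed_le.
  by move=> x _; apply: smooth_continuous; exact: smooth_sqn.
have KU : K `<=` U.
  by move=> x /Kr xr; apply: rU; rewrite -ball_normE/= sub0r normrN.
have teta : test_fun U eta by exact: (test_fun_sub seta cK KU).
have /choice[M_ hM] : forall i : 'I_n, exists m : R, forall x, `|partial i eta x| <= m.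
  by move=> i; have [m _ hm] := test_fun_bounded (test_fun_partial i teta); exists m.
(* Normalised so that G 0 = 0: there the bump eta takes the value e^-1. *)
pose c := - (pi / 2 * expR 1) : R.
pose G x := pi / 2 + c * eta x.
have sG : smooth G.
  apply: smoothD; first exact: smooth_cst.
  by apply: smoothM => //; exact: smooth_cst.
have M_ge0 i : 0 <= M_ i by exact: le_trans (hM i 0).
exists G, (`|c| * \sum_i M_ i), (pi / q); split=> //.
- apply: (test_fun_sub _ cK KU).
    by apply: smooth_comp => //; exact: smooth1_cos.
  move=> x hx; apply: eta_supp; apply: contra_neq hx => e0.
  by rewrite /G e0 mulr0 addr0 cos_pihalf.
- by rewrite mulr_ge0 ?sumr_ge0// divr_ge0 ?pi_ge0// ltW.
- move=> i x.
  have -> : partial i G x = c * partial i eta x.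
    rewrite (partialD i (@smooth_cst R n (pi / 2)) (g := fun x => c * eta x)); last first.
      by apply: smoothM => //; exact: smooth_cst.
    rewrite (partialZ c i seta) [X in X + _](_ : _ = 0) ?add0r//.
    exact: derive_cst.
  rewrite normrM ler_wpM2l//; apply: (le_trans (hM i x)).
  by rewrite (bigD1 i)//= lerDl sumr_ge0.
- move=> x; pose s := q^-1 * sqn x.
  have s0 : 0 <= s by rewrite mulr_ge0 ?sqn_ge0// invr_ge0 ltW.
  have GE : G x = pi / 2 * (1 - expR 1 * flat 1 (1 - s)).
    by rewrite /G /c /eta -/s; ring.
  have e1 : expR 1 * flat 1 (1 - s) <= 1.
    have [s1|s1] := ltP s 1; last by rewrite flat_neg ?mulr0// subr_le0.
    rewrite flat1E ?subr_gt0// -expRD expR_le1 subr_le0.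
    by rewrite invf_ge1 ?subr_gt0// gerBl.
  have e2 : 1 - expR 1 * flat 1 (1 - s) <= 2 * s.
    have [s1|s1] := ltP s (1 / 2); last first.
      rewrite lerBlDr; have : 0 <= expR 1 * flat 1 (1 - s) by rewrite mulr_ge0 ?expR_ge0 ?flat1_ge0.
      lra.
    have t0 : 0 < 1 - s by lra.
    rewrite flat1E// -expRD.
    have := @expR_ge1Dx R (1 - (1 - s)^-1).
    have : (1 - s)^-1 <= 1 + 2 * s.
      rewrite -[X in X <= _]mul1r ler_pdivrMr//; nra.
    lra.
  have pi0 : 0 <= pi / 2 :> R by rewrite divr_ge0// pi_ge0.
  have G0 : 0 <= G x by rewrite GE mulr_ge0// subr_ge0.
  have G1 : G x <= pi / q * sqn x.
    rewrite GE; apply: (@le_trans _ _ (pi / 2 * (2 * s))).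
      by rewrite ler_wpM2l.
    by rewrite /s le_eqVlt; apply/orP; left; apply/eqP; field; rewrite gt_eqF.
  have Gpi : G x <= pi.
    rewrite GE; apply: (@le_trans _ _ (pi / 2 * 1)).
      rewrite ler_wpM2l// gerBl mulr_ge0 ?expR_ge0 ?flat1_ge0//.
    by have := @pi_ge0 R; lra.
  have h0 : 0 <= sin (G x) by apply: sin_ge0_pi; rewrite G0.
  apply: (@le_trans _ _ (sin (G x))).
    by rewrite expr2 ler_piMr// sin_le1.
  exact: le_trans (sin_le_id G0) G1.
Qed.

Section localisation.
Context (R : realType) (n : nat) (Omega : set 'rV[R]_n).
Hypotheses (oO : open Omega) (bO : bounded_set Omega).
Local Notation E := 'rV[R]_n.
Local Notation leb := (@lebesgue_rV R n).
Local Notation L2n v := (L2dot Omega v v).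

Let mO : measurable Omega. Proof. exact: measurable_rV_open. Qed.

(** The jets of sin G w and cos G w satisfy this Pythagorean identity with the
    jet of w and the cross term w grad G. *)
Lemma wform_split (a X Y W U : 'I_n.+1 -> E -> R) :
  (forall j, bmf Omega (a j)) -> (forall j, L2 Omega (X j)) ->
  (forall j, L2 Omega (Y j)) -> (forall j, L2 Omega (W j)) ->
  (forall j, L2 Omega (U j)) ->
  (forall j x, X j x ^+ 2 + Y j x ^+ 2 = W j x ^+ 2 + U j x ^+ 2) ->
  wform Omega a X X + wform Omega a Y Y = wform Omega a W W + wform Omega a U U.
Proof.
move=> ba LX LY LW LU h; rewrite -!big_split/=; apply: eq_bigr => j _.
have i1 := L2_mul_integrable oO (L2_bmfM oO (ba j) (LX j)) (LX j).
have i2 := L2_mul_integrable oO (L2_bmfM oO (ba j) (LY j)) (LY j).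
have i3 := L2_mul_integrable oO (L2_bmfM oO (ba j) (LW j)) (LW j).
have i4 := L2_mul_integrable oO (L2_bmfM oO (ba j) (LU j)) (LU j).
rewrite /L2dot -!RintegralD//; apply: eq_Rintegral => x _.
by rewrite -!mulrA -!expr2 -!mulrDr h.
Qed.

Definition dirichlet (v : E -> R) : R :=
  \sum_i L2dot Omega (partial i v) (partial i v).

Variables (p : E -> R) (p1 p2 mu : R).
Hypotheses (bp : bmf Omega p) (p1_gt0 : 0 < p1)
  (pb : forall x, Omega x -> p1 <= p x <= p2) (mu_gt0 : 0 < mu) (p20 : 0 <= p2).

(** Away from 0 the low-lying functions have bounded gradients, uniformly in
    eps and Lam. By the localisation formula
    Q(sin G w) + Q(cos G w) = Q(w) + int p |grad G|^2 w^2 and Q(cos G w) >= 0,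
    the part sin G w has bounded energy; the potential times
    sin^2 G is bounded, since sin^2 G <= C |x|^2, so the Dirichlet integral of
    this part is bounded.
    The remainder of w after multiplication by th = cos^2 G is sin G times
    this part. *)
Lemma localisation (U : set E) : open U -> U 0 -> U `<=` Omega ->
  exists th K, [/\ test_fun U th, 0 < K & forall eps Lam w, 0 < eps -> 0 <= Lam ->
    (forall phi, test_fun Omega phi ->
       0 <= qform Omega p mu eps Lam (cjet phi) (cjet phi)) ->
    test_fun Omega w -> qform Omega p mu eps Lam (cjet w) (cjet w) <= 1 / 4 ->
    L2n w <= 5 / 2 ->
    test_fun Omega (fun x => -1 * (th x * w x) + w x) /\
    dirichlet (fun x => -1 * (th x * w x) + w x) <= K].
Proof.
move=> oU U0 UO.
have [G [M [C [sG tcG [M0 C0] dG sinG]]]] := square_partition oU U0.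
have scos : smooth (fun x => cos (G x)) by apply: smooth_comp => //; exact: smooth1_cos.
have ssin : smooth (fun x => sin (G x)) by apply: smooth_comp => //; exact: smooth1_sin.
have dcos i : partial i (fun x => cos (G x)) = fun x => - sin (G x) * partial i G x.
  rewrite (partial_comp i (@smooth1_cos R) sG); apply/funext => x.
  by rewrite derive1E derive_val.
have dsin i : partial i (fun x => sin (G x)) = fun x => cos (G x) * partial i G x.
  rewrite (partial_comp i (@smooth1_sin R) sG); apply/funext => x.
  by rewrite derive1E derive_val.
pose th x := cos (G x) * cos (G x).
have tth : test_fun U th by exact: test_funMl.
pose K0 := (1 / 4 + (n.+1%:R * (p2 * M ^+ 2) + mu * C) * (5 / 2)) / p1.
have n0 : 0 <= n.+1%:R :> R by exact: ler0n.
have K00 : 0 < K0.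
  rewrite divr_gt0// ltr_wpDr// !mulr_ge0// addr_ge0 ?mulr_ge0 ?sqr_ge0// ltW//.
exists th, (2 * K0 + 2 * (n%:R * M ^+ 2 * (5 / 2))); split=> //.
  apply: ltr_wpDr; last by rewrite mulr_gt0.
  by rewrite mulr_ge0// mulr_ge0// mulr_ge0 ?sqr_ge0.
move=> eps Lam w e0 L0 Q0 tw Qw w5.
have sw := test_fun_smooth tw; have Lw := L2_test oO bO tw.
pose X x := sin (G x) * w x; pose Y x := cos (G x) * w x.
have tX : test_fun Omega X by exact: test_funMl.
have tY : test_fun Omega Y by exact: test_funMl.
have sX := test_fun_smooth tX.
have vE : (fun x => -1 * (th x * w x) + w x) = fun x => sin (G x) * X x.
  apply/funext => x; rewrite /th /X.
  have := cos2Dsin2 (G x); rewrite !expr2 => h.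
  rewrite [in RHS]mulrA (_ : sin (G x) * sin (G x) = 1 - cos (G x) * cos (G x)); first by ring.
  by rewrite -h; ring.
rewrite vE; have tv : test_fun Omega (fun x => sin (G x) * X x) by exact: test_funMl.
split=> //.
have dX i : partial i X = fun x => sin (G x) * partial i w x + w x * (cos (G x) * partial i G x).
  by rewrite /X partialM// dsin.
have dY i : partial i Y = fun x => cos (G x) * partial i w x + w x * (- sin (G x) * partial i G x).
  by rewrite /Y partialM// dcos.
pose W : 'I_n.+1 -> E -> R := fun j x => if unlift ord0 j is Some i then partial i G x * w x else 0 * w x.
have bG i : bmf Omega (partial i G).
  split; first by apply: smooth_measurable; exact: smooth_partial.
  by exists M => x _; exact: dG.
have LW j : L2 Omega (W j).
  rewrite /W; case: unlift => [i|]; first exact: L2_bmfM.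
  by apply: L2_bmfM => //; exact: bmf_cst.
have bq j := bmf_qlevel bp mu_gt0 e0 Lam j.
have LcX j := L2_cjet oO bO j tX; have LcY j := L2_cjet oO bO j tY.
have Lcw j := L2_cjet oO bO j tw.
have split_eq := wform_split bq LcX LcY Lcw LW _.
have {}split_eq : qform Omega p mu eps Lam (cjet X) (cjet X) +
    qform Omega p mu eps Lam (cjet Y) (cjet Y) =
    qform Omega p mu eps Lam (cjet w) (cjet w) +
    qform Omega p mu eps Lam W W.
  apply: split_eq => j x; rewrite /cjet /jet /W; have := cos2Dsin2 (G x).
  case: unlift => [i|] h.
    rewrite dX dY -[partial i w x ^+ 2]mul1r -[(_ * w x) ^+ 2]mul1r -h; ring.
  by rewrite /X /Y -[w x ^+ 2]mul1r -h; ring.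
have b_cst c (j : 'I_n.+1) : bmf Omega ((fun (_ : 'I_n.+1) (_ : E) => c) j).
  exact: bmf_cst.
have cstE c : wform Omega (fun _ _ => c) (fun _ => w) (fun _ => w) = n.+1%:R * (c * L2n w).
  rewrite /wform L2dotZ// sumr_const card_ord -[LHS]mulr_natl //.
have hW : qform Omega p mu eps Lam W W <= n.+1%:R * ((p2 * M ^+ 2) * L2n w).
  rewrite -cstE; apply: le_wform => //; first by move=> j; exact: bmf_cst.
  move=> j x Ox; rewrite /qweight /W.
  case: unlift => [i|]; last first.
    by rewrite mul0r expr0n/= mulr0 mulr_ge0 ?sqr_ge0// mulr_ge0// sqr_ge0.
  have /andP[h1 h2] := pb Ox.
  rewrite exprMn mulrA ler_wpM2r ?sqr_ge0//.
  apply: ler_pM => //; [by apply: le_trans h1; exact: ltW|exact: sqr_ge0|].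
  by rewrite -(real_normK (num_real (partial i G x))) lerXn2r ?nnegrE.
have QX : qform Omega p mu eps Lam (cjet X) (cjet X) <=
    1 / 4 + n.+1%:R * (p2 * M ^+ 2) * (5 / 2).
  have h := Q0 _ tY.
  have h2 : n.+1%:R * (p2 * M ^+ 2 * L2n w) <= n.+1%:R * (p2 * M ^+ 2) * (5 / 2).
    by rewrite mulrA ler_wpM2l// mulr_ge0// mulr_ge0// sqr_ge0.
  move: split_eq Qw hW h h2.
  set a := qform _ _ _ _ _ _ _; set b := qform _ _ _ _ _ _ _.
  set c := qform _ _ _ _ _ _ _; set d := qform _ _ _ _ _ _ _; lra.
have LX := L2_test oO bO tX.
have LdX i : L2 Omega (partial i X) by apply: L2_test => //; exact: test_fun_partial.
have DX : p1 * dirichlet X <= qform Omega p mu eps Lam (cjet X) (cjet X) + mu * C * L2n w.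
  rewrite /qform wform_qweight addrAC.
  have h1 : 0 <= L2dot Omega (fun x => (Lam - potential mu eps x) * X x) X + mu * C * L2n w.
    have Lc : L2 Omega (fun x => (Lam - potential mu eps x) * X x).
      by apply: L2_bmfM => //; exact: bmf_level.
    have Lcw' : L2 Omega (fun x => - (mu * C) * w x).
      by apply: L2_bmfM => //; exact: bmf_cst.
    rewrite -[X in _ + X]opprK subr_ge0 -mulNr -L2dotZ//.
    apply: le_L2dot => // x Ox.
    have V0 := potential_den_gt0 x e0.
    rewrite /X; have hs := sinG x; set sn := sin (G x) in hs *.
    have hV : potential mu eps x * sn ^+ 2 <= mu * C.
      rewrite /potential mulrAC ler_pdivrMr// -mulrA ler_wpM2l ?(ltW mu_gt0)//.
      apply: (le_trans hs); rewrite ler_wpM2l// lerDl sqr_ge0//.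
    have hw := sqr_ge0 (w x); have hs0 := sqr_ge0 sn.
    have := ler_wpM2r hw hV; have := mulr_ge0 L0 (mulr_ge0 hs0 hw).
    nra.
  apply: (@le_trans _ _ (\sum_i L2dot Omega (fun x => p x * partial i X x) (partial i X))).
    rewrite mulr_sumr; apply: ler_sum => i _; rewrite -L2dotZ//.
    apply: le_L2dot => //; try exact: L2_bmfM.
      by apply: L2_bmfM => //; exact: bmf_cst.
    move=> x Ox; have /andP[h _] := pb Ox.
    by rewrite -!mulrA -!expr2 ler_wpM2r ?sqr_ge0.
  by rewrite lerDr.
have DX2 : dirichlet X <= K0.
  rewrite /K0 ler_pdivlMr// mulrC; apply: (le_trans DX).
  have h : mu * C * L2n w <= mu * C * (5 / 2).
    by rewrite ler_wpM2l// mulr_ge0// ltW.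
  rewrite mulrDl addrA; exact: lerD QX h.
have hi i : L2n (partial i (fun x => sin (G x) * X x)) <=
    2 * L2n (partial i X) + 2 * (M ^+ 2 * L2n w).
  have Ldv : L2 Omega (partial i (fun x => sin (G x) * X x)).
    by apply: L2_test => //; exact: test_fun_partial.
  have L2X := L2_bmfM oO (bmf_cst Omega 2) (LdX i).
  have L2w := L2_bmfM oO (bmf_cst Omega (2 * M ^+ 2)) Lw.
  have E1 := L2dotZ oO 2 (LdX i) (LdX i).
  have E2 := L2dotZ oO (2 * M ^+ 2) Lw Lw.
  rewrite mulrA -E1 -E2 /L2dot.
  have ii1 := L2_mul_integrable oO L2X (LdX i).
  have ii2 := L2_mul_integrable oO L2w Lw.
  rewrite -(RintegralD mO ii1 ii2).
  apply: (le_Rintegral mO (L2_mul_integrable oO Ldv Ldv) (integrableD mO ii1 ii2)).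
  move=> x Ox; rewrite partialM// dsin /X.
  set a := partial i _ x; set c := cos _; set s := sin _; set g := partial i G x.
  have cs : c * c + s * s = 1 by rewrite -!expr2 cos2Dsin2.
  have hg : g * g <= M ^+ 2.
    by rewrite -expr2 -(real_normK (num_real g)) lerXn2r ?nnegrE//; exact: dG.
  have aa := sqr_ge0 a; have ww := sqr_ge0 (w x).
  have step : (s * a + s * w x * (c * g)) * (s * a + s * w x * (c * g)) <=
      2 * (s * s) * (a * a) + 2 * ((s * s) * (c * c)) * (g * g) * (w x * w x).
    by have := sqr_ge0 (s * a - s * w x * (c * g)); nra.
  apply: (le_trans step).
  have s1 : 0 <= 1 - s * s by rewrite -cs addrK -expr2 sqr_ge0.
  have c1 : 0 <= 1 - c * c by rewrite -cs addrC addKr -expr2 sqr_ge0.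
  have ss : 0 <= s * s by rewrite -expr2 sqr_ge0.
  have gg : 0 <= g * g by rewrite -expr2 sqr_ge0.
  have sc : 0 <= 1 - (s * s) * (c * c) by have := mulr_ge0 ss c1; lra.
  have h1 := mulr_ge0 aa s1.
  have h2 : 0 <= M ^+ 2 - (s * s) * (c * c) * (g * g).
    by have := mulr_ge0 sc gg; move: hg; lra.
  have h3 := mulr_ge0 h2 ww.
  by move: h1 h3; rewrite !expr2; lra.
rewrite /dirichlet; apply: (@le_trans _ _
  (\sum_i (2 * L2n (partial i X) + 2 * (M ^+ 2 * L2n w)))).
  by apply: ler_sum => i _; exact: hi.
rewrite big_split/= -mulr_sumr sumr_const card_ord -[_ *+ n]mulr_natl.
apply: lerD; first by rewrite ler_wpM2l.
rewrite mulrCA ler_wpM2l// mulrA ler_wpM2l// mulr_ge0// sqr_ge0//.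
Qed.

End localisation.

(** * Lower integrals *)

Section lower_integral.
Context d (T : measurableType d) (R : realType).
Variable m : {measure set T -> \bar R}.
Implicit Types (D : set T) (f g : T -> \bar R).
Local Open Scope ereal_scope.

Import HBNNSimple.

(** The integral of a nonnegative function that need not be measurable is its
    lower integral: it is monotone, and additive as soon as one of the two
    functions is measurable. *)
Lemma le_lower_integral D f g : (forall x, D x -> 0 <= f x) ->
  (forall x, D x -> f x <= g x) ->
  \int[m]_(x in D) f x <= \int[m]_(x in D) g x.
Proof.
move=> f0 fg; have g0 x : D x -> 0 <= g x.
  by move=> Dx; exact: le_trans (f0 x Dx) (fg x Dx).
rewrite !ge0_integralE//; apply: ge_ereal_sup => _ [h hf <-].
apply: ereal_sup_ubound; exists h => // x; apply: le_trans (hf x) _.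
by rewrite !patchE; case: ifPn => //; rewrite inE => Dx; exact: fg.
Qed.

Lemma sintegral_restr_integral D f (h : {nnsfun T >-> R}) :
  (forall x, (h x)%:E <= (f \_ D) x) ->
  sintegral m h = \int[m]_(x in D) (h x)%:E.
Proof.
move=> hf; rewrite -integralT_nnsfun [RHS]integral_mkcond.
apply: eq_integral => x _; rewrite patchE; case: ifPn => // xD.
have := hf x; rewrite patchE (negbTE xD) => hx.
apply/eqP; rewrite eq_le hx /=.
by change (0%:E <= (h x)%:E); rewrite lee_fin.
Qed.

Lemma lower_integralD_le D f g : measurable D -> (forall x, D x -> 0 <= f x) ->
  (forall x, D x -> 0 <= g x) -> measurable_fun D g ->
  \int[m]_(x in D) (f x + g x) <= \int[m]_(x in D) f x + \int[m]_(x in D) g x.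
Proof.
move=> mD f0 g0 mg.
have fg0 x : D x -> 0 <= f x + g x by move=> Dx; rewrite adde_ge0 ?f0 ?g0.
rewrite [leLHS]ge0_integralE//; apply: ge_ereal_sup => _ [h hfg <-].
(* A simple function below f + g is below k + g, where k is measurable and
   below f. *)
pose k x := maxe ((h x)%:E - g x) 0.
have mk : measurable_fun D k.
  apply: measurable_maxe; last exact: measurable_cst.
  apply: emeasurable_funB => //; apply/measurable_EFinP.
  by apply: measurable_funTS; exact: measurable_funP.
have k0 x : D x -> 0 <= k x by move=> _; rewrite /k le_max lexx orbT.
have kf x : D x -> k x <= f x.
  move=> Dx; rewrite /k ge_max f0// andbT.
  have := hfg x; rewrite patchE mem_set// => hx.
  case: (g x) hx (g0 x Dx) => [r| |] hx gr //; first by rewrite leeBlDr.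
  by rewrite [X in X <= _](_ : _ = -oo) ?leNye.
have hk x : D x -> (h x)%:E <= k x + g x.
  move=> Dx; have := k0 x Dx; rewrite /k; case: (g x) (g0 x Dx) => [r| |] // gr _.
    by rewrite -leeBlDr// le_max lexx.
  by rewrite [X in maxe X _](_ : _ = -oo) // maxNye add0e leey.
rewrite (sintegral_restr_integral hfg).
apply: (@le_trans _ _ (\int[m]_(x in D) (k x + g x))).
  by apply: le_lower_integral => // x _; rewrite lee_fin.
rewrite ge0_integralD//; apply: leeD => //.
exact: le_lower_integral.
Qed.

Lemma lower_integralZ_le D f (c : R) : measurable D -> (0 < c)%R ->
  (forall x, D x -> 0 <= f x) ->
  \int[m]_(x in D) (c%:E * f x) <= c%:E * \int[m]_(x in D) f x.
Proof.
move=> mD c0 f0.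
have cf0 x : D x -> 0 <= c%:E * f x by move=> Dx; rewrite mule_ge0 ?f0// lee_fin ltW.
rewrite [leLHS]ge0_integralE//; apply: ge_ereal_sup => _ [h hf <-].
rewrite (sintegral_restr_integral hf).
rewrite -lee_pdivrMl// -ge0_integralZl_EFin//.
- apply: le_lower_integral => // x Dx.
    by apply: mule_ge0; [rewrite lee_fin invr_ge0 ltW|rewrite lee_fin].
  by rewrite lee_pdivrMl//; have := hf x; rewrite patchE mem_set.
- by move=> x _; rewrite lee_fin.
- by apply/measurable_EFinP; apply: measurable_funTS; exact: measurable_funP.
- by rewrite invr_ge0 ltW.
Qed.

(** The integrand h need not be measurable either: its positive and negative
    parts are dominated separately. *)
Lemma Rintegral_lower_bound D (h : T -> R) f g (a b : R) : measurable D ->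
  (forall x, D x -> 0 <= f x) -> (forall x, D x -> 0 <= g x) ->
  measurable_fun D g -> (forall x, D x -> `|h x|%:E <= f x + g x) ->
  \int[m]_(x in D) f x <= a%:E -> \int[m]_(x in D) g x <= b%:E ->
  (`|(\int[m]_(x in D) h x)%R| <= a + b)%R.
Proof.
move=> mD f0 g0 mg hfg fa gb.
have bound k : (forall x, D x -> 0 <= k x) -> (forall x, D x -> k x <= `|h x|%:E) ->
    0 <= \int[m]_(x in D) k x <= (a + b)%:E.
  move=> k0 kh; rewrite integral_ge0//=.
  apply: (@le_trans _ _ (\int[m]_(x in D) (f x + g x))).
    apply: le_lower_integral => // x Dx.
    exact: le_trans (kh x Dx) (hfg x Dx).
  by apply: (le_trans (lower_integralD_le mD f0 g0 mg)); rewrite EFinD leeD.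
rewrite /Rintegral integralE.
have /andP[p0 p1] : 0 <= \int[m]_(x in D) ((EFin \o h)^\+ x) <= (a + b)%:E.
  apply: bound => x Dx; first exact: funepos_ge0.
  by rewrite funeposE ge_max !lee_fin ler_norm/=.
have /andP[n0 n1] : 0 <= \int[m]_(x in D) ((EFin \o h)^\- x) <= (a + b)%:E.
  apply: bound => x Dx; first exact: funeneg_ge0.
  by rewrite funenegE ge_max !lee_fin -normrN ler_norm/=.
move: p0 p1 n0 n1.
have -> : (fine (\int[m]_(x in D) ((fun x => (h x)%:E)^\+ x) -
    \int[m]_(x in D) ((fun x => (h x)%:E)^\- x)) =
  fine (\int[m]_(x in D) ((EFin \o h)^\+ x) -
    \int[m]_(x in D) ((EFin \o h)^\- x)))%R by [].
move: (\int[m]_(x in D) ((EFin \o h)^\+ x)) (\int[m]_(x in D) ((EFin \o h)^\- x)).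
move=> P N.
case: P => [r| |]; case: N => [s| |]//=; rewrite !lee_fin => r0 rab s0 sab.
by rewrite ler_norml; apply/andP; split; lra.
Qed.

End lower_integral.

(** Every preimage is a finite union of the measurable fibres of s, whatever F
    may be. *)
Lemma simple_valued_measurable (R : realType) (V : zmodType) (S : set V)
    (s : R -> V) (F : V -> \bar R) (D : set R) :
  simple_valued S s -> measurable_fun D (F \o s).
Proof.
move=> [fs _ ms]; apply: measurable_funTS => _ Y mY; rewrite setTI.
rewrite (_ : _ @^-1` Y =
    \bigcup_(y in range s `&` F @^-1` Y) (s @^-1` [set y])).
  apply: fin_bigcup_measurable => [|y _]; last exact: ms.
  exact: finite_setIl.
apply/seteqP; split=> t /=; first by move=> h; exists (s t).
by move=> [y [_ hy] /= ->].
Qed.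

(** As before, with the pointwise bound required almost everywhere only: put
    the exceptional set into g, where it costs nothing. *)
Lemma Rintegral_lower_bound_ae d (T : measurableType d) (R : realType)
    (m : {measure set T -> \bar R}) D (h : T -> R) (f g : T -> \bar R) (a b : R) :
  measurable D ->
  (forall x, D x -> 0 <= f x)%E -> (forall x, D x -> 0 <= g x)%E ->
  measurable_fun D g -> {ae m, forall x, D x -> (`|h x|%:E <= f x + g x)%E} ->
  (\int[m]_(x in D) f x <= a%:E)%E -> (\int[m]_(x in D) g x <= b%:E)%E ->
  `|\int[m]_(x in D) h x| <= a + b.
Proof.
move=> mD f0 g0 mg [N [mN N0 hN]] fa gb.
pose k x := if x \in N then +oo%E else g x.
have k0 x : D x -> (0 <= k x)%E.
  by move=> Dx; rewrite /k; case: ifPn => // _; exact: g0.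
have mk : measurable_fun D k.
  apply: measurable_fun_if => //.
  - apply: (measurable_fun_bool true) => //.
    by rewrite preimage_mem_true; exact: measurableI.
  - by apply: measurable_funS mg => //; exact: subIsetl.
apply: (@Rintegral_lower_bound _ _ _ m D h f k) => //.
  move=> x Dx; rewrite /k; case: ifPn => [_|].
    by rewrite addey ?leey// -ltNye (lt_le_trans _ (f0 x Dx))// ltNyr.
  by rewrite notin_setE => nx; apply: contrapT => nh; apply: nx; apply: hN => /(_ Dx).
rewrite (_ : integral _ _ _ = \int[m]_(x in D) g x)%E//.
apply: ge0_ae_eq_integral => //; exists N; split=> // x /= /not_implyP[Dx].
by rewrite /k; case: ifPn => //; rewrite inE.
Qed.

(** * Energy and dual norms *)

Section energy.
Context (R : realType) (n : nat) (Omega : set 'rV[R]_n).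
Hypotheses (oO : open Omega) (bO : bounded_set Omega).
Local Notation E := 'rV[R]_n.
Local Notation leb := (@lebesgue_rV R n).
Local Notation L2n v := (L2dot Omega v v).
Local Notation N2 X := (wform Omega (@unitw R n) X X).

Lemma wform_wjet_test (a X : 'I_n.+1 -> E -> R) phi :
  (forall j, bmf Omega (a j)) -> (forall j, L2 Omega (X j)) ->
  test_fun Omega phi ->
  wform Omega a (wjet Omega phi) X = wform Omega a (cjet phi) X.
Proof.
move=> ba LX tp; apply: wform_ael => // j.
- exact: L2_cjet.
- by apply: L2_wjet; exact: H1_test.
- exact: wjet_test.
Qed.

Lemma gradnorm2_test phi : test_fun Omega phi ->
  gradnorm2 Omega phi = (dirichlet Omega phi)%:E.
Proof.
move=> tp; have hp := H1_test oO bO tp; have Lp := L2_test oO bO tp.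
have b1 j : bmf Omega (@unitw R n j) by exact: bmf_cst.
have := gradnorm2E oO hp.
rewrite wform_wjet_test//; last by move=> j; exact: L2_wjet.
rewrite wformC wform_wjet_test//; last by move=> j; exact: L2_cjet.
rewrite L2norm2E// {1}/wform big_ord_recl /cjet !jet0.
rewrite (_ : (fun x => _ * phi x) = phi); last first.
  by apply/funext => x; rewrite /unitw mul1r.
rewrite (_ : \sum_(i < n) _ = dirichlet Omega phi); last first.
  apply: eq_bigr => i _; rewrite !jetS; congr L2dot.
  by apply/funext => x; rewrite /unitw mul1r.
rewrite EFinD.
case: (gradnorm2 Omega phi) => [r| |] // [] /addrI ->//.
Qed.

Lemma H10norm_test phi : test_fun Omega phi ->
  H10norm Omega phi = (Num.sqrt (dirichlet Omega phi))%:E.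
Proof.
move=> tp; rewrite /H10norm gradnorm2_test// poweR12_sqrt// lee_fin.
by apply: sumr_ge0 => i _; exact: L2dot_ge0.
Qed.

(** Test functions are normalised with their classical gradients: dividing phi
    by the square root of K puts it in the unit ball of H^1_0. *)
Lemma Hm1norm_test (l : (E -> R) -> R) phi K : Hm1 Omega l ->
  test_fun Omega phi -> 0 < K -> dirichlet Omega phi <= K ->
  (`|l phi|%:E <= (Num.sqrt K)%:E * Hm1norm Omega l)%E.
Proof.
move=> [ll _] tp K0 hK; have sp := test_fun_smooth tp.
pose c := (Num.sqrt K)^-1.
have sK : 0 < Num.sqrt K by rewrite sqrtr_gt0.
have c0 : 0 < c by rewrite invr_gt0.
have tcp : test_fun Omega (fun x => (c - 1) * phi x + phi x).
  by apply: test_funD => //; exact: test_funZ.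
have lc : l (fun x => (c - 1) * phi x + phi x) = c * l phi.
  rewrite ll; [ring|exact: H10_test|exact: H10_test].
have -> : `|l phi|%:E = ((Num.sqrt K)%:E * `|c * l phi|%:E)%E.
  by rewrite -EFinM normrM (gtr0_norm c0) mulrA divff ?mul1r// gt_eqF.
rewrite lee_pmul2l// ?lte_fin//; apply: ereal_sup_ubound.
exists (fun x => (c - 1) * phi x + phi x); last by rewrite lc.
split; first exact: H10_test.
rewrite H10norm_test// lee_fin -[leRHS]sqrtr1 ler_wsqrtr//.
rewrite (_ : dirichlet _ _ = c ^+ 2 * dirichlet Omega phi).
  rewrite /c exprVn sqr_sqrtr; last exact: ltW.
  by rewrite mulrC ler_pdivrMr// mul1r.
rewrite mulr_sumr; apply: eq_bigr => i _.
have td := test_fun_partial i tp.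
have Ld := L2_test oO bO td.
have Lcd := L2_test oO bO (test_funZ c td).

have -> : (fun x => (c - 1) * phi x + phi x) = fun x => c * phi x.
  by apply/funext => x; ring.
rewrite partialZ// L2dotZ// L2dotC L2dotZ// mulrA expr2//.
Qed.

(** Weights that retain the derivatives and discard the values *)
Definition gradw : 'I_n.+1 -> E -> R := qweight (fun=> 1) (fun=> 0).

Lemma bmf_gradw j : bmf Omega (gradw j).
Proof. by apply: bmf_qweight; exact: bmf_cst. Qed.

Lemma gradnorm2_wform v : H1 Omega v ->
  gradnorm2 Omega v = (wform Omega gradw (wjet Omega v) (wjet Omega v))%:E.
Proof.
move=> hv; have Lj j := L2_wjet j hv.
rewrite -(wformE oO bmf_gradw Lj Lj); apply: eq_integral => x _; congr EFin.
rewrite enorm_sqn /sqn big_ord_recl /gradw /qweight unlift_none !mul0r add0r.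
apply: eq_bigr => i _; rewrite liftK /wjet jetS mxE mul1r expr2//.
Qed.

(** The energy form of the equation differs from the form at the level Lam by
    the L^2 product only. *)
Lemma energy_formE p mu eps Lam u w : bmf Omega p -> 0 < mu -> 0 < eps ->
  H1 Omega u -> test_fun Omega w ->
  energy_form Omega p mu eps u w =
  qform Omega p mu eps Lam (cjet w) (wjet Omega u) - Lam * L2dot Omega u w.
Proof.
move=> bp mu0 eps0 hu tw; have Lu j := L2_wjet j hu.
have hw := H1_test oO bO tw; have Lw j := L2_wjet j hw.
have bq j := bmf_qlevel bp mu0 eps0 0 j.
transitivity (qform Omega p mu eps 0 (cjet w) (wjet Omega u)).
  rewrite /qform -wform_wjet_test//.
  rewrite -[RHS]/(fine (_%:E)) -(wformE oO bq Lw Lu).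
  rewrite /energy_form /Rintegral; congr fine; apply: eq_integral => x _; congr EFin.
    rewrite big_ord_recl /wjet !jet0 /qweight unlift_none sub0r addrC.
    rewrite /edot mulr_sumr /potential enorm_sqn; congr (_ + _); first ring.
    by apply: eq_bigr => i _; rewrite liftK !jetS !mxE; ring.
have LV L : L2 Omega (fun x => (L - potential mu eps x) * w x).
  by apply: L2_bmfM => //; [exact: bmf_level|exact: L2_test].
rewrite /qform /wjet !wform_qweight addrAC; congr (_ + _).
have Lw0 := L2_test oO bO tw; have Lu0 := hu.1.
rewrite (L2dotC _ u w) -mulNr addrC -L2dot_lin//; apply: eq_Rintegral => x _; ring.
Qed.

End energy.

(** * Measurability in time of the gradient norm *)

Lemma quadratic_discr (R : realType) (A B C : R) : 0 <= A ->
  (forall t, 0 <= t ^+ 2 * A + 2 * t * B + C) -> B ^+ 2 <= A * C.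
Proof.
rewrite le_eqVlt => /predU1P[<-|A0] h.
  have [->|B0] := eqVneq B 0; first by rewrite expr0n mul0r.
  have := h (- (C + 1) / (2 * B)); rewrite mulr0 add0r.
  have -> : 2 * (- (C + 1) / (2 * B)) * B = - (C + 1) by field.
  by rewrite opprD addrAC addNr add0r oppr_ge0 ler10.
have := h (- B / A).
have -> : (- B / A) ^+ 2 * A + 2 * (- B / A) * B + C = (A * C - B ^+ 2) / A.
  by field; rewrite gt_eqF.
by rewrite pmulr_lge0 ?invr_gt0// subr_ge0.
Qed.

Section time.
Context (R : realType) (n : nat) (Omega : set 'rV[R]_n).
Hypotheses (oO : open Omega) (bO : bounded_set Omega).
Local Notation E := 'rV[R]_n.
Local Notation leb := (@lebesgue_rV R n).
Local Notation gform v := (wform Omega (@gradw R n) (wjet Omega v) (wjet Omega v)).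

Let bg j := bmf_gradw Omega j.

Lemma gform_ge0 v : 0 <= gform v.
Proof.
apply: wform_ge0 => j x _; rewrite /gradw /qweight.
by case: unlift.
Qed.

Lemma H10normE v : H1 Omega v -> H10norm Omega v = (Num.sqrt (gform v))%:E.
Proof.
move=> hv; rewrite /H10norm gradnorm2_wform// poweR12_sqrt// lee_fin.
exact: gform_ge0.
Qed.

(** Expand the square of u + (v - u) and use the Cauchy-Schwarz inequality. *)
Lemma gform_dist v u : H1 Omega v -> H1 Omega u ->
  `|gform v - gform u| <= gform (v - u) +
     2 * Num.sqrt (gform (v - u)) * Num.sqrt (gform u).
Proof.
move=> hv hu.
have -> : v - u = fun x => -1 * u x + v x.
  by apply/funext => x; rewrite mulN1r addrC.
have hd := H1_lin oO bO (-1) hu hv.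
set d := (fun x => _) in hd *.
have Ld j := L2_wjet j hd; have Lu j := L2_wjet j hu; have Lv j := L2_wjet j hv.
have Lud j : L2 Omega (fun x => 1 * wjet Omega u j x + wjet Omega d j x).
  exact: L2_lin.
have ae1 j : {ae leb, forall x, Omega x ->
    wjet Omega v j x = 1 * wjet Omega u j x + wjet Omega d j x}.
  apply: filterS (wjet_lin oO bO (-1) j hu hv) => x k Ox.
  by rewrite /d k//; ring.
have Ev : gform v = gform u + 2 * wform Omega (@gradw R n) (wjet Omega d) (wjet Omega u)
    + gform d.
  rewrite (wform_ael oO bg Lud Lv Lv ae1) (wformC Omega).
  rewrite (wform_ael oO bg Lud Lud Lv ae1) (wform_expand oO)//.
  by rewrite expr1n mul1r mulr1.
have CS : wform Omega (@gradw R n) (wjet Omega d) (wjet Omega u) ^+ 2 <=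
    gform u * gform d.
  apply: quadratic_discr; first exact: gform_ge0.
  move=> t; rewrite -(wform_expand oO)//; apply: wform_ge0 => j x _.
  by rewrite /gradw /qweight; case: unlift.
have CS' : `|wform Omega (@gradw R n) (wjet Omega d) (wjet Omega u)| <=
    Num.sqrt (gform d) * Num.sqrt (gform u).
  by rewrite -sqrtr_sqr -sqrtrM ?gform_ge0// ler_wsqrtr// mulrC.
have := gform_ge0 d; move: CS'; rewrite Ev ler_norml => /andP[].
set a := gform d; set b := Num.sqrt _; set c := Num.sqrt _.
set e := wform _ _ _ _ => h1 h2 h3; rewrite ler_norml; apply/andP; split; lra.
Qed.

(** The gradient norm is continuous for the norm of H^1_0, so it is the limit
    of its values on the simple functions that approximate u. *)
Lemma measurable_gradnorm2 T u : L2H10 Omega T u ->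
  measurable_fun [set` `]0, T[] (fun t => gradnorm2 Omega (u t)).
Proof.
move=> [uH [s ss su] _].
apply: (@emeasurable_fun_cvg _ _ _ _ (fun k t => gradnorm2 Omega (s k t))).
  by move=> k; exact: simple_valued_measurable (ss k).
move=> t /= tT; have hu : H1 Omega (u t) by have [] := uH t tT.
have hs k : H1 Omega (s k t).
  by have [_ /(_ (s k t)) h _] := ss k; have [] := h (ex_intro2 _ _ t I erefl).
have hd k : H1 Omega (s k t - u t).
  have -> : s k t - u t = fun x => -1 * u t x + s k t x.
    by apply/funext => x; rewrite mulN1r addrC.
  exact: H1_lin.
have /fine_cvg := su t tT.
rewrite (_ : fine \o _ = fun k => Num.sqrt (gform (s k t - u t))); last first.
  by apply/funext => k /=; rewrite H10normE.
move=> cr.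
rewrite gradnorm2_wform// (_ : (fun k => _) = fun k => (gform (s k t))%:E); last first.
  by apply/funext => k; rewrite gradnorm2_wform.
apply: cvg_EFin; first by near=> k.
pose r k := Num.sqrt (gform (s k t - u t)).
pose c := Num.sqrt (gform (u t)).
have cb : r k ^+ 2 + 2 * r k * c @[k --> \oo] --> (0 : R).
  rewrite (_ : 0 = 0 ^+ 2 + 2 * 0 * c :> R); last by rewrite expr0n mulr0 mul0r addr0.
  apply: cvgD; first by rewrite expr2; apply: cvgM.
  by apply: cvgMl; apply: cvgMr.
have := @squeeze_cvgr _ \oo _ _ (fun k => gform (u t) - (r k ^+ 2 + 2 * r k * c))
  (fun k => gform (u t) + (r k ^+ 2 + 2 * r k * c)) (fun k => gform (s k t)).
apply.
- near=> k; have := gform_dist (hs k) hu.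
  rewrite -(sqr_sqrtr (gform_ge0 (s k t - u t))) -/(r k) -/c.
  rewrite sqrtr_sqr (ger0_norm (sqrtr_ge0 _)) -/(r k) ler_norml => /andP[h1 h2].
  by apply/andP; split; lra.
- rewrite -[X in _ --> X]subr0; apply: cvgB => //; exact: cvg_cst.
- rewrite -[X in _ --> X]addr0; apply: cvgD => //; exact: cvg_cst.
Unshelve. all: by end_near. Qed.

End time.

Lemma smooth1_expR (R : realType) : smooth1 (@expR R).
Proof.
apply: (smooth1_coind (P := fun F => F = expR)) => // _ ->.
by exists expR => // s; exact: is_derive_expR.
Qed.

Lemma smooth1_expR_lin (R : realType) (c : R) : smooth1 (fun t => expR (c * t)).
Proof.
apply: smooth1_gen_smooth1.
apply: (smooth1_gen_comp (F := expR) (G := fun t => c * t)).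
  exact: smooth1_expR.
apply: (smooth1_genM (F := fun=> c) (G := id)).
- exact: smooth1_gen_cst.
- exact: smooth1_gen_id.
Qed.

Lemma is_derive_expR_lin (R : realType) (c t : R) :
  is_derive t (1 : R) (fun t => expR (c * t)) (c * expR (c * t)).
Proof.
have d1 : is_derive t (1 : R) (fun t : R => c * t) c.
  by apply: is_derive_eq; rewrite -[_ *: _]/(_ * _) mulr1.
have d2 := @is_derive1_comp R expR (fun t => c * t) t (expR (c * t)) c (is_derive_expR _) d1.
by rewrite mulrC.
Qed.

Lemma integral_expR_decay (R : realType) (L T : R) : 0 < L -> 0 < T ->
  (\int[lebesgue_measure]_(t in [set` `]0%R, T[]) (expR (- L * t))%:E
    <= (L^-1)%:E)%E.
Proof.
move=> L0 T0.
pose F (t : R) : R^o := - L^-1 * expR (- L * t).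
have d t : is_derive t (1 : R) F (expR (- L * t)).
  have d1 := is_derive_expR_lin (- L) t.
  have e : - L^-1 * (- L * expR (- L * t)) = expR (- L * t).
    by field; rewrite gt_eqF.
  rewrite -[X in is_derive _ _ _ X]e.
  exact: (@is_deriveZ _ _ _ (fun t => expR (- L * t)) (- L^-1) t 1 _ d1).
have ce : continuous (fun t => expR (- L * t)).
  exact/smooth1_continuous/smooth1_expR_lin.
have cF : continuous F.
  by move=> t; apply/differentiable_continuous/derivable1_diffP; case: (d t).
apply: (@le_trans _ _ (\int[lebesgue_measure]_(t in [set` `[0%R, T]]) (expR (- L * t))%:E)%E).
  apply: ge0_subset_integral => //.
  - by apply/measurable_EFinP; apply: measurable_funTS; exact: continuous_measurable_fun.
  - by apply: subset_itv; rewrite bnd_simp.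
rewrite (@continuous_FTC2 _ _ F)//.
- have h : - L^-1 * expR (- L * T) - (- L^-1 * expR (- L * 0)) <= L^-1.
    rewrite mulr0 expR0 mulr1 opprK gerDr mulNr oppr_le0.
    by rewrite mulr_ge0 ?expR_ge0// invr_ge0 ltW.
  exact: h.
- exact: continuous_subspaceT.
- split; first by move=> t _; case: (d t).
  + exact/cvg_at_right_filter/cF.
  + exact/cvg_at_left_filter/cF.
- by move=> t _; rewrite derive1E derive_val.
Qed.

(** * The integrand of the weak formulation *)

Section young.
Context (R : realType) (n : nat) (Omega : set 'rV[R]_n).
Hypothesis oO : open Omega.
Local Notation L2n v := (L2dot Omega v v).

Lemma L2dot_young v z (s e : R) : 0 < s -> 0 <= e -> L2 Omega v -> L2 Omega z ->
  `|L2dot Omega v z| * e <= s / 2 * L2n v + e ^+ 2 * L2n z / (2 * s).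
Proof.
move=> s0 e0 Lv Lz.
have key c : 0 <= s ^+ 2 * L2n v + 2 * s * (c * L2dot Omega v z) + c ^+ 2 * L2n z.
  have Lcz : L2 Omega (fun x => c * z x) by apply: L2_bmfM => //; exact: bmf_cst.
  have := @L2dot_ge0 R n Omega (fun x => s * v x + c * z x).
  rewrite (L2n_expand oO s Lv Lcz) (L2dotZ oO c Lz Lcz) (L2dotC Omega z) !(L2dotZ oO c Lz)//.
  by rewrite (L2dotC Omega z v) [c * (c * _)]mulrA -(expr2 c).
have h1 := key e; have h2 := key (- e).
have s2 : 0 < 2 * s by rewrite mulr_gt0.
rewrite -(ler_pM2l s2).
have -> : 2 * s * (s / 2 * L2n v + e ^+ 2 * L2n z / (2 * s)) =
  s ^+ 2 * L2n v + e ^+ 2 * L2n z by field; rewrite gt_eqF.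
move: h1 h2; rewrite sqrrN.
set a := L2dot _ v z; set A := _ * L2n v; set C := _ * L2n z => h1 h2.
have [a0|a0] := ger0P a; lra.
Qed.

End young.

Section main_estimate.
Context (R : realType) (n : nat) (Omega : set 'rV[R]_n).
Hypotheses (oO : open Omega) (bO : bounded_set Omega).
Local Notation E := 'rV[R]_n.
Local Notation leb := (@lebesgue_rV R n).
Local Notation L2n v := (L2dot Omega v v).
Local Notation N2 X := (wform Omega (@unitw R n) X X).
Local Notation gform v := (wform Omega (@gradw R n) (wjet Omega v) (wjet Omega v)).
Variables (p : E -> R) (p1 p2 mu eps T Lam : R).
Hypotheses (bp : bmf Omega p) (p1_gt0 : 0 < p1)
  (pb : forall x, Omega x -> p1 <= p x <= p2) (mu_gt0 : 0 < mu)
  (eps_gt0 : 0 < eps) (T_gt0 : 0 < T) (Lam_gt0 : 0 < Lam).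

(** The multiplier psi(t) of the test function psi(t) w'(x). Since
    psi' + Lam psi = - e^(- Lam t)/T, it annihilates the growth e^(Lam t) of
    the low modes, and it vanishes at the final time T. *)
Definition decay (t : R) : R := (1 - t / T) * expR (- Lam * t).

Lemma smooth1_decay : smooth1 decay.
Proof.
apply: smooth1_gen_smooth1; apply: (smooth1_genM (F := fun t => 1 - t / T)); last first.
  by apply: smooth1_gen_base; exact: smooth1_expR_lin.
apply: (smooth1_genD (F := fun=> 1) (G := fun t => - (t / T))).
  exact: smooth1_gen_cst.
rewrite (_ : (fun t => _) = fun t => - T^-1 * t); last first.
  by apply/funext => t; rewrite mulNr mulrC.
apply: (smooth1_genM (F := fun=> - T^-1) (G := id)); [exact: smooth1_gen_cst|exact: smooth1_gen_id].
Qed.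

Lemma derive1_decay t :
  derive1 decay t = - (expR (- Lam * t) / T) - Lam * decay t.
Proof.
have d1 : is_derive t (1 : R) (fun t => 1 - t / T) (- T^-1).
  have -> : (fun t => 1 - t / T) = fun t => 1 + - T^-1 * t.
    by apply/funext => r; rewrite mulNr mulrC.
  have d0 : is_derive t (1 : R) (fun t : R => - T^-1 * t) (- T^-1).
    by apply: is_derive_eq; rewrite -[_ *: _]/(_ * _) mulr1.
  have := is_derive1D (is_derive_cst (1 : R) t (1 : R)) d0.
  by rewrite add0r.
have d2 := is_derive_expR_lin (- Lam) t.
have := is_derive1M d1 d2 => d3.
rewrite derive1E derive_val /decay; ring.
Qed.

Lemma N2_gform u : H1 Omega u -> N2 (wjet Omega u) = L2n u + gform u.
Proof.
move=> hu; apply: EFin_inj; rewrite -(gradnorm2E oO hu) EFinD.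
by rewrite gradnorm2_wform// L2norm2E//; case: hu.
Qed.

Lemma decay_bound t : t \in `]0, T[ -> 0 <= decay t <= expR (- Lam * t).
Proof.
rewrite in_itv/= => /andP[t0 tT].
have h : 0 <= 1 - t / T by rewrite subr_ge0 ler_pdivrMr// mul1r ltW.
rewrite mulr_ge0 ?expR_ge0//= ler_piMl ?expR_ge0// lerBlDr lerDl.
by rewrite divr_ge0 ?ltW.
Qed.

(** The time derivative of the multiplier compensates for the bottom of the
    spectrum: what is left of the integrand is e^(- Lam t) (u, w') / T and the
    defect in the Euler equation. *)
Lemma integrand_bound sigma s w' d u t : 0 < sigma -> 0 < s ->
  test_fun Omega w' -> test_fun Omega d -> H1 Omega u ->
  L2n w' <= 5 / 2 -> L2n d <= 1 / 4 -> t \in `]0, T[ ->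
  `|qform Omega p mu eps Lam (cjet w') (wjet Omega u) + L2dot Omega d u|
    <= sigma * (1 + K2 p2 Lam * N2 (wjet Omega u)) ->
  `|- (L2dot Omega u w' * derive1 decay t) +
     energy_form Omega p mu eps u w' * decay t| <=
  (s + sigma * K2 p2 Lam) * L2n u +
  ((5 / (2 * T ^+ 2) + 1 / 4) / (2 * s) * expR (- Lam * t) ^+ 2 + sigma
   + sigma * K2 p2 Lam * gform u).
Proof.
move=> sg0 s0 tw' td hu w52 d14 tT.
rewrite derive1_decay (energy_formE oO bO Lam)// (N2_gform hu).
have /andP[ps0 pse] := decay_bound tT.
have e1 : decay t <= 1.
  apply: le_trans pse _; rewrite -expR0 ler_expR mulNr oppr_le0.
  by move: tT; rewrite in_itv/= => /andP[t0 _]; rewrite mulr_ge0 ?ltW.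
have e0 : 0 <= expR (- Lam * t) by exact: expR_ge0.
set e := expR _ in e0 pse *; set ps := decay t in ps0 pse e1 *.
set q := qform _ _ _ _ _ _ _; set k := L2dot _ d u; set m := L2dot _ u w'.
have Lu := hu.1; have Lw := L2_test oO bO tw'; have Ld := L2_test oO bO td.
have eT0 : 0 <= e / T by rewrite divr_ge0// ltW.
have hm := L2dot_young oO s0 eT0 Lu Lw.
have hk := L2dot_young oO s0 e0 Lu Ld.
rewrite (L2dotC Omega u d) in hk; rewrite -/m in hm; rewrite -/k in hk.
have hm' : `|m| * (e / T) <= s / 2 * L2n u + 5 / (2 * T ^+ 2) / (2 * s) * e ^+ 2.
  apply: le_trans hm _; rewrite lerD2l.
  have -> : 5 / (2 * T ^+ 2) / (2 * s) * e ^+ 2 = (e / T) ^+ 2 * (5 / 2) / (2 * s).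
    by field; rewrite !gt_eqF.
  by rewrite ler_wpM2r ?invr_ge0 ?mulr_ge0 ?(ltW s0)// ler_wpM2l// sqr_ge0.
have hk' : `|k| * e <= s / 2 * L2n u + 1 / 4 / (2 * s) * e ^+ 2.
  apply: le_trans hk _; rewrite lerD2l.
  have -> : 1 / 4 / (2 * s) * e ^+ 2 = e ^+ 2 * (1 / 4) / (2 * s).
    by field; rewrite !gt_eqF.
  by rewrite ler_wpM2r ?invr_ge0 ?mulr_ge0 ?(ltW s0)// ler_wpM2l// sqr_ge0.
move=> hq.
have -> : - (m * (- (e / T) - Lam * ps)) + (q - Lam * m) * ps =
    m * (e / T) + (q + k) * ps - k * ps by ring.
have h1 : `|(q + k) * ps| <= sigma * (1 + K2 p2 Lam * (L2n u + gform u)).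
  rewrite normrM (ger0_norm ps0); apply: le_trans hq; exact: ler_piMr.
have h2 : `|k * ps| <= `|k| * e.
  by rewrite normrM (ger0_norm ps0) ler_wpM2l.
have h3 : `|m * (e / T)| = `|m| * (e / T) by rewrite normrM (ger0_norm eT0).
apply: (le_trans (ler_normB _ _)); apply: (le_trans (lerD (ler_normD _ _) h2)).
rewrite h3.
set a := L2n u in hm' hk' h1 *; set g := gform u in h1 *.
have -> : (5 / (2 * T ^+ 2) + 1 / 4) / (2 * s) * e ^+ 2 =
  5 / (2 * T ^+ 2) / (2 * s) * e ^+ 2 + 1 / 4 / (2 * s) * e ^+ 2.
  by rewrite mulrDl mulrDl.
move: h1 hm' hk'; set X := K2 _ _; set A := _ / _ * e ^+ 2; set B := _ / _ * e ^+ 2; lra.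
Qed.

End main_estimate.

(** * Estimates in time *)

Section time_estimate.
Context (R : realType) (n : nat) (Omega : set 'rV[R]_n).
Hypotheses (oO : open Omega) (bO : bounded_set Omega).
Local Notation E := 'rV[R]_n.
Local Notation L2n v := (L2dot Omega v v).
Local Notation N2 X := (wform Omega (@unitw R n) X X).
Variables (p : E -> R) (p1 p2 mu eps T Lam : R).
Hypotheses (bp : bmf Omega p) (p1_gt0 : 0 < p1)
  (pb : forall x, Omega x -> p1 <= p x <= p2) (mu_gt0 : 0 < mu)
  (eps_gt0 : 0 < eps) (T_gt0 : 0 < T) (Lam_gt0 : 0 < Lam).

Let mT : measurable ([set` `]0%R, T[] : set R).
Proof. exact: measurable_itv. Qed.

Lemma measurable_expR_lin (c : R) (D : set R) :
  measurable_fun D (fun t => expR (c * t)).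
Proof.
apply: measurable_funTS; apply: continuous_measurable_fun.
exact/smooth1_continuous/smooth1_expR_lin.
Qed.

Lemma expR_sqr_lin (t : R) : expR (- Lam * t) ^+ 2 = expR (- (2 * Lam) * t).
Proof. by rewrite expr2 -expRD; congr expR; ring. Qed.

Lemma integral_gradnorm2 u : L2H10 Omega T u -> exists2 G : R, 0 <= G &
  (\int[lebesgue_measure]_(t in [set` `]0%R, T[]) gradnorm2 Omega (u t) <= G%:E)%E.
Proof.
move=> [uH _ fin].
have E1 : (\int[lebesgue_measure]_(t in [set` `]0%R, T[]) (H10norm Omega (u t) ^+ 2))%E =
    (\int[lebesgue_measure]_(t in [set` `]0%R, T[]) gradnorm2 Omega (u t))%E.
  apply: eq_integral => t; rewrite inE /= => tT; have [hu _] := uH t tT.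
  have h0 : (0 <= gradnorm2 Omega (u t))%E.
    by rewrite gradnorm2_wform// lee_fin; exact: gform_ge0.
  by rewrite /H10norm poweR12_sqrt// -expe2 sqr_sqrte.
move: fin; rewrite E1.
have : (0 <= \int[lebesgue_measure]_(t in [set` `]0%R, T[]) gradnorm2 Omega (u t))%E.
  apply: integral_ge0 => t tT; have [hu _] := uH t tT.
  by rewrite gradnorm2_wform// lee_fin; exact: gform_ge0.
by case: (integral _ _ _) => // r r0 _; exists r.
Qed.

(** Integration in time of the bound above. The squared L^2 norm of u is
    integrated by its lower integral, which the cost controls; all other terms
    are measurable in time. *)
Lemma lhs_estimate sigma s w' d u M G : 0 < sigma -> 0 < s ->
  test_fun Omega w' -> test_fun Omega d -> L2n w' <= 5 / 2 -> L2n d <= 1 / 4 ->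
  (forall v, H10 Omega v ->
   `|qform Omega p mu eps Lam (cjet w') (wjet Omega v) + L2dot Omega d v|
    <= sigma * (1 + K2 p2 Lam * N2 (wjet Omega v))) ->
  L2H10 Omega T u ->
  (\int[lebesgue_measure]_(t in [set` `]0%R, T[]) L2norm2 Omega (u t) <= M%:E)%E ->
  (\int[lebesgue_measure]_(t in [set` `]0%R, T[]) gradnorm2 Omega (u t) <= G%:E)%E ->
  `|\int[lebesgue_measure]_(t in [set` `]0%R, T[])
     (- (L2dot Omega (u t) w' * derive1 (decay T Lam) t) +
      energy_form Omega p mu eps (u t) w' * decay T Lam t)| <=
  (s + sigma * K2 p2 Lam) * M +
  ((5 / (2 * T ^+ 2) + 1 / 4) / (2 * s) / (2 * Lam) + sigma * T +
   sigma * K2 p2 Lam * G).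
Proof.
move=> sg0 s0 tw' td w52 d14 hE uL2 hM hG; have [uH _ _] := uL2.
have hu t : t \in `]0, T[ -> H1 Omega (u t) by move=> /uH [].
have K0 : 0 < K2 p2 Lam by rewrite ltr_wpDl// addr_ge0.
set B := (5 / _ + _) / (2 * s).
have B0 : 0 <= B.
  apply: divr_ge0; last by rewrite mulr_ge0 ?(ltW s0).
  by apply: addr_ge0; rewrite divr_ge0// mulr_ge0// sqr_ge0.
have c0 : 0 < s + sigma * K2 p2 Lam by rewrite addr_gt0// mulr_gt0.
have sK : 0 <= sigma * K2 p2 Lam by rewrite mulr_ge0 ?ltW.
have L0 t : (0 <= L2norm2 Omega (u t))%E.
  by apply: integral_ge0 => x _; rewrite lee_fin sqr_ge0.
have G0 t : t \in `]0, T[ -> (0 <= gradnorm2 Omega (u t))%E.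
  by move=> /hu h; rewrite gradnorm2_wform// lee_fin; exact: gform_ge0.
have mG := measurable_gradnorm2 oO bO uL2.
apply: (@Rintegral_lower_bound _ _ _ lebesgue_measure [set` `]0%R, T[] _
  (fun t => (s + sigma * K2 p2 Lam)%:E * L2norm2 Omega (u t))%E
  (fun t => (B * expR (- (2 * Lam) * t) + sigma)%:E +
     (sigma * K2 p2 Lam)%:E * gradnorm2 Omega (u t))%E) => //.
- by move=> t _; rewrite mule_ge0// lee_fin ltW.
- move=> t tT; rewrite adde_ge0//.
    by rewrite lee_fin addr_ge0 ?(ltW sg0)// mulr_ge0 ?expR_ge0.
  by rewrite mule_ge0 ?G0// lee_fin.
- apply: emeasurable_funD; last exact: measurable_funeM.
  apply/measurable_EFinP; apply: measurable_funD => //.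
  by apply: measurable_funM => //; exact: measurable_expR_lin.
- move=> t tT; have h := hu t tT.
  rewrite (gradnorm2_wform oO h) L2norm2E//; last by case: h.
  rewrite -!EFinM -!EFinD lee_fin -expR_sqr_lin.
  by apply: (integrand_bound oO bO bp _ _ _ _ sg0 s0 tw' td h) => //; exact/hE/uH.
- apply: (le_trans (lower_integralZ_le _ _ _ _)) => //.
  by rewrite [leRHS]EFinM lee_pmul2l// lte_fin.
- rewrite ge0_integralD//=; first last.
  + exact: measurable_funeM.
  + by move=> t tT; rewrite mule_ge0 ?G0// lee_fin.
  + apply/measurable_EFinP; apply: measurable_funD => //.
    by apply: measurable_funM => //; exact: measurable_expR_lin.
  + by move=> t _; rewrite lee_fin addr_ge0 ?(ltW sg0)// mulr_ge0 ?expR_ge0.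
  rewrite EFinD; apply: leeD; last first.
    rewrite ge0_integralZl_EFin// [leRHS]EFinM.
        by apply: lee_wpmul2l; rewrite ?lee_fin.
  under eq_integral do rewrite EFinD.
  rewrite ge0_integralD//=; first last.
  + by move=> t _; rewrite lee_fin ltW.
  + apply/measurable_EFinP.
    by apply: measurable_funM => //; exact: measurable_expR_lin.
  + by move=> t _; rewrite lee_fin mulr_ge0 ?expR_ge0.
  rewrite EFinD; apply: leeD; last first.
    rewrite integral_cst// EFinM; apply: lee_wpmul2l; first by rewrite lee_fin ltW.
    by have := lebesgue_measure_itv `]0, T[; rewrite /= lte_fin T_gt0 sube0 => ->.
  under eq_integral do rewrite EFinM.
  rewrite ge0_integralZl_EFin//.
  + rewrite [leRHS]EFinM; apply: lee_wpmul2l; first by rewrite lee_fin.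
    by apply: integral_expR_decay => //; rewrite mulr_gt0.
  + by apply/measurable_EFinP; exact: measurable_expR_lin.
Qed.

(** The control sees only v, the part of w' away from the singularity, whose
    Dirichlet integral is at most K. *)
Lemma rhs_estimate s f w' v K M : 0 < s -> 0 < K ->
  (forall t, t \in `]0, T[ -> Hm1 Omega (f t)) ->
  test_fun Omega v -> dirichlet Omega v <= K ->
  {ae lebesgue_measure, forall t : measurableTypeR R, t \in `]0, T[ -> f t w' = f t v} ->
  (\int[lebesgue_measure]_(t in [set` `]0%R, T[]) (Hm1norm Omega (f t) ^+ 2) <= M%:E)%E ->
  `|\int[lebesgue_measure]_(t in [set` `]0%R, T[]) (f t w' * decay T Lam t)|
  <= s / 2 * M + K / (2 * s) / (2 * Lam).
Proof.
move=> s0 K0 fH tv vK fv hM.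
have s20 : 0 < s / 2 by rewrite divr_gt0.
have KB0 : 0 <= K / (2 * s) by rewrite divr_ge0 ?mulr_ge0// ltW.
have H0 (l : (E -> R) -> R) : (0 <= Hm1norm Omega l ^+ 2)%E.
  by rewrite expe2; case: (Hm1norm _ _) => [r| |]//=; rewrite lee_fin -expr2 sqr_ge0.
apply: (@Rintegral_lower_bound_ae _ _ _ lebesgue_measure [set` `]0%R, T[] _
  (fun t => (s / 2)%:E * Hm1norm Omega (f t) ^+ 2)%E
  (fun t => (K / (2 * s) * expR (- (2 * Lam) * t))%:E)) => //.
- by move=> t _; rewrite mule_ge0// lee_fin ltW.
- by move=> t _; rewrite lee_fin mulr_ge0 ?expR_ge0.
- apply/measurable_EFinP; apply: measurable_funM => //; exact: measurable_expR_lin.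
- apply: filterS fv => t ftv tT; rewrite ftv//.
  have := Hm1norm_test oO bO (fH t tT) tv K0 vK.
  have /andP[ps0 pse] := decay_bound Lam T_gt0 tT.
  rewrite -expR_sqr_lin.
  set e := expR _ in pse *; set ps := decay _ _ _ in ps0 pse *.
  case: (Hm1norm Omega (f t)) => [h| |].
  + rewrite -EFin_expe -!EFinM -EFinD !lee_fin => fh.
    rewrite normrM (ger0_norm ps0).
    have sK2 : Num.sqrt K ^+ 2 = K by rewrite sqr_sqrtr// ltW.
    have k0 := sqrtr_ge0 K.
    set k := Num.sqrt K in fh sK2 k0.
    have a0 := normr_ge0 (f t v); set a := `|_| in fh a0 *.
    have h1 : a * ps <= k * h * e by apply: ler_pM.
    apply: le_trans h1 _; rewrite -sK2 -subr_ge0.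
    have -> : s / 2 * h ^+ 2 + k ^+ 2 / (2 * s) * e ^+ 2 - k * h * e =
       (s * h - k * e) ^+ 2 / (2 * s) by field; rewrite gt_eqF.
    by rewrite divr_ge0 ?sqr_ge0// mulr_ge0// ltW.
  + by move=> _; rewrite expe2 mulyy gt0_muley ?lte_fin// addye// leey.
  + by rewrite gt0_muleNy ?lte_fin ?sqrtr_gt0.
- apply: (le_trans (lower_integralZ_le _ _ _ _)) => //.
  by rewrite [leRHS]EFinM lee_pmul2l// lte_fin.
- under eq_integral do rewrite EFinM.
  rewrite ge0_integralZl_EFin//.
  + rewrite [leRHS]EFinM; apply: lee_wpmul2l; first by rewrite lee_fin.
    by apply: integral_expR_decay => //; rewrite mulr_gt0.
  + by apply/measurable_EFinP; exact: measurable_expR_lin.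
Qed.

End time_estimate.

(** * Failure of the uniform bound *)

Theorem theorem4p1 (R : realType) (n : nat) (T : R)
    (Omega omega : set 'rV[R]_n) (p : 'rV[R]_n -> R) (p1 p2 p3 mu : R)
    (n_ge3 : (3 <= n)%N) (T_gt0 : 0 < T)
    (Omega_domain : domain Omega) (Omega_bounded : bounded_set Omega)
    (Omega_0 : Omega 0) (Omega_C2 : Ck_boundary 2 Omega)
    (omega_open : open omega) (omega_neq0 : omega !=set0)
    (omega_Omega : omega `<=` Omega)
    (p1_gt0 : 0 < p1) (p1_p2 : p1 <= p2) (p3_ge0 : 0 <= p3)
    (p_C3 : Ck_closure 3 Omega p)
    (p_bounds : forall x, closure Omega x -> p1 <= p x <= p2)
    (gradp_bound : forall x, closure Omega x ->
      enorm (grad_closure Omega p x) <= p3)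
    (mu_gt : p2 * ((n%:R - 2) ^+ 2 / 4) < mu)
    (omega_0 : ~ closure omega 0) :
  ~ exists C : R, forall (eps : R) (u0 : 'rV[R]_n -> R),
      0 < eps -> L2 Omega u0 ->
      (inf_cost Omega T p mu omega eps u0 <= C%:E * L2norm2 Omega u0)%E.
Proof.
move=> [C hC].
have [oO _ _] := Omega_domain.
have bO := Omega_bounded.
have pb x : Omega x -> p1 <= p x <= p2.
  by move=> Ox; apply: p_bounds; exact: subset_closure.
have p2_gt0 : 0 < p2 := lt_le_trans p1_gt0 p1_p2.
have bp : bmf Omega p.
  split.
    have [[cp _] _ _] := p_C3.
    exact: continuous_in_measurable_rV.
  exists p2 => x /pb /andP[h1 h2]; rewrite ger0_norm//.
  exact: le_trans (ltW p1_gt0) h1.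
have mu_gt0 : 0 < mu.
  apply: le_lt_trans mu_gt; rewrite mulr_ge0 ?(ltW p2_gt0)//.
  by rewrite divr_ge0// sqr_ge0.
(* On this neighbourhood of 0 the control does not act. *)
pose U := Omega `\` closure omega.
have oU : open U.
  by apply: openI => //; apply: closed_openC; exact: closed_closure.
have U0 : U 0 by [].
have UO : U `<=` Omega by move=> x [].
have [th [K [tth K0 loc]]] :=
  localisation oO bO bp p1_gt0 pb mu_gt0 (ltW p2_gt0) oU U0 UO.
(* M bounds both terms of the cost, s is the small parameter of Young's
   inequality, and A collects what remains with the factor 1/(2 Lam). *)
pose M := 2 * (`|C| + 1).
have M0 : 0 < M by rewrite mulr_gt0// ltr_wpDl.
pose s := (6 * M)^-1.
have s0 : 0 < s by rewrite invr_gt0 mulr_gt0.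
pose A := (5 / (2 * T ^+ 2) + 1 / 4) / (2 * s) + K / (2 * s).
have A0 : 0 <= A.
  have s2 : 0 <= 2 * s by rewrite mulr_ge0// ltW.
  apply: addr_ge0; apply: divr_ge0 => //; last exact: ltW.
  by apply: addr_ge0; rewrite divr_ge0// mulr_ge0// sqr_ge0.
have p_le x : Omega x -> p x <= p2 by move=> /pb /andP[].
have [eps [phi0 [eps0 tphi0 phi00 hphi0]]] :=
  hardy_test (8 * A + 1) oO bO Omega_0 n_ge3 p2_gt0 bp p_le mu_gt.
have [Lam [w [LsLam Q0 tw w1 Qw]]] :=
  ground_level oO bO bp p1_gt0 pb mu_gt0 eps0 tphi0 phi00 hphi0.
have Lam0 : 0 < Lam by apply: lt_le_trans LsLam; rewrite ltr_wpDl// mulr_ge0.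
have Lw := L2_test oO bO tw.
have : (inf_cost Omega T p mu omega eps w < (`|C| + 1)%:E)%E.
  apply: le_lt_trans (hC eps w eps0 Lw) _.
  rewrite L2norm2E// w1 mule1 lte_fin (le_lt_trans (ler_norm C))//.
  by rewrite ltrDl.
move=> /ereal_inf_lt[_ [f [u [[fH _ _] floc [uL2 eqn] ->]]]].
have half (a b : \bar R) : (0 <= a -> 0 <= b ->
    2^-1%:E * a + 2^-1%:E * b < (`|C| + 1)%:E -> a <= M%:E /\ b <= M%:E)%E.
  case: a => [a| |]; case: b => [b| |]//=.
  - rewrite !lee_fin -!EFinM -EFinD lte_fin /M => a0 b0 h; split; lra.
  - by rewrite gt0_muley ?lte_fin// addey.
  - by rewrite gt0_muley ?lte_fin// addye.
  - by rewrite gt0_muley ?lte_fin// addye.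
rewrite /cost => /half [||hu hf].
- by apply: integral_ge0 => t _; apply: integral_ge0 => x _; rewrite lee_fin sqr_ge0.
- apply: integral_ge0 => t _; rewrite expe2.
  by case: (Hm1norm _ _) => [r| |]//=; rewrite lee_fin -expr2 sqr_ge0.
have [G G0 hG] := integral_gradnorm2 oO uL2.
have K20 : 0 < K2 p2 Lam by rewrite ltr_wpDl// addr_ge0.
(* All the errors of the Euler equation add up to sigma * X. The bound G for
   the gradient of u depends on w but not on sigma. *)
pose X := K2 p2 Lam * M + T + K2 p2 Lam * G.
have X0 : 0 < X.
  by rewrite ltr_wpDr ?mulr_ge0 ?(ltW K20)// addr_gt0// mulr_gt0.
pose sigma := (16 * X)^-1.
have sigma0 : 0 < sigma by rewrite invr_gt0 mulr_gt0.
have [w' [tw' Qw' d14 eul]] := near_minimizer oO bO bp pb mu_gt0 eps0 Q0 tw Qw sigma0.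
(* The datum w and the test function w' are at distance at most 1/2. *)
set d := (fun x => -1 * w x + w' x) in d14 eul.
have Lw' := L2_test oO bO tw'.
have td : test_fun Omega d by apply: test_funD => //; exact: test_funZ.
have Ld := L2_test oO bO td.
have w'E : w' = fun x => 1 * w x + d x by apply/funext => x; rewrite /d; ring.
have w'52 : L2dot Omega w' w' <= 5 / 2.
  have h1 := L2n_expand oO 1 Lw Ld; have h2 := L2n_expand oO (-1) Lw Ld.
  have h3 := @L2dot_ge0 R n Omega (fun x => -1 * w x + d x).
  rewrite [in leLHS]w'E h1; move: h3; rewrite h2 w1; lra.
have ww' : 1 / 2 <= L2dot Omega w w'.
  have h1 := L2n_expand oO (1 / 2) Lw Ld.
  have h3 := @L2dot_ge0 R n Omega (fun x => 1 / 2 * w x + d x).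
  rewrite L2dotC [in leRHS]w'E L2dot_lin// w1; move: h3; rewrite h1 w1; lra.
have [tv vK] := loc eps Lam w' eps0 (ltW Lam0) Q0 tw' Qw' w'52.
set v := (fun x => -1 * (th x * w' x) + w' x) in tv vK.
have tthw : test_fun Omega (fun x => th x * w' x).
  by apply: test_funMl => //; exact: test_fun_smooth tth.
(* The control vanishes on th * w', hence acts on w' as on v. *)
have fv : {ae lebesgue_measure, forall t : measurableTypeR R,
    t \in `]0, T[ -> f t w' = f t v}.
  apply: filterS (floc th tth) => t ft tT.
  have [lin _] := fH t tT.
  by rewrite /v lin ?ft//; [ring|exact: H10_test..].
have sd : smooth1 (decay T Lam) by exact: smooth1_decay.
have := eqn w' (decay T Lam) (H10_test oO bO tw') (fun t => smooth1_derivable sd)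
  (smooth1_continuous (smooth1_derive1 sd)).
have -> : decay T Lam T = 0 by rewrite /decay divff ?gt_eqF// subrr mul0r.
have -> : decay T Lam 0 = 1 by rewrite /decay mul0r subr0 mul1r mulr0 expR0.
rewrite mulr1 => /(_ erefl) E.
have eul' y := euler_H10 oO bO bp mu_gt0 eps0 tw' td sigma0 eul (u := y).
have hr := rhs_estimate oO bO T_gt0 Lam0 s0 K0 fH tv vK fv hf.
have := lhs_estimate oO bO bp mu_gt0 eps0 T_gt0 Lam0 sigma0 s0 tw' td w'52 d14 eul' uL2 hu hG.
rewrite E => /(le_trans (ler_norm _)) hl.
have {}hr := le_trans (ler_norm _) (eq_rect _ (fun r => r <= _) hr _ (esym (normrN _))).
have sM : s * M = 1 / 6 by rewrite /s; field; rewrite gt_eqF.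
have sX : sigma * X = 1 / 16 by rewrite /sigma; field; rewrite gt_eqF.
have hA : A / (2 * Lam) <= 1 / 16.
  rewrite ler_pdivrMr ?mulr_gt0//.
  have -> : 1 / 16 * (2 * Lam) = Lam / 8 by field.
  by rewrite ler_pdivlMr//; move: LsLam; lra.
move: hA; rewrite /A mulrDl => hA.
have : sigma * X = sigma * K2 p2 Lam * M + sigma * T + sigma * K2 p2 Lam * G.
  by rewrite /X; ring.
rewrite sX => sX'.
have hlM : (s + sigma * K2 p2 Lam) * M = 1 / 6 + sigma * K2 p2 Lam * M.
  by rewrite mulrDl sM.
have hsM : s / 2 * M = 1 / 12 by rewrite mulrAC sM; field.
move: hl hr; rewrite hlM hsM.
set a := _ / (2 * Lam) in hA *; set b := _ / (2 * Lam) in hA *.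
set F := Rintegral _ _ _; set r1 := sigma * _ * M in sX' *; set r2 := sigma * T in sX' *.
set r3 := sigma * _ * G in sX' *; lra.
Qed.
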